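(* Let $\Sigma^2=\sup\{\sigma^2(\mathcal{S}\mu):\mu\text{ measurable},\ |\mu|\leqslant\chi_{\mathbb{D}}\}$. Then \[ \Sigma^2=\sup_{\mu\in M_{ei},\ |\mu|\leqslant\chi_{\mathbb{D}}}\sigma^2(\mathcal{S}\mu)=\sup_{\mu\in M_{pp},\ |\mu|\leqslant\chi_{\mathbb{D}}}\sigma^2(\mathcal{S}\mu). \]
   Context: All Beltrami coefficients $\mu$ are measurable functions supported in the unit disk $\mathbb{D}$. For $f(z)=z^d$, $(f^*\mu)(z)=\mu(f(z))\,\overline{f'(z)}/f'(z)$. $M_{ei}(d)$ is the set of $\mu$ that are eventually invariant under $z\mapsto z^d$, i.e. $(z^d)^*\mu=\mu$ on $U\cap\mathbb{D}$ for some open neighbourhood $U$ of the unit circle; $M_{ei}=\bigcup_{d\geqslant2}M_{ei}(d)$. $M_{pp}(d)$ is the set of $\mu\in M_{ei}(d)$ whose Cauchy transform $\mathcal C\mu(z)=\frac{1}{\pi}\int\frac{\mu(\zeta)}{z-\zeta}dm(\zeta)$ satisfies, for $|z|>1$, $\mathcal C\mu(z)=\frac{z}{d}\sum_{k\geqslant0}\frac{Q(z^{d^k})}{d^kz^{d^{k+1}}}$ for some polynomial $Q$ of degree at most $d-2$ (this is the infinitesimal vector field of the polynomial family $z^d+tQ(z)$); $M_{pp}=\bigcup_{d\geqslant2}M_{pp}(d)$. The Beurling transform is $\mathcal{S}\mu(z)=-\frac{1}{\pi}\,\mathrm{p.v.}\int\frac{\mu(w)}{(z-w)^2}dm(w)$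 and $\sigma^2(g)=\frac{1}{2\pi}\limsup_{R\to1^+}\frac{1}{|\log(R-1)|}\int_{|z|=R}|g|^2|dz|$. *)

(* Defs.v *)
From HB Require Import structures.
From mathcomp Require Import all_boot all_order all_algebra.
From mathcomp Require Import all_classical all_reals all_analysis.
From mathcomp Require Import complex.
Set Implicit Arguments. Unset Strict Implicit. Unset Printing Implicit Defensive.
Import Order.TTheory GRing.Theory Num.Theory numFieldNormedType.Exports.
Local Open Scope classical_set_scope.
Local Open Scope ring_scope.
Local Open Scope complex_scope.

Section Defs.
Variable R : realType.

Definition toC (p : R * R) : R[i] := p.1 +i* p.2.

Definition leb2 := ((@lebesgue_measure R) \x (@lebesgue_measure R))%E.

Definition in_disk (z : R[i]) : Prop := Normc.normc z < 1.

Definition chiD (z : R[i]) : R := if `[< in_disk z >] then 1 else 0.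

Definition cmeasurable (f : R[i] -> R[i]) : Prop :=
  measurable_fun setT (fun p => complex.Re (f (toC p))) /\
  measurable_fun setT (fun p => complex.Im (f (toC p))).

Definition bounded_by_chiD (mu : R[i] -> R[i]) : Prop :=
  forall z, Normc.normc (mu z) <= chiD z.

Definition cintegral (A : set R[i]) (f : R[i] -> R[i]) : R[i] :=
  (Rintegral leb2 (toC @^-1` A) (fun p => complex.Re (f (toC p))))
  +i* (Rintegral leb2 (toC @^-1` A) (fun p => complex.Im (f (toC p)))).

Definition cauchy_tr (mu : R[i] -> R[i]) (z : R[i]) : R[i] :=
  (pi^-1)%:C * cintegral setT (fun w => mu w / (z - w)).

Definition beurling_trunc (mu : R[i] -> R[i]) (z : R[i]) (eps : R) : R[i] :=
  - (pi^-1)%:C * cintegral [set w | eps < Normc.normc (z - w)]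
                    (fun w => mu w / (z - w) ^+ 2).

Definition beurling (mu : R[i] -> R[i]) (z : R[i]) : R[i] :=
  (lim (complex.Re (beurling_trunc mu z eps) @[eps --> 0^'+]))
  +i* (lim (complex.Im (beurling_trunc mu z eps) @[eps --> 0^'+])).

Definition circle_int (g : R[i] -> R[i]) (r : R) : \bar R :=
  (\int[@lebesgue_measure R]_(t in `[0%R, (2 * pi)%R]%classic)
      ((Normc.normc (g ((r * cos t) +i* (r * sin t)))) ^+ 2 * r)%:E)%E.

Definition sigma2 (g : R[i] -> R[i]) : \bar R :=
  ((2 * pi)^-1)%:E *
  limf_esup (fun r : R => ((`|ln (r - 1)|)^-1)%:E * circle_int g r)%E (1^'+).

Definition pullback_pow (d : nat) (mu : R[i] -> R[i]) (z : R[i]) : R[i] :=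
  mu (z ^+ d) * (d%:R * z ^+ d.-1)^* / (d%:R * z ^+ d.-1).

Definition unit_circle : set (R * R) := [set p | Normc.normc (toC p) = 1].

Definition eventually_invariant (d : nat) (mu : R[i] -> R[i]) : Prop :=
  exists U : set (R * R), open U /\ unit_circle `<=` U /\
    {ae leb2, forall p, U p -> in_disk (toC p) ->
        pullback_pow d mu (toC p) = mu (toC p)}.

Definition M_ei (mu : R[i] -> R[i]) : Prop :=
  exists d : nat, (2 <= d)%N /\ eventually_invariant d mu.

Definition pp_term (d : nat) (Q : {poly R[i]}) (z : R[i]) (k : nat) : R[i] :=
  Q.[z ^+ (d ^ k)%N] / ((d ^ k)%N%:R * z ^+ (d ^ k.+1)%N).

Definition M_pp_d (d : nat) (mu : R[i] -> R[i]) : Prop :=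
  eventually_invariant d mu /\
  exists Q : {poly R[i]}, (size Q <= d.-1)%N /\
    forall z : R[i], 1 < Normc.normc z ->
      ((fun n => complex.Re (z / d%:R * \sum_(k < n) pp_term d Q z k)) @ \oo
         --> complex.Re (cauchy_tr mu z)) /\
      ((fun n => complex.Im (z / d%:R * \sum_(k < n) pp_term d Q z k)) @ \oo
         --> complex.Im (cauchy_tr mu z)).

Definition M_pp (mu : R[i] -> R[i]) : Prop :=
  exists d : nat, (2 <= d)%N /\ M_pp_d d mu.

Definition admissible (mu : R[i] -> R[i]) : Prop :=
  cmeasurable mu /\ bounded_by_chiD mu.

Definition Sigma2 : \bar R :=
  ereal_sup [set sigma2 (beurling mu) | mu in admissible].

End Defs.

(* Main.v *)
(* Expanding the Beurling kernel at infinity, [sigma2 (beurling mu)] is governed by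
   the sums of [a_n ^ 2] for [n < N], where [a_n = (n+1)/pi |int mu z^n|], with
   [ln N] comparable to [|ln (r - 1)|].

   Given [mu] and [L], put [D = 2L]. Take [mu] on the annulus
   [1/2 <= |z|, |z|^D < 1/2], replace [mu e^(-2it)] by its Fejer mean of order [L]
   in the angle (the Fejer kernel is positive, so the bound by 1 survives, and the
   frequencies of modulus at least [L] disappear), and pull the result back by
   [z^(2 D^k)] for all [k]. The pulled back annuli tile [2^(-1/2) <= |z| < 1], so
   that the resulting [nu] is invariant under [z^D] near the circle. Its moments
   vanish except in the orders [2 D^k M - 2] with [0 < M < L], where they are
   [1 / (2 D^k)] times a quantity depending only on [M]; hence its Cauchy transform
   is the lacunary series of a polynomial of degree at most [D - 2]. Each generation
   [k] contributes the same block of coefficients, whose square norm [B] gives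
   [sigma2 (beurling nu) >= B / ln D].

   On the [mu] side, the parts of [mu] in [|z| < 1/2] and in [|z|^D >= 1/2]
   contribute a bounded amount to the sum of [a_n ^ 2] over [n < N] as soon as
   [L > N]: this is Bessel's inequality in the angle, the second annulus having width
   at most [1/D]. So that sum is at most about [B] when [L = K (N + 1)] with [K] large.
   Taking [r] which nearly realizes [sigma2 (beurling mu)] and [N] close to
   [8 |ln (r - 1)| / (r - 1)], one has [ln D ~ |ln (r - 1)|], and
   [sigma2 (beurling nu)] is as close to [sigma2 (beurling mu)] as desired. *)
From HB Require Import structures.
Require Import Defs.
From mathcomp Require Import all_boot all_order all_algebra.
From mathcomp Require Import all_classical all_reals all_analysis.
From mathcomp Require Import complex.
From mathcomp Require Import measurable_realfun ring lra zify.
Set Implicit Arguments. Unset Strict Implicit. Unset Printing Implicit Defensive.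
Import Order.TTheory GRing.Theory Num.Theory numFieldNormedType.Exports.
Local Open Scope classical_set_scope.
Local Open Scope ring_scope.
Local Open Scope complex_scope.

(** One good radius for [mu] is enough: the limsup only provides isolated radii at which [mu] is
    nearly extremal, and nothing is known between them. The pull-backs copy what happens down to the
    scale r - 1 into every later scale, so that [nu] does as well on all circles of radius 1 + D^-k.
    The price is that |ln (r - 1)| becomes ln D; this is harmless, since D is 1 / (r - 1) up to a
    factor of order K |ln (r - 1)|, whose logarithm is negligible. Two constraints on the competitor
    are rigid: |nu| <= 1 exactly, and one polynomial of degree at most D - 2 for all generations.
    Cutting the frequencies sharply would break the first. The Fejer weights 1 - M / L preserve it,
    and on the orders that matter, M <= N + 1, they are at least 1 - 1 / K. Square norms are
    compared through |a + b|^2 <= (1 + x) |a|^2 + (1 + 1 / x) |b|^2, which keeps the leading factor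
    near 1 and leaves the errors in constants that the division by the logarithm kills. *)

Notation Re := complex.Re.
Notation Im := complex.Im.
Notation normc := Normc.normc.

(** * Polar coordinates *)

Section density.
Local Open Scope ereal_scope.
Context d (T : measurableType d) (R : realType) (mu : {measure set T -> \bar R}).
Variables (D : set T) (mD : measurable D) (g : T -> R).
Hypotheses (mg : measurable_fun D g) (g0 : forall x, D x -> (0 <= g x)%R).

(* The unused proof arguments let the measure structure be attached to this head. *)
Definition mdensity of measurable D & measurable_fun D g &
  (forall x, D x -> (0 <= g x)%R) := fun A : set T =>
  \int[mu]_(x in D `&` A) (g x)%:E.

Local Notation mdens := (mdensity mD mg g0).

Let mdensity0 : mdens set0 = 0.
Proof. by rewrite /mdensity setI0 integral_set0. Qed.

Let mdensity_ge0 A : 0 <= mdens A.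
Proof. by apply: integral_ge0 => x [Dx _]; rewrite lee_fin; exact: g0. Qed.

Let mdensity_sigma_additive : semi_sigma_additive mdens.
Proof.
move=> F mF tF mUF; rewrite /mdensity setI_bigcupr.
have mDF k : measurable (D `&` F k) by exact: measurableI.
have tDF : trivIset setT (fun k => D `&` F k).
  by apply: trivIset_setIl.
rewrite ge0_integral_bigcup//.
- by apply: is_cvg_nneseries => n _ _; apply: integral_ge0 => x [Dx _]; rewrite lee_fin; exact: g0.
- apply/measurable_EFinP; apply: measurable_funS mg => //.
  by rewrite -setI_bigcupr; exact: subIsetl.
- by move=> x [k _ [Dx _]]; rewrite lee_fin; exact: g0.
Qed.

HB.instance Definition _ := isMeasure.Build _ _ _ mdens
  mdensity0 mdensity_ge0 mdensity_sigma_additive.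

Import HBNNSimple.

(** Approximating [f] from below by simple functions reduces the identity, by monotone convergence
    on both sides, to level sets, where it is the definition of [mdensity]. *)
Lemma ge0_integral_mdensity (f : T -> \bar R) :
  measurable_fun setT f -> (forall x, 0 <= f x) ->
  \int[mdens]_x f x = \int[mu]_(x in D) (f x * (g x)%:E).
Proof.
move=> mf f0; pose h := nnsfun_approx measurableT mf.
have hE x : EFin \o h^~ x @ \oo --> f x by apply: cvg_nnsfun_approx.
have -> : \int[mdens]_x f x =
    lim (\int[mdens]_x (EFin \o h n) x @[n --> \oo]).
  have fE x : f x = lim ((EFin \o h n) x @[n --> \oo]).
    by apply/esym/cvg_lim => //; exact: hE.
  under eq_integral => x _ do rewrite fE.
  apply: monotone_convergence => //.
  - by move=> n; apply/measurable_EFinP.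
  - by move=> n x _ /=; rewrite lee_fin.
  - by move=> x _ a b ab; rewrite lee_fin; exact/lefP/nd_nnsfun_approx.
have -> : \int[mu]_(x in D) (f x * (g x)%:E) =
    lim (\int[mu]_(x in D) ((EFin \o h n) x * (g x)%:E) @[n --> \oo]).
  have fg x : f x * (g x)%:E = lim ((EFin \o h n) x * (g x)%:E @[n --> \oo]).
    by apply/esym/cvg_lim => //; apply: cvgeZr => //; exact: hE.
  under eq_integral => x _ do rewrite fg.
  apply: (@monotone_convergence _ _ _ mu D mD
    (fun n x => (EFin \o h n) x * (g x)%:E)).
  - move=> n; apply/emeasurable_funM.
      by apply/measurable_EFinP; exact: measurable_funTS.
    exact/measurable_EFinP.
  - by move=> n x Dx /=; rewrite mule_ge0 ?lee_fin ?g0.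
  - by move=> x Dx a b ab/=; rewrite lee_wpmul2r ?lee_fin ?g0//; exact/lefP/nd_nnsfun_approx.
congr (lim (_ @ \oo)); apply/funext => n.
transitivity (\int[mdens]_x
   (\sum_(y \in range (h n)) (y * \1_(h n @^-1` [set y]) x)%:E)).
  by apply: eq_integral => t tE; rewrite /= fimfunE -fsumEFin.
rewrite ge0_integral_fsum//; last 2 first.
- by move=> r; apply/measurable_EFinP; exact: measurable_funM.
- by move=> m y _; exact: nnfun_muleindic_ge0.
transitivity (\int[mu]_(x in D) (\sum_(y \in range (h n))
    (y * \1_(h n @^-1` [set y]) x)%:E * (g x)%:E)); last first.
  apply: eq_integral => x xE.
  rewrite -ge0_mule_fsuml => [|y]; last exact: nnfun_muleindic_ge0.
  by rewrite fsumEFin // -(fimfunE _ x).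
have mind r : measurable_fun D (fun x => (\1_(h n @^-1` [set r]) x)%:E : \bar R).
  by apply/measurable_EFinP; exact: measurable_funTS.
rewrite ge0_integral_fsum//; last 2 first.
- move=> y; apply: emeasurable_funM => //; last exact/measurable_EFinP.
  apply: (eq_measurable_fun (fun x => y%:E * (\1_(h n @^-1` [set y]) x)%:E)).
    by move=> x _; rewrite EFinM.
  exact: emeasurable_funM.
- by move=> m y Ey; apply: mule_ge0; [exact: nnfun_muleindic_ge0|rewrite lee_fin g0].
apply: eq_fsbigr => r rhn.
rewrite integralZl_indic_nnsfun// integral_indic// setIT.
under eq_integral do rewrite EFinM -muleA.
have r0 : (0 <= r)%R by move/set_mem: rhn => [x _ <-].
rewrite ge0_integralZl//; last 2 first.
- by apply: emeasurable_funM => //; exact/measurable_EFinP.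
- by move=> x Dx; rewrite mule_ge0// lee_fin ?g0.
congr (_ * _).
transitivity (\int[mu]_(x in D `&` (h n @^-1` [set r])) (g x)%:E) => //.
rewrite integral_mkcondr; apply: eq_integral => x _.
by rewrite epatch_indic muleC.
Qed.

End density.

(** * Change of variable on an interval *)

Section substitution.
Local Open Scope ereal_scope.
Context {R : realType}.
Local Notation leb := (@lebesgue_measure R).
Implicit Types (F f : R -> R) (a b : R) (h : R -> \bar R).

Lemma integral_derive_oc F f a b : (a < b)%R -> continuous F -> continuous f ->
  (forall x, x \in `]a, b[ -> is_derive x 1%R F (f x)) ->
  \int[leb]_(x in `]a, b]) (f x)%:E = (F b - F a)%:E.
Proof.
move=> ab cF cf dF; rewrite EFinB.
rewrite integral_itv_obnd_cbnd; last first.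
  by apply/measurable_EFinP; apply: measurable_funTS; exact: continuous_measurable_fun.
rewrite (@continuous_FTC2 _ f F)//.
- exact: continuous_subspaceT.
- split.
  + by move=> x xab; exact: (@ex_derive _ _ _ _ _ _ _ (dF x xab)).
  + exact: cvg_at_right_filter (cF _).
  + exact: cvg_at_left_filter (cF _).
- by move=> x xab; rewrite derive1E; exact: (@derive_val _ _ _ _ _ _ _ (dF x xab)).
Qed.

(** Lebesgue measure on []F a, F b]] is the push-forward by [F] of the density [f] on []a, b]]: the
    two agree on half-open intervals by the fundamental theorem of calculus, hence everywhere by
    uniqueness of Lebesgue measure. *)
Lemma ge0_integral_substitution_oc F f a b h :
  (a < b)%R -> continuous F -> continuous f ->
  (forall x, x \in `]a, b[ -> is_derive x 1%R F (f x)) ->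
  (forall x, x \in `[a, b] -> (0 <= f x)%R) ->
  {in `[a, b] &, {homo F : x y / (x < y)%R}} ->
  measurable_fun setT h -> (forall x, 0 <= h x) ->
  \int[leb]_(x in `]F a, F b]) h x =
  \int[leb]_(x in `]a, b]) (h (F x) * (f x)%:E).
Proof.
move=> ab cF cf dF f0 iF mh h0.
pose D : set (measurableTypeR R) := `]a, b]%classic.
pose J : set (measurableTypeR R) := `]F a, F b]%classic.
have mD : measurable D by exact: measurable_itv.
have mJ : measurable J by exact: measurable_itv.
have mf : measurable_fun D f.
  by apply: measurable_funTS; exact: continuous_measurable_fun.
have fD x : D x -> (0 <= f x)%R.
  by rewrite /D/= in_itv/= => /andP[ax xb]; apply: f0; rewrite in_itv/= (ltW ax).
pose F' : measurableTypeR R -> measurableTypeR R := F.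
have mF : measurable_fun setT F' by exact: continuous_measurable_fun.
have leF : {in `[a, b] &, {homo F : x y / (x <= y)%R}}.
  move=> x y xab yab; rewrite le_eqVlt => /predU1P[->//|xy].
  by apply/ltW/iF.
pose m2 : {measure set (measurableTypeR R) -> \bar R} :=
  measure_function_pushforward__canonical__measure_function_Measure
    (mdensity leb mD mf fD) mF.
have DJ x : D x -> J (F x).
  rewrite /D/J/= !in_itv/= => /andP[ax xb]; apply/andP; split.
    by apply: iF => //; rewrite in_itv/= ?lexx ?(ltW ab) ?(ltW ax).
  by apply: leF => //; rewrite in_itv/= ?lexx ?(ltW ab) ?(ltW ax).
(* Intersecting with [J] truncates the interval to []c', d']]; its end points have preimages [u] and
   [v] by the intermediate value theorem, and []u, v]] is its preimage. *)
have key (X : set (measurableTypeR R)) : ocitv X -> leb (X `&` J) = m2 X.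
  move=> [[c d]] /= _ <-.
  pose c' := Num.max c (F a); pose d' := Num.min d (F b).
  have XJ : `]c, d]%classic `&` J = `]c', d']%classic.
    apply/seteqP; split => x; rewrite /J/= !in_itv/= /c' /d' gt_max le_min.
      by move=> [/andP[-> ->] /andP[-> ->]].
    by move=> /andP[/andP[-> ->] /andP[-> ->]].
  rewrite XJ /= /pushforward /= /mdensity /F'.
  have [dc|cd] := leP d' c'.
    rewrite set_itv_ge; last by rewrite bnd_simp -leNgt.
    rewrite measure0 (_ : _ `&` _ = set0) ?integral_set0//.
    apply/seteqP; split => // x [Dx] FX.
    have : (`]c, d]%classic `&` J) (F x) by split => //; exact: DJ.
    by rewrite XJ set_itv_ge// bnd_simp -leNgt.
  have ex_u y : (F a <= y <= F b)%R -> exists2 u, u \in `[a, b] & F u = y.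
    move=> yab; apply: (@IVT _ F a b y (ltW ab)).
    - exact: continuous_subspaceT.
    - have Fab : (F a <= F b)%R by move: yab => /andP[]; exact: le_trans.
      by rewrite (min_idPl Fab) (max_idPr Fab).
  have [u uab Fu] := ex_u c' ltac:(by rewrite /c' le_max lexx orbT/= (le_trans (ltW cd))// /d' ge_min lexx orbT).
  have [v vab Fv] := ex_u d' ltac:(by rewrite (le_trans _ (ltW cd)) /= ?/d' ?ge_min ?lexx ?orbT// /c' le_max lexx orbT).
  have uv : (u < v)%R.
    rewrite ltNge; apply/negP => vu; have := leF _ _ vab uab vu.
    by rewrite Fu Fv leNgt cd.
  have au : (a <= u)%R by move: uab; rewrite in_itv/= => /andP[].
  have vb : (v <= b)%R by move: vab; rewrite in_itv/= => /andP[].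
  rewrite (_ : _ `&` _ = `]u, v]%classic); last first.
    apply/seteqP; split => x.
      move=> [Dx FX]; have xab : x \in `[a, b].
        by move: Dx; rewrite /D/= !in_itv/= => /andP[/ltW -> ->].
      have : (`]c, d]%classic `&` J) (F x) by split => //; exact: DJ.
      rewrite XJ/= !in_itv/= -Fu -Fv => /andP[ux xv]; apply/andP; split.
        by rewrite ltNge; apply/negP => xu; have := leF _ _ xab uab xu; rewrite leNgt ux.
      by rewrite leNgt; apply/negP => vx; have := iF _ _ vab xab vx; rewrite ltNge xv.
    rewrite /= in_itv/= => /andP[ux xv].
    have xab : x \in `[a, b].
      by rewrite in_itv/= (le_trans au (ltW ux)) (le_trans xv vb).
    split; first by rewrite /D/= in_itv/= (le_lt_trans au ux) (le_trans xv vb).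
    have : `]c', d']%classic (F x).
      by rewrite /= in_itv/= -Fu -Fv iF//= leF.
    by rewrite -XJ => -[].
  have dFuv x : x \in `]u, v[ -> is_derive x 1%R F (f x).
    rewrite in_itv/= => /andP[ux xv]; apply: dF.
    by rewrite in_itv/= (le_lt_trans au ux) (lt_le_trans xv vb).
  apply: (etrans _ (esym (integral_derive_oc uv cF cf dFuv))).
  by rewrite Fu Fv lebesgue_measure_itv/= lte_fin cd EFinB.
(* Uniqueness concerns measures on the whole line, so Lebesgue measure outside [J] is added to [m2],
   which only charges [J]. *)
pose nJ := mrestr leb (measurableC mJ).
have mE (A : set (measurableTypeR R)) : measurable A -> leb A = (measure_add nJ m2) A.
  apply: lebesgue_measure_unique => X oX.
  apply: (etrans _ (esym (measure_addE _ _ _))).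
  rewrite -key// -[in LHS](@setIT _ X) -(setvU J) setIUr.
  rewrite measureU//=.
  - apply: measurableI; last exact: measurableC.
    by move: oX => [[c d]] /= _ <-; exact: measurable_itv.
  - apply: measurableI => //.
    by move: oX => [[c d]] /= _ <-; exact: measurable_itv.
  - by apply/seteqP; split => // x [[_ nJx] [_ Jx]].
transitivity (\int[m2]_(x in J) h x).
  apply: eq_measure_integral => A mA AJ; apply: (etrans (mE A mA)).
  apply: (etrans (measure_addE _ _ _)).
  transitivity (0 + m2 A); last by rewrite add0e.
  congr (_ + _); rewrite /= /mrestr (_ : A `&` ~` J = set0) ?measure0//.
  by apply/seteqP; split => // x [/AJ].
rewrite integral_mkcond ge0_integral_pushforward//=; last 2 first.
- exact/(measurable_restrictT _ _).1/measurable_funTS.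
- by move=> x _; apply: erestrict_ge0 => y _; exact: h0.
rewrite preimage_setT ge0_integral_mdensity; last 2 first.
- apply: measurableT_comp => //.
  exact/(measurable_restrictT _ _).1/measurable_funTS.
- by move=> x; apply: erestrict_ge0 => y _; exact: h0.
apply: eq_integral => x /[!inE] Dx; congr (_ * _).
by rewrite /= patchE mem_set//; exact: DJ.
Qed.

End substitution.

Section substitution_line.
Local Open Scope ereal_scope.
Context {R : realType}.
Local Notation leb := (@lebesgue_measure R).
Implicit Types (F f : R -> R) (a b : R) (h : R -> \bar R).

Lemma bigcup_itv_oc : \bigcup_n `](- n.+1%:R)%R, n.+1%:R : R]%classic = setT.
Proof.
apply/seteqP; split => // x _; exists (Num.trunc `|x|) => //=.
have := real_truncnS_gt (num_real `|x|); rewrite in_itv/= ltr_norml => /andP[-> /ltW ->].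
by [].
Qed.

(** The range is kept as an increasing union because [F] need not be onto: it is a bounded interval
    for [atan] and the whole line for a scaling. Both sides are limits of the same sequence of
    integrals over bounded intervals. *)
Lemma ge0_integral_substitutionT F f h :
  continuous F -> continuous f ->
  (forall x : R, is_derive x 1%R F (f x)) -> (forall x, (0 <= f x)%R) ->
  {homo F : x y / (x < y)%R} ->
  measurable_fun setT h -> (forall x, 0 <= h x) ->
  \int[leb]_(x in \bigcup_n `]F (- n.+1%:R)%R, F n.+1%:R]%classic) h x =
  \int[leb]_x (h (F x) * (f x)%:E).
Proof.
move=> cF cf dF f0 iF mh h0.
have mF : measurable_fun setT F by exact: continuous_measurable_fun.
have mhF : measurable_fun setT (fun x => h (F x) * (f x)%:E).
  apply: emeasurable_funM; first exact: measurableT_comp.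
  by apply/measurable_EFinP; exact: continuous_measurable_fun.
have leF : {homo F : x y / (x <= y)%R}.
  by move=> x y; rewrite le_eqVlt => /predU1P[->//|/iF/ltW].
have nS (m n : nat) : (m <= n)%N -> (m.+1%:R <= n.+1%:R :> R)%R by rewrite ler_nat.
have H1 := @ge0_nondecreasing_set_cvg_integral _ (measurableTypeR R) R
  (fun n => `]F (- n.+1%:R)%R, F n.+1%:R]%classic) h leb.
have H2 := @ge0_nondecreasing_set_cvg_integral _ (measurableTypeR R) R
  (fun n => `](- n.+1%:R)%R, n.+1%:R : R]%classic) (fun x => h (F x) * (f x)%:E) leb.
rewrite bigcup_itv_oc in H2.
pose u n := \int[leb]_(x in `](- n.+1%:R)%R, n.+1%:R : R]%classic) (h (F x) * (f x)%:E).
have uE : u = fun n => \int[leb]_(x in `]F (- n.+1%:R)%R, F n.+1%:R]%classic) h x.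
  apply/funext => n; apply/esym; apply: ge0_integral_substitution_oc => //.
  - by rewrite (@lt_le_trans _ _ 0%R)// oppr_lt0 ltr0n.
  - by move=> x y _ _; exact: iF.
apply: (@cvg_unique _ (@ereal_hausdorff R) (u @ \oo)) => //.
- rewrite uE.
  apply: H1 => //.
  + move=> m n mn; rewrite subsetEset => x/=; rewrite !in_itv/= => /andP[x1 x2].
    by rewrite (le_lt_trans _ x1) ?(le_trans x2) ?leF// ?lerN2 nS.
  + by move=> n; exact: measurable_funTS.
- apply: H2 => //.
  + move=> m n mn; rewrite subsetEset => x/=; rewrite !in_itv/= => /andP[x1 x2].
    by rewrite (le_lt_trans _ x1) ?(le_trans x2) ?lerN2 ?nS.
  + by move=> n; exact: measurable_funTS.
  + by move=> n x _; rewrite mule_ge0// lee_fin.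
Qed.

Lemma ge0_integral_opp h : measurable_fun setT h -> (forall x, 0 <= h x) ->
  \int[leb]_x h x = \int[leb]_x h (- x)%R.
Proof.
move=> mh h0.
rewrite -[RHS](@ge0_integral_pushforward _ _ (measurableTypeR R) (measurableTypeR R) R
  (-%R : measurableTypeR R -> measurableTypeR R) _ leb setT h)//.
by apply: eq_measure_integral => //= A mA AS; exact/esym/lebesgue_measureN.
Qed.

Lemma ge0_integral_scale h (c : R) : c != 0%R ->
  measurable_fun setT h -> (forall x, 0 <= h x) ->
  \int[leb]_x h x = \int[leb]_x (h (c * x)%R * `|c|%:E).
Proof.
move=> c0 mh h0.
have continuous_mull (k : R) : continuous (fun x : R => k * x)%R.
  by move=> x; apply: cvgM; [exact: cvg_cst|exact: cvg_id].
wlog cp : c c0 / (0 < c)%R.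
  move=> H; move: c0; rewrite neq_lt => /orP[cn|cp]; last first.
    by apply: H => //; rewrite gt_eqF.
  rewrite (H (- c)%R) ?oppr_eq0 ?lt_eqF ?oppr_gt0// ge0_integral_opp.
  - by apply: eq_integral => x _; rewrite mulrNN normrN.
  - apply: emeasurable_funM; last exact: measurable_cst.
    by apply: measurableT_comp => //; exact/continuous_measurable_fun/continuous_mull.
  - by move=> x; rewrite mule_ge0.
have dF (x : R) : is_derive x 1%R (fun x : R => c * x)%R `|c|%R.
  rewrite (gtr0_norm cp).
  have := @is_deriveZ _ _ _ (@id R) c x 1%R 1%R (is_derive_id _ _).
  by rewrite [_ *: _]mulr1.
apply: (etrans _ (@ge0_integral_substitutionT _ _ h (continuous_mull c) _ dF _ _ mh h0)).
- congr (integral _ _ _); apply/esym/seteqP; split => // x _.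
  have : (setT : set R) (x / c)%R by [].
  rewrite -bigcup_itv_oc => -[n _] /=; rewrite in_itv/= => /andP[x1 x2].
  by exists n => //=; rewrite in_itv/= ![(c * _)%R]mulrC -ltr_pdivlMr// -ler_pdivrMr// x1 x2.
- by move=> x; exact: cvg_cst.
- by move=> x; exact: normr_ge0.
- by move=> x y xy; rewrite ltr_pM2l.
Qed.

End substitution_line.

Section polar.
Local Open Scope ereal_scope.
Context {R : realType}.
Local Notation leb := (@lebesgue_measure R).
Local Notation Rm := (measurableTypeR R).

Definition polar (p : Rm * Rm) : Rm * Rm := (p.1 * cos p.2, p.1 * sin p.2)%R.

Lemma measurable_cos : measurable_fun setT (@cos R : Rm -> Rm).
Proof. by apply: continuous_measurable_fun; exact: continuous_cos. Qed.

Lemma measurable_sin : measurable_fun setT (@sin R : Rm -> Rm).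
Proof. by apply: continuous_measurable_fun; exact: continuous_sin. Qed.

Lemma measurable_polar : measurable_fun setT polar.
Proof.
apply: measurable_fun_pair; apply: measurable_funM => //.
- by apply: (measurableT_comp (f := cos)) measurable_snd; exact: measurable_cos.
- by apply: (measurableT_comp (f := sin)) measurable_snd; exact: measurable_sin.
Qed.

Variable F : Rm * Rm -> \bar R.
Hypotheses (mF : measurable_fun setT F) (F0 : forall p, 0 <= F p).

(** Both half-lines of direction [t] are integrated at once, whence the absolute value in the
    Jacobian. *)
Let ray (t : Rm) := \int[leb]_r (F (polar (r, t)) * `|r|%:E).

Let mFpolar : measurable_fun setT (fun p => F (polar p) * `|p.1|%:E).
Proof.
apply: emeasurable_funM; first exact: measurableT_comp measurable_polar.
by apply/measurable_EFinP; apply: measurableT_comp.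
Qed.

Let mFpolar1 t : measurable_fun setT (fun r : Rm => F (polar (r, t)) * `|r|%:E).
Proof. exact: (measurable_fun_pair1 t mFpolar). Qed.

Let mray : measurable_fun setT ray.
Proof.
apply: (@measurable_fun_fubini_tonelli_G _ _ _ _ _ leb
  (fun p => F (polar p) * `|p.1|%:E)) => //.
by move=> p; rewrite mule_ge0.
Qed.

Let ray_ge0 t : 0 <= ray t.
Proof. by apply: integral_ge0 => x _; rewrite mule_ge0. Qed.

(** Along the line of slope [t] one substitutes x = r cos (atan t): one factor cos comes from dx and
    one from |x|, and cos^2 (atan t) = 1 / (1 + t^2) is the derivative of [atan]. *)
Let shear_ray t : \int[leb]_x (F (x, x * t)%R * `|x|%:E) =
  ray (atan t) * ((1 + t ^+ 2)^-1)%:E.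
Proof.
have c0 : (0 < cos (atan t))%R.
  by apply: cos_gt0_pihalf; rewrite atan_gtNpi2 atan_ltpi2.
have ct : (cos (atan t) * t = sin (atan t))%R.
  by rewrite -{2}(atanK t) /tan mulrCA divff ?mulr1// gt_eqF.
have c2 : ((1 + t ^+ 2)^-1 = cos (atan t) ^+ 2)%R.
  by rewrite -{1}(atanK t) -cos2_tan2 ?invrK// gt_eqF.
rewrite (@ge0_integral_scale _ _ (cos (atan t)))//; last 3 first.
- by rewrite gt_eqF.
- apply: emeasurable_funM => //.
    apply: measurableT_comp => //; apply: measurable_fun_pair => //.
    exact: measurable_funM.
  by apply/measurable_EFinP; exact: normr_measurable.
- by move=> x; rewrite mule_ge0.
rewrite /ray -ge0_integralZr//; last 2 first.
- by move=> x _; rewrite mule_ge0.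
- by rewrite lee_fin invr_ge0 addr_ge0// sqr_ge0.
apply: eq_integral => x _; rewrite /polar/= -ct.
rewrite (mulrC x (cos _)) (mulrA x) (mulrC x (cos _)) c2 -!muleA -!EFinM.
by rewrite normrM (gtr0_norm c0); congr (_ * _%:E); rewrite expr2; ring.
Qed.

(** For fixed x, the substitution y = x t replaces the ordinate by the slope. After exchanging the
    integrals, only the one-variable substitution by [atan] remains. *)
Let integral_ray :
  \int[leb \x leb]_p F p = \int[leb]_(t in `](- (pi / 2))%R, (pi / 2)%R[) ray t.
Proof.
apply: (etrans (@fubini_tonelli1 _ _ Rm Rm R leb leb F mF F0)).
transitivity (\int[leb]_x \int[leb]_t (F (x, x * t)%R * `|x|%:E)).
  rewrite /fubini_F.
  have mK : measurable_fun setT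
      (fun p : Rm * Rm => F (p.1, p.1 * p.2)%R * `|p.1|%:E).
    apply: emeasurable_funM.
      apply: measurableT_comp => //; apply: measurable_fun_pair => //.
      exact: measurable_funM.
    by apply/measurable_EFinP; apply: measurableT_comp.
  have mG1 : measurable_fun setT (fun x : Rm => \int[leb]_y F (x, y)).
    exact: (@measurable_fun_fubini_tonelli_F _ _ _ _ _ leb F).
  have mG2 : measurable_fun setT
      (fun x : Rm => \int[leb]_y (F (x, x * y)%R * `|x|%:E)).
    apply: (@measurable_fun_fubini_tonelli_F _ _ _ _ _ leb
      (fun p : Rm * Rm => F (p.1, p.1 * p.2)%R * `|p.1|%:E)) => //.
    by move=> p; rewrite mule_ge0.
  (* The point x = 0 is removed, as scaling by x requires x to be nonzero. *)
  have m0 : measurable (setT `\ (0 : R)%R : set Rm).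
    by apply: measurableD.
  apply: (etrans (esym (integral_setD1 m0 (measurable_funTS mG1)))).
  apply: (etrans _ (integral_setD1 m0 (measurable_funTS mG2))).
  apply: eq_integral => x; rewrite inE/= => -[_ /eqP x0].
  apply: (ge0_integral_scale x0) => //.
  exact: measurable_fun_pair2 mF.
rewrite (@fubini_tonelli _ _ _ _ _ leb leb
  (fun p : Rm * Rm => F (p.1, p.1 * p.2)%R * `|p.1|%:E)); last 2 first.
- apply: emeasurable_funM.
    apply: measurableT_comp => //; apply: measurable_fun_pair => //.
    exact: measurable_funM.
  by apply/measurable_EFinP; apply: measurableT_comp.
- by move=> p; rewrite mule_ge0.
under eq_integral do rewrite /= shear_ray.
apply: (etrans (esym (@ge0_integral_substitutionT _ (@atan R)
  (fun t => (1 + t ^+ 2)^-1)%R ray _ _ _ _ _ mray ray_ge0))).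
- exact: continuous_atan.
- exact: continuous_oneDsqrV.
- by move=> x; rewrite invr_ge0 addr_ge0// sqr_ge0.
- exact: lt_atan.
congr (integral _ _ _); apply/seteqP; split => [x [n _]|x]/=; rewrite !in_itv/=.
  move=> /andP[x1 x2]; rewrite (lt_trans (atan_gtNpi2 _) x1)/=.
  exact: (le_lt_trans x2 (atan_ltpi2 _)).
move=> xI; have : (setT : set R) (tan x) by [].
rewrite -bigcup_itv_oc => -[n _] /=; rewrite in_itv/= => /andP[x1 x2].
exists n => //=; rewrite in_itv/= -(tanK xI).
by rewrite (lt_atan x1) (le_atan x2).
Qed.

(** Each line is split at 0: its negative half of angle t is the positive half-line of angle t + pi.
    The angles start at -(pi / 2) because they come from [atan]. *)
Theorem ge0_integral_polar : \int[leb \x leb]_p F p =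
  \int[leb]_(t in `](- (pi / 2))%R, (pi / 2 + pi)%R])
    \int[leb]_(r in `]0%R, +oo[) (F (polar (r, t)) * r%:E).
Proof.
pose G (t : Rm) := \int[leb]_(r in `]0%R, +oo[) (F (polar (r, t)) * r%:E).
have mr : measurable_fun setT (fun r : Rm => r%:E : \bar R) by exact/measurable_EFinP.
have mFp t : measurable_fun setT (fun r : Rm => F (polar (r, t)) * r%:E).
  apply: emeasurable_funM => //.
  by apply: measurableT_comp => //; exact: measurable_fun_pair1 measurable_polar.
have G0 t : 0 <= G t.
  apply: integral_ge0 => r /=; rewrite in_itv/= andbT => r0.
  by rewrite mule_ge0// lee_fin ltW.
have mG : measurable_fun setT G.
  have GE t : G t = \int[leb]_r ((fun p => F (polar p) * `|p.1|%:E) \_ (fst @^-1` `]0%R, +oo[)) (r, t).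
    rewrite /G integral_mkcond; apply: eq_integral => r _.
    rewrite !patchE; have [|rn] := boolP (r \in `]0%R, +oo[%classic).
      rewrite inE /= => rp; rewrite mem_set//=.
      by move: rp; rewrite in_itv/= andbT => /gtr0_norm ->.
    by rewrite memNset//= => h; move: rn; rewrite mem_set.
  rewrite (funext GE).
  apply: (@measurable_fun_fubini_tonelli_G _ _ _ _ _ leb
    ((fun p => F (polar p) * `|p.1|%:E) \_ (fst @^-1` `]0%R, +oo[))).
  - apply/(measurable_restrictT _ _).1/measurable_funTS => //.
    by rewrite -[X in measurable X]setTI; apply: measurable_fst.
  - by move=> p; apply: erestrict_ge0 => q _; rewrite mule_ge0.
have rayE t : ray t = G t + G (t + pi)%R.
  rewrite /ray.
  have -> : setT = `]-oo, (0 : R)%R[%classic `|` `[(0 : R)%R, +oo[%classic.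
    apply/seteqP; split => // x _ /=; rewrite !in_itv/= andbT.
    by case: (ltP x 0%R); [left|right].
  rewrite ge0_integral_setU//=; last 3 first.
  - by apply: measurable_funTS; exact: mFpolar1.
  - by move=> x _; rewrite mule_ge0.
  - by apply/disj_setPS => x /=; rewrite !in_itv/= andbT leNgt => -[->].
  rewrite addeC; congr (_ + _).
    rewrite -integral_itv_obnd_cbnd.
      apply: eq_integral => r; rewrite inE/= in_itv/= andbT => r0.
      by rewrite gtr0_norm.
    by apply: measurable_funTS; exact: mFpolar1.
  rewrite integral_mkcond ge0_integral_opp; last 2 first.
  - apply/(measurable_restrictT _ _).1/measurable_funTS => //.
    exact: mFpolar1.
  - by move=> x; apply: erestrict_ge0 => q _; rewrite mule_ge0.
  rewrite /G [RHS]integral_mkcond; apply: eq_integral => r _.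
  rewrite !patchE !mem_setE !in_itv/= andbT oppr_lt0.
  case: ifPn => // r0; rewrite normrN gtr0_norm//; congr (F _ * _).
  by rewrite /polar/= cosDpi sinDpi !mulrN !mulNr.
have I1 : (- (pi / 2) < pi / 2 :> R)%R by rewrite gt0_cp// divr_gt0 ?pi_gt0.
have I2 : (pi / 2 < pi / 2 + pi :> R)%R by rewrite ltrDl pi_gt0.
have addpiC : continuous (fun t : R => t + pi)%R.
  by move=> x; apply: cvgD; [exact: cvg_id|exact: cvg_cst].
have mGp : measurable_fun setT (fun t : Rm => G (t + pi)%R).
  apply: (measurableT_comp mG).
  exact: (continuous_measurable_fun addpiC).
have mI : measurable (`](- (pi / 2))%R, (pi / 2)%R]%classic : set Rm) by exact: measurable_itv.
have mI' : measurable (`](- (pi / 2) + pi)%R, (pi / 2 + pi)%R]%classic : set Rm).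
  exact: measurable_itv.
have Epi : (- (pi / 2) + pi = pi / 2 :> R)%R by rewrite {2}[pi]splitr addrA addNr add0r.
transitivity (\int[leb]_(t in `](- (pi / 2))%R, (pi / 2)%R]) (G t + G (t + pi)%R)).
  apply: (etrans integral_ray).
  apply: (etrans (integral_itv_bndo_bndc (measurable_funTS mray))).
  by apply: eq_integral => t _; exact: rayE.
apply: (etrans (ge0_integralD _ mI (fun t _ => G0 t) (measurable_funTS mG)
  (fun t _ => G0 _) (measurable_funTS mGp))).
have dpi (x : R) : x \in `](- (pi / 2))%R, (pi / 2)%R[ ->
    is_derive x 1%R (fun t : R => t + pi)%R 1%R.
  by move=> _; rewrite -[1%R in X in is_derive _ _ _ X]addr0; exact: is_deriveD.
have shiftE : \int[leb]_(t in `](- (pi / 2))%R, (pi / 2)%R]) G (t + pi)%R =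
    \int[leb]_(t in `](- (pi / 2) + pi)%R, (pi / 2 + pi)%R]) G t.
  apply: esym; apply: (etrans (@ge0_integral_substitution_oc _ (fun t => t + pi)%R
    (fun=> 1%R) _ _ G I1 addpiC (fun=> cvg_cst _) dpi _ _ mG G0)).
  - by move=> x _; exact: ler01.
  - by move=> x y _ _; rewrite ltrD2r.
  - by apply: eq_integral => t _; rewrite mule1.
rewrite shiftE.
apply: (etrans (esym (ge0_integral_setU _ mI mI' (measurable_funTS mG) (fun t _ => G0 t) _))).
  apply/disj_setPS => x /=; rewrite !in_itv/= Epi => -[/andP[_ x1] /andP[x2 _]].
  by move: x1; rewrite leNgt x2.
congr (integral _ _ _); apply/seteqP; split => x /=; rewrite !in_itv/= Epi.
  case=> /andP[x1 x2]; first by rewrite x1 (le_trans x2 (ltW I2)).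
  by rewrite x2 andbT (lt_trans I1).
by move=> /andP[x1 x2]; have [xp|xp] := leP x (pi / 2)%R; [left|right]; rewrite ?x1.
Qed.

End polar.

(** * Complex-valued integrals *)

Section normc.
Context {R : realType}.
Implicit Types (z w : R[i]) (x y : R).

Lemma ReD z w : Re (z + w) = Re z + Re w. Proof. by case: z; case: w. Qed.
Lemma ImD z w : Im (z + w) = Im z + Im w. Proof. by case: z; case: w. Qed.
Lemma ReN z : Re (- z) = - Re z. Proof. by case: z. Qed.
Lemma ImN z : Im (- z) = - Im z. Proof. by case: z. Qed.
Lemma ReM z w : Re (z * w) = Re z * Re w - Im z * Im w.
Proof. by case: z; case: w. Qed.
Lemma ImM z w : Im (z * w) = Re z * Im w + Im z * Re w.
Proof. by case: z => a b; case: w => c d /=; rewrite addrC. Qed.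

Lemma Re_sum (I : Type) (s : seq I) (P : pred I) (F : I -> R[i]) :
  Re (\sum_(i <- s | P i) F i) = \sum_(i <- s | P i) Re (F i).
Proof. by apply: (big_morph (@complex.Re R) ReD). Qed.

Lemma complex_eqP z w : Re z = Re w -> Im z = Im w -> z = w.
Proof. by case: z => a b; case: w => c d /= -> ->. Qed.

Lemma conjcM z w : conjc (z * w) = conjc z * conjc w.
Proof. exact: (rmorphM (@conjc R)). Qed.

Lemma conjc_sum (I : Type) (s : seq I) (P : pred I) (F : I -> R[i]) :
  conjc (\sum_(i <- s | P i) F i) = \sum_(i <- s | P i) conjc (F i).
Proof. exact: (rmorph_sum (@conjc R)). Qed.

Lemma normc_ge0 z : 0 <= normc z.
Proof. by case: z => a b /=; exact: sqrtr_ge0. Qed.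

Lemma sqr_normcE z : normc z ^+ 2 = Re z ^+ 2 + Im z ^+ 2.
Proof. by case: z => a b /=; rewrite sqr_sqrtr// addr_ge0// sqr_ge0. Qed.

Lemma ler_normcD z w : normc (z + w) <= normc z + normc w.
Proof. exact: le_normcD. Qed.

Lemma normc_oppr z : normc (- z) = normc z.
Proof. exact: normcN. Qed.

Lemma normcX z n : normc (z ^+ n) = normc z ^+ n.
Proof.
elim: n => [|n IH]; first by rewrite !expr0 Normc.normc1.
by rewrite !exprS Normc.normcM IH.
Qed.

Lemma normc_real x : normc x%:C = `|x|.
Proof. by rewrite /= expr0n/= addr0 sqrtr_sqr. Qed.

Lemma normc_nat n : normc (n%:R : R[i]) = n%:R.
Proof.
have -> : (n%:R : R[i]) = (n%:R : R)%:C by rewrite rmorph_nat.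
by rewrite normc_real normr_nat.
Qed.

Lemma normc_conj z : normc (conjc z) = normc z.
Proof. by case: z => a b /=; rewrite sqrrN. Qed.

Lemma normc_eq0 z : (normc z == 0) = (z == 0).
Proof.
apply/idP/idP => [/eqP/Normc.eq0_normc ->//|/eqP ->].
by rewrite Normc.normc0.
Qed.

Lemma normc_gt0 z : (0 < normc z) = (z != 0).
Proof. by rewrite lt_neqAle normc_ge0 andbT eq_sym normc_eq0. Qed.

Lemma ler_normc_sum (I : Type) (s : seq I) (P : pred I) (F : I -> R[i]) :
  normc (\sum_(i <- s | P i) F i) <= \sum_(i <- s | P i) normc (F i).
Proof.
elim/big_rec2: _ => [|i x z _ IH]; first by rewrite Normc.normc0.
by rewrite (le_trans (ler_normcD _ _))// lerD2l.
Qed.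

Lemma ler_Re_normc z : `|Re z| <= normc z.
Proof.
rewrite -(@ler_pXn2r _ 2)// ?nnegrE ?normc_ge0// sqr_normcE real_normK ?num_real//.
by rewrite lerDl sqr_ge0.
Qed.

Lemma ler_Im_normc z : `|Im z| <= normc z.
Proof.
rewrite -(@ler_pXn2r _ 2)// ?nnegrE ?normc_ge0// sqr_normcE real_normK ?num_real//.
by rewrite lerDr sqr_ge0.
Qed.

Lemma mulc_conj z : z * conjc z = (normc z ^+ 2)%:C.
Proof.
by rewrite sqr_normcE; case: z => a b; apply: complex_eqP => /=; ring.
Qed.

(** Young's inequality with a free weight: a small [x] keeps the factor of the main term near 1 and
    charges the error term. *)
Lemma sqr_normcD z w (x : R) : 0 < x ->
  normc (z + w) ^+ 2 <= (1 + x) * normc z ^+ 2 + (1 + x^-1) * normc w ^+ 2.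
Proof.
move=> x0; have := ler_normcD z w.
set a := normc z; set b := normc w => ab.
apply: (@le_trans _ _ ((a + b) ^+ 2)).
  by rewrite ler_pXn2r// ?nnegrE ?addr_ge0 ?normc_ge0.
rewrite -subr_ge0.
have -> : (1 + x) * a ^+ 2 + (1 + x^-1) * b ^+ 2 - (a + b) ^+ 2 =
   (x * a - b) ^+ 2 / x.
  by field; rewrite gt_eqF.
by rewrite divr_ge0 ?sqr_ge0 ?ltW.
Qed.

End normc.

Section cmeasurable_on.
Context {R : realType} d (T : measurableType d).
Implicit Types (D : set T) (f g : T -> R[i]).

Definition cmeasurable_on D f :=
  measurable_fun D (fun x => Re (f x)) /\ measurable_fun D (fun x => Im (f x)).

Lemma cmeasurable_on_cst D (c : R[i]) : cmeasurable_on D (fun=> c).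
Proof. by split; exact: measurable_cst. Qed.

Lemma cmeasurable_onS D E f : measurable E -> D `<=` E ->
  cmeasurable_on E f -> cmeasurable_on D f.
Proof. by move=> mE DE [? ?]; split; exact: (measurable_funS mE DE). Qed.

Lemma eq_cmeasurable_on D f g : (forall x, D x -> f x = g x) ->
  cmeasurable_on D f -> cmeasurable_on D g.
Proof.
move=> fg [m1 m2]; split.
- by apply: eq_measurable_fun m1 => x /[!inE] /fg ->.
- by apply: eq_measurable_fun m2 => x /[!inE] /fg ->.
Qed.

Lemma cmeasurable_onD D f g : cmeasurable_on D f -> cmeasurable_on D g ->
  cmeasurable_on D (fun x => f x + g x).
Proof.
move=> [f1 f2] [g1 g2]; split.
- by under eq_fun do rewrite ReD; exact: measurable_funD.
- by under eq_fun do rewrite ImD; exact: measurable_funD.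
Qed.

Lemma cmeasurable_onM D f g : cmeasurable_on D f -> cmeasurable_on D g ->
  cmeasurable_on D (fun x => f x * g x).
Proof.
move=> [f1 f2] [g1 g2]; split.
- under eq_fun do rewrite ReM.
  by apply: measurable_funB; exact: measurable_funM.
- under eq_fun do rewrite ImM.
  by apply: measurable_funD; exact: measurable_funM.
Qed.

Lemma cmeasurable_onX D f n : cmeasurable_on D f ->
  cmeasurable_on D (fun x => f x ^+ n).
Proof.
move=> mf; elim: n => [|n IH].
  by under eq_fun do rewrite expr0; exact: cmeasurable_on_cst.
by under eq_fun do rewrite exprS; exact: cmeasurable_onM.
Qed.

Lemma cmeasurable_on_conj D f : cmeasurable_on D f ->
  cmeasurable_on D (fun x => conjc (f x)).
Proof.
move=> [f1 f2]; split.
- by rewrite (_ : (fun x => _) = (fun x => Re (f x)))//; apply/funext => x; case: (f x).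
- rewrite (_ : (fun x => _) = (fun x => - Im (f x))); last by apply/funext => x; case: (f x).
  exact: measurable_funN.
Qed.

Lemma cmeasurable_on_sum D (I : Type) (s : seq I) (P : pred I) (F : I -> T -> R[i]) :
  (forall i, P i -> cmeasurable_on D (F i)) ->
  cmeasurable_on D (fun x => \sum_(i <- s | P i) F i x).
Proof.
move=> mF; elim: s => [|i s IH].
  by under eq_fun do rewrite big_nil; exact: cmeasurable_on_cst.
have [Pi|Pi] := boolP (P i); last first.
  by under eq_fun do rewrite big_cons (negbTE Pi).
under eq_fun do rewrite big_cons Pi.
by apply: cmeasurable_onD => //; exact: mF.
Qed.

Lemma cmeasurable_on_real D (u : T -> R) : measurable_fun D u ->
  cmeasurable_on D (fun x => (u x)%:C).
Proof. by move=> mu; split => //=; exact: measurable_cst. Qed.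

Lemma cmeasurable_on_normc D f : cmeasurable_on D f ->
  measurable_fun D (fun x => normc (f x)).
Proof.
move=> [f1 f2].
have -> : (fun x => normc (f x)) =
    (fun x => Num.sqrt (Re (f x) ^+ 2 + Im (f x) ^+ 2)).
  by apply/funext => x; rewrite -sqr_normcE sqrtr_sqr ger0_norm ?normc_ge0.
apply: measurableT_comp.
  by apply: continuous_measurable_fun; exact: sqrt_continuous.
by apply: measurable_funD; exact: measurable_funX.
Qed.

End cmeasurable_on.

Lemma cmeasurable_on_comp {R : realType} d1 d2 (T1 : measurableType d1)
    (T2 : measurableType d2) (phi : T1 -> T2) (f : T2 -> R[i]) :
  measurable_fun setT phi -> cmeasurable_on setT f ->
  cmeasurable_on setT (f \o phi).
Proof. by move=> mphi [f1 f2]; split; [exact: (measurableT_comp f1 mphi)|exact: (measurableT_comp f2 mphi)]. Qed.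

Section cint.
Context d (T : measurableType d) {R : realType} (m : {measure set T -> \bar R}).
Implicit Types (D : set T) (f g : T -> R[i]).

Definition cint D f : R[i] :=
  (\int[m]_(x in D) Re (f x)) +i* (\int[m]_(x in D) Im (f x)).

Definition cintegrable D f :=
  m.-integrable D (EFin \o (fun x => Re (f x))) /\
  m.-integrable D (EFin \o (fun x => Im (f x))).

Lemma bounded_cintegrable D f (B : R) : measurable D -> (m D < +oo)%E ->
  cmeasurable_on D f -> (forall x, D x -> normc (f x) <= B) -> cintegrable D f.
Proof.
move=> mD fD [f1 f2] fB; split; apply: measurable_bounded_integrable => //.
- exists B; split; first exact: num_real.
  by move=> M BM x Dx; rewrite /= (le_trans (ler_Re_normc _))// (le_trans (fB _ Dx))// ltW.
- exists B; split; first exact: num_real.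
  by move=> M BM x Dx; rewrite /= (le_trans (ler_Im_normc _))// (le_trans (fB _ Dx))// ltW.
Qed.

Lemma eq_cint D f g : (forall x, D x -> f x = g x) -> cint D f = cint D g.
Proof.
by move=> fg; congr (_ +i* _); apply: eq_Rintegral => x /[!inE] /fg ->.
Qed.

Lemma cint0 D : cint D (fun=> 0) = 0.
Proof. by rewrite /cint /Rintegral !integral0_eq. Qed.

Lemma cintegrableD D f g : measurable D -> cintegrable D f -> cintegrable D g ->
  cintegrable D (fun x => f x + g x).
Proof.
move=> mD [f1 f2] [g1 g2]; split.
- rewrite (_ : _ \o _ = (EFin \o (fun x => Re (f x))) \+ (EFin \o (fun x => Re (g x)))).
    exact: integrableD.
  by apply/funext => x /=; rewrite ReD.
- rewrite (_ : _ \o _ = (EFin \o (fun x => Im (f x))) \+ (EFin \o (fun x => Im (g x)))).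
    exact: integrableD.
  by apply/funext => x /=; rewrite ImD.
Qed.

Lemma cintD D f g : measurable D -> cintegrable D f -> cintegrable D g ->
  cint D (fun x => f x + g x) = cint D f + cint D g.
Proof.
move=> mD [f1 f2] [g1 g2]; apply: complex_eqP; rewrite /= -RintegralD//.
- by apply: eq_Rintegral => x _; rewrite ReD.
- by apply: eq_Rintegral => x _; rewrite ImD.
Qed.

Let integrableZ D (u : T -> R) (k : R) : measurable D ->
  m.-integrable D (EFin \o u) -> m.-integrable D (EFin \o (fun x => k * u x)).
Proof.
move=> mD iu; rewrite (_ : _ \o _ = (fun x => k%:E * (EFin \o u) x)%E)//.
exact: integrableZl.
Qed.

Lemma cintegrableZ D (c : R[i]) f : measurable D -> cintegrable D f ->
  cintegrable D (fun x => c * f x).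
Proof.
move=> mD [f1 f2]; split.
- rewrite (_ : _ \o _ = (EFin \o (fun x => Re c * Re (f x))) \+
      (EFin \o (fun x => (- Im c) * Im (f x)))).
    by apply: integrableD => //; exact: integrableZ.
  by apply/funext => x /=; rewrite ReM mulNr.
- rewrite (_ : _ \o _ = (EFin \o (fun x => Re c * Im (f x))) \+
      (EFin \o (fun x => Im c * Re (f x)))).
    by apply: integrableD => //; exact: integrableZ.
  by apply/funext => x /=; rewrite ImM.
Qed.

Lemma cintZ D (c : R[i]) f : measurable D -> cintegrable D f ->
  cint D (fun x => c * f x) = c * cint D f.
Proof.
move=> mD [f1 f2]; apply: complex_eqP.
- rewrite ReM /= -!RintegralZl// -RintegralB//; [|exact: integrableZ..].
  by apply: eq_Rintegral => x _; rewrite ReM.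
- rewrite ImM /= -!RintegralZl// -RintegralD//; [|exact: integrableZ..].
  by apply: eq_Rintegral => x _; rewrite ImM.
Qed.

Lemma cintegrable_sum D (I : Type) (s : seq I) (P : pred I) (F : I -> T -> R[i]) :
  measurable D -> (forall i, P i -> cintegrable D (F i)) ->
  cintegrable D (fun x => \sum_(i <- s | P i) F i x).
Proof.
move=> mD iF; elim: s => [|i s IH].
  by split; under [X in _ \o X]eq_fun do rewrite big_nil; exact: integrable0.
have [Pi|Pi] := boolP (P i); last first.
  by under eq_fun do rewrite big_cons (negbTE Pi).
under eq_fun do rewrite big_cons Pi.
by apply: cintegrableD => //; exact: iF.
Qed.

Lemma cint_sum D (I : Type) (s : seq I) (P : pred I) (F : I -> T -> R[i]) :
  measurable D -> (forall i, P i -> cintegrable D (F i)) ->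
  cint D (fun x => \sum_(i <- s | P i) F i x) = \sum_(i <- s | P i) cint D (F i).
Proof.
move=> mD iF; elim: s => [|i s IH].
  by under eq_fun do rewrite big_nil; rewrite big_nil cint0.
rewrite big_cons; have [Pi|Pi] := boolP (P i); last first.
  by rewrite -IH; apply: eq_cint => x _; rewrite big_cons (negbTE Pi).
rewrite -IH -cintD//; first by apply: eq_cint => x _; rewrite big_cons Pi.
  exact: iF.
exact: cintegrable_sum.
Qed.

Lemma cint_cst D (c : R[i]) : measurable D -> cint D (fun=> c) = c * (fine (m D))%:C.
Proof.
move=> mD; rewrite /cint !Rintegral_cst//.
by apply: complex_eqP => /=; rewrite ?ReM ?ImM /= ?mulr0 ?subr0 ?add0r.
Qed.

Lemma cint_mkcond D f : cint D f = cint setT (fun x => if x \in D then f x else 0).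
Proof.
rewrite /cint !(Rintegral_mkcond _ D).
by congr (_ +i* _); apply: eq_Rintegral => x _; rewrite patchE; case: ifP.
Qed.

Lemma cint_setU D E f : measurable D -> measurable E -> cintegrable (D `|` E) f ->
  [disjoint D & E] -> cint (D `|` E) f = cint D f + cint E f.
Proof.
by move=> mD mE [f1 f2] DE; apply: complex_eqP; rewrite /= Rintegral_setU.
Qed.

Lemma cintegrableS D E f : measurable D -> measurable E -> D `<=` E ->
  cintegrable E f -> cintegrable D f.
Proof. by move=> mD mE DE [f1 f2]; split; exact: (integrableS mE mD DE). Qed.

(* Rotating by a unimodular constant turns the modulus of the integral into the
   integral of a real part. *)
Lemma le_normc_cint D f (u : T -> R) : measurable D -> cintegrable D f ->
  m.-integrable D (EFin \o u) -> (forall x, D x -> normc (f x) <= u x) ->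
  normc (cint D f) <= \int[m]_(x in D) u x.
Proof.
move=> mD fi ui fu; set I := cint D f.
have [I0|I0] := eqVneq I 0.
  rewrite I0 Normc.normc0; apply: Rintegral_ge0 => x Dx.
  exact: le_trans (normc_ge0 _) (fu _ Dx).
have nI : 0 < normc I by rewrite normc_gt0.
pose c := conjc I * ((normc I)^-1)%:C.
have nc : normc c = 1.
  by rewrite Normc.normcM normc_conj normc_real ger0_norm ?invr_ge0 ?normc_ge0// divff// gt_eqF.
have cI : c * I = (normc I)%:C.
  rewrite /c mulrAC (mulrC _ I) mulc_conj -rmorphM/= expr2 mulfK// gt_eqF//.
have -> : normc I = Re (cint D (fun x => c * f x)) by rewrite cintZ// cI.
rewrite /=; apply: le_Rintegral => //; first exact: (cintegrableZ c mD fi).1.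
move=> x Dx; rewrite (le_trans (ler_norm _))// (le_trans (ler_Re_normc _))//.
by rewrite Normc.normcM nc mul1r fu.
Qed.

Lemma normc_cint_le D f (B : R) : measurable D -> (m D < +oo)%E ->
  cmeasurable_on D f -> (forall x, D x -> normc (f x) <= B) ->
  normc (cint D f) <= B * fine (m D).
Proof.
move=> mD fD mf fB; rewrite -(Rintegral_cst m mD); apply: le_normc_cint => //.
- exact: bounded_cintegrable fB.
- apply: measurable_bounded_integrable => //; exists `|B|; split => //.
  by move=> M BM x _; exact: ltW.
Qed.

End cint.

(** * Unimodular exponentials and their orthogonality *)

Section cis.
Context {R : realType}.
Local Notation leb := (@lebesgue_measure R).
Local Notation Rm := (measurableTypeR R).
Implicit Types (t a : R) (k : int).

Definition cis t : R[i] := cos t +i* sin t.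
Arguments cis : simpl never.

Lemma cisD t u : cis (t + u) = cis t * cis u.
Proof.
by apply: complex_eqP; rewrite ?ReM ?ImM /cis /= ?cosD ?sinD// addrC.
Qed.

Lemma cis0 : cis 0 = 1.
Proof. by rewrite /cis cos0 sin0. Qed.

Lemma cisN t : cis (- t) = conjc (cis t).
Proof. by rewrite /cis cosN sinN. Qed.

Lemma normc_cis t : normc (cis t) = 1.
Proof. by rewrite /cis /= cos2Dsin2 sqrtr1. Qed.

Lemma cis_neq0 t : cis t != 0.
Proof. by rewrite -normc_gt0 normc_cis ltr01. Qed.

Lemma cisX t n : cis t ^+ n = cis (n%:R * t).
Proof.
elim: n => [|n IH]; first by rewrite expr0 mul0r cis0.
by rewrite exprS IH -cisD -[in RHS]natr1 mulrDl mul1r addrC.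
Qed.

Lemma cis2pi : cis (2 * pi) = 1.
Proof. by rewrite /cis mulrC mulr_natr cos2pi sin2pi. Qed.

Lemma cis_int2pi k : cis (k%:~R * (2 * pi)) = 1.
Proof.
case: k => n; first by rewrite -pmulrn -cisX cis2pi expr1n.
by rewrite NegzE rmorphN/= mulNr cisN -pmulrn -cisX cis2pi expr1n conjc1.
Qed.

Lemma cmeasurable_cis (k : R) : cmeasurable_on setT (fun t : Rm => cis (k * t)).
Proof.
have mk : measurable_fun setT (fun t : Rm => k * t).
  apply: (@continuous_measurable_fun R (fun t => k * t)) => x.
  by apply: cvgM; [exact: cvg_cst|exact: cvg_id].
split => /=.
- exact: (measurableT_comp measurable_cos mk).
- exact: (measurableT_comp measurable_sin mk).
Qed.

(** The base point is left free because polar coordinates come with -(pi / 2) while [circle_int]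
    starts at 0. *)
Definition circ a : set Rm := `]a, a + 2 * pi]%classic.

Lemma measurable_circ a : measurable (circ a).
Proof. exact: measurable_itv. Qed.

Lemma lebesgue_circ a : leb (circ a) = (2 * pi)%:E.
Proof.
have p0 : 0 < 2 * pi :> R by rewrite mulr_gt0 ?pi_gt0.
rewrite /circ lebesgue_measure_itv/= lte_fin ltrDl p0.
by rewrite -EFinD addrAC subrr add0r.
Qed.

Lemma lebesgue_circ_lty a : (leb (circ a) < +oo)%E.
Proof. by rewrite lebesgue_circ ltry. Qed.

Lemma cint_cis a k : cint leb (circ a) (fun t => cis (k%:~R * t)) =
  if k == 0 then (2 * pi)%:C else 0.
Proof.
case: eqVneq => [->|k0].
  rewrite (@eq_cint _ _ _ leb (circ a) _ (fun=> 1)).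
    by rewrite cint_cst; [rewrite mul1r; congr (_%:C); exact: (congr1 fine (lebesgue_circ a))|exact: measurable_circ].
  by move=> t _; rewrite mul0r cis0.
have p0 : 0 < 2 * pi :> R by rewrite mulr_gt0 ?pi_gt0.
have aI : a < a + 2 * pi by rewrite ltrDl.
have kR : k%:~R != 0 :> R by rewrite intr_eq0.
have ck (c : R) : continuous (fun t : R => c * t).
  by move=> x; apply: cvgM; [exact: cvg_cst|exact: cvg_id].
have dk (x : R) : is_derive x 1 (fun t : R => k%:~R * t) (k%:~R).
  have := @is_deriveZ _ _ _ (@id R) (k%:~R) x 1 1 (is_derive_id _ _).
  by rewrite [_ *: _]mulr1.
have cosk : continuous (fun t : R => cos (k%:~R * t)).
  by move=> x; apply: continuous_comp; [exact: ck|exact: continuous_cos].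
have sink : continuous (fun t : R => sin (k%:~R * t)).
  by move=> x; apply: continuous_comp; [exact: ck|exact: continuous_sin].
have per : cis (k%:~R * (a + 2 * pi)) = cis (k%:~R * a).
  by rewrite mulrDr cisD cis_int2pi mulr1.
have [pc ps] : cos (k%:~R * (a + 2 * pi)) = cos (k%:~R * a) /\
    sin (k%:~R * (a + 2 * pi)) = sin (k%:~R * a) by case: per => -> ->.
apply: complex_eqP; rewrite /= /Rintegral.
- have cF : continuous (fun t : R => (k%:~R)^-1 * sin (k%:~R * t)).
    by move=> x; apply: cvgM; [exact: cvg_cst|exact: sink].
  have dF (x : R) : x \in `]a, (a + 2 * pi)[ ->
      is_derive x 1 (fun t : R => (k%:~R)^-1 * sin (k%:~R * t)) (cos (k%:~R * x)).
    move=> _; have h1 := is_derive1_comp (f := sin) (is_derive_sin (k%:~R * x)) (dk x).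
    have := @is_deriveZ _ _ _ _ ((k%:~R)^-1) x 1 _ h1.
    by rewrite /GRing.scale/= mulrCA mulVf ?mulr1.
  apply: (etrans (congr1 fine (integral_derive_oc aI cF cosk dF))).
  by rewrite ps subrr.
- have cF : continuous (fun t : R => - (k%:~R)^-1 * cos (k%:~R * t)).
    by move=> x; apply: cvgM; [exact: cvg_cst|exact: cosk].
  have dF (x : R) : x \in `]a, (a + 2 * pi)[ ->
      is_derive x 1 (fun t : R => - (k%:~R)^-1 * cos (k%:~R * t)) (sin (k%:~R * x)).
    move=> _; have h1 := is_derive1_comp (f := cos) (is_derive_cos (k%:~R * x)) (dk x).
    apply: (is_derive_eq (@is_deriveZ _ _ _ _ (- (k%:~R)^-1) x 1 _ h1)).
    by rewrite /GRing.scale/=; field.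
  apply: (etrans (congr1 fine (integral_derive_oc aI cF sink dF))).
  by rewrite pc subrr.
Qed.

Lemma bounded_circ_cintegrable a (f : Rm -> R[i]) (B : R) :
  cmeasurable_on (circ a) f -> (forall t, circ a t -> normc (f t) <= B) ->
  cintegrable leb (circ a) f.
Proof.
exact: bounded_cintegrable (measurable_circ a) (lebesgue_circ_lty a).
Qed.

Lemma cintegrable_cis a (k : R) (c : R[i]) :
  cintegrable leb (circ a) (fun t => c * cis (k * t)).
Proof.
apply: cintegrableZ; first exact: measurable_circ.
apply: (@bounded_circ_cintegrable _ _ 1).
  by apply: (cmeasurable_onS measurableT) => //; exact: cmeasurable_cis.
by move=> t _; rewrite normc_cis.
Qed.

(** Orthogonality keeps the diagonal of the double sum. Arbitrary distinct frequencies cover alike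
    the modes, the Fejer kernel and the expansion at infinity. *)
Lemma parseval a (N : nat) (k : 'I_N -> int) (c : 'I_N -> R[i]) : injective k ->
  \int[leb]_(t in circ a) normc (\sum_i c i * cis ((k i)%:~R * t)) ^+ 2 =
  2 * pi * \sum_i normc (c i) ^+ 2.
Proof.
move=> injk.
transitivity (Re (cint leb (circ a) (fun t =>
    \sum_i \sum_j (c i * conjc (c j)) * cis ((k i - k j)%:~R * t)))).
  rewrite /=; apply: eq_Rintegral => t _.
  rewrite -[LHS]/(Re (normc (\sum_i c i * cis ((k i)%:~R * t)) ^+ 2)%:C).
  congr Re; rewrite -mulc_conj conjc_sum mulr_suml; apply: eq_bigr => i _.
  rewrite mulr_sumr; apply: eq_bigr => j _.
  by rewrite conjcM -cisN rmorphB/= mulrBl cisD; ring.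
rewrite cint_sum; last 2 first.
- exact: measurable_circ.
- move=> i _; apply: cintegrable_sum; first exact: measurable_circ.
  by move=> j _; exact: cintegrable_cis.
rewrite Re_sum mulr_sumr; apply: eq_bigr => i _.
rewrite cint_sum; last 2 first.
- exact: measurable_circ.
- by move=> j _; exact: cintegrable_cis.
rewrite (bigD1 i)//= big1 ?addr0 => [|j ji].
  rewrite cintZ; last 2 first.
  - exact: measurable_circ.
  - have := @cintegrable_cis a ((k i - k i)%:~R) 1.
    by under eq_fun do rewrite mul1r.
  by rewrite cint_cis subrr eqxx mulc_conj -rmorphM/= mulrC.
rewrite cintZ; last 2 first.
- exact: measurable_circ.
- have := @cintegrable_cis a ((k i - k j)%:~R) 1.
  by under eq_fun do rewrite mul1r.
rewrite cint_cis subr_eq0; case: eqP => [/injk e|_]; last by rewrite mulr0.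
by rewrite e eqxx in ji.
Qed.

End cis.

(** * Integrals over the unit disk in polar coordinates *)

Section disk_integral.
Context {R : realType}.
Local Notation leb := (@lebesgue_measure R).
Local Notation Rm := (measurableTypeR R).

(** Written without a square root, so that measurability is that of a polynomial inequality;
    [udiskE] links it with [in_disk]. *)
Definition udisk : set (Rm * Rm) := [set p | p.1 ^+ 2 + p.2 ^+ 2 < 1].

Lemma udiskE (p : Rm * Rm) : udisk p <-> in_disk (toC p).
Proof.
rewrite /udisk /in_disk/= -[Num.sqrt _ < 1](@ltr_pXn2r _ 2)// ?nnegrE ?sqrtr_ge0// expr1n.
by rewrite sqr_sqrtr// addr_ge0// sqr_ge0.
Qed.

Lemma measurable_udisk : measurable udisk.
Proof.
rewrite -[X in measurable X]setTI.
apply: (measurable_fun_ltr (f := fun p : Rm * Rm => p.1 ^+ 2 + p.2 ^+ 2)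
  (g := fun=> 1)) => //.
by apply: measurable_funD; exact: measurable_funX.
Qed.

Lemma measurable_unit_ring : measurable (`]0%R, 1%R[%classic : set Rm).
Proof. exact: measurable_itv. Qed.

(** The crude bound by the square of side 2 suffices, because the area enters error terms only. *)
Lemma udisk_le4 : ((leb \x leb)%E udisk <= 4%:E)%E.
Proof.
pose Q : set Rm := `[(- 1)%R, 1%R]%classic.
have mQ : measurable Q by exact: measurable_itv.
apply: (@le_trans _ _ ((leb \x leb)%E (Q `*` Q))).
  apply: le_measure; rewrite ?inE//.
  - exact: measurable_udisk.
  - exact: measurableX.
  - move=> [x y] /=; rewrite /udisk /Q /= => xy; rewrite !in_itv/= -!ler_norml.
    split; rewrite -(@ler_pXn2r _ 2)// ?nnegrE// expr1n real_normK ?num_real//.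
      by rewrite (le_trans _ (ltW xy))// lerDl sqr_ge0.
    by rewrite (le_trans _ (ltW xy))// lerDr sqr_ge0.
have Q2 : leb Q = 2%:E.
  by rewrite /Q lebesgue_measure_itv/= lte_fin ifT; [rewrite -EFinD; congr (_%:E); lra|lra].
rewrite (_ : (leb \x leb)%E (Q `*` Q) = (leb Q * leb Q)%E).
  by rewrite Q2 -EFinM lee_fin; lra.
exact: product_measure1E.
Qed.

Lemma udisk_lty : ((leb \x leb)%E udisk < +oo)%E.
Proof. exact: (le_lt_trans udisk_le4 (ltry _)). Qed.

Lemma unit_itv_lty : (leb `]0%R, 1%R[%classic < +oo)%E.
Proof. by rewrite lebesgue_measure_itv/= lte_fin ltr01 -EFinD ltry. Qed.

Lemma integrable_le d (T : measurableType d) (m : {measure set T -> \bar R})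
    (D : set T) (f : T -> R) (B : R) :
  measurable D -> (m D < +oo)%E -> measurable_fun D f ->
  (forall x, D x -> `|f x| <= B) -> m.-integrable D (EFin \o f).
Proof.
move=> mD fD mf fB; apply: measurable_bounded_integrable => //.
exists B; split; first exact: num_real.
by move=> M BM x Dx; rewrite /= (le_trans (fB _ Dx))// ltW.
Qed.

(** Tonelli's theorem gives measurability for nonnegative integrands, so the bound [B] is added to
    [K] and its integral subtracted afterwards. *)
Lemma measurable_Rintegral_section (J : set Rm) (K : Rm * Rm -> R) (B : R) :
  measurable J -> (leb J < +oo)%E ->
  measurable_fun setT K -> (forall p, `|K p| <= B) ->
  measurable_fun setT (fun r : Rm => \int[leb]_(t in J) K (r, t)).
Proof.
move=> mJ fJ mK KB.
have mKr r : measurable_fun J (fun t => K (r, t)).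
  by apply: measurable_funTS; exact: (measurable_fun_pair2 r mK).
have iK r : leb.-integrable J (EFin \o (fun t => K (r, t))).
  exact: (integrable_le mJ fJ (mKr r) (fun t _ => KB _)).
have iB : leb.-integrable J (EFin \o (fun=> B)).
  by apply: (integrable_le (B := `|B|) mJ fJ) => //; exact: measurable_cst.
have -> : (fun r : Rm => \int[leb]_(t in J) K (r, t)) =
    (fun r => fine (\int[leb]_t ((fun p => (K p + B)%:E) \_ (snd @^-1` J)) (r, t))%E -
              \int[leb]_(t in J) B).
  apply/funext => r; apply/eqP; rewrite eq_sym subr_eq -RintegralD//; apply/eqP.
  by rewrite /Rintegral [in RHS]integral_mkcond; congr fine.
apply: measurable_funB; last exact: measurable_cst.
apply: measurableT_comp => //.
apply: (@measurable_fun_fubini_tonelli_F _ _ Rm Rm R leb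
   ((fun p => (K p + B)%:E) \_ (snd @^-1` J))).
- apply/(measurable_restrictT _ _).1.
    by rewrite -[X in measurable X]setTI; apply: measurable_snd.
  apply: measurable_funTS; apply/measurable_EFinP.
  by apply: measurable_funD => //; exact: measurable_cst.
- move=> p; apply: erestrict_ge0 => q _; rewrite lee_fin.
  by rewrite -lerBlDr sub0r; have := KB q; rewrite ler_norml => /andP[].
Qed.

Local Notation J := (circ (- (pi / 2)) : set Rm).

Lemma Rintegral_polar_ge0 (g : Rm * Rm -> R) (B : R) :
  measurable_fun setT g -> (forall p, 0 <= g p <= B) ->
  \int[(leb \x leb)%E]_(p in udisk) g p =
  \int[leb]_(r in `]0%R, 1%R[) (r * \int[leb]_(t in J) g (polar (r, t))).
Proof.
move=> mg gB.
have g0 p : 0 <= g p by case/andP: (gB p).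
have gleB p : g p <= B by case/andP: (gB p).
have mgp : measurable_fun setT (g \o polar) by exact: (measurableT_comp mg measurable_polar).
have JE : `](- (pi / 2))%R, (pi / 2 + pi)%R]%classic = J.
  have Epi : pi / 2 + pi = - (pi / 2) + 2 * pi :> R by lra.
  by rewrite /circ Epi.
rewrite /Rintegral; congr fine; rewrite integral_mkcond.
apply: (etrans (@ge0_integral_polar _ ((EFin \o g) \_ udisk) _ _)).
- apply/(measurable_restrictT _ _).1; first exact: measurable_udisk.
  by apply: measurable_funTS; exact/measurable_EFinP.
- by move=> p; apply: erestrict_ge0 => q _; rewrite lee_fin.
rewrite JE.
(* [S] is the punctured disk in polar coordinates; extending the integrand by 0 outside it lets
   Tonelli exchange the two integrals. *)
pose S : set (Rm * Rm) := (fst @^-1` `]0%R, 1%R[) `&` (snd @^-1` J).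
have mS : measurable S.
  apply: measurableI; rewrite -[X in measurable X]setTI.
    by apply: measurable_fst => //; exact: measurable_itv.
  by apply: measurable_snd => //; exact: measurable_circ.
pose K := (fun p : Rm * Rm => (p.1 * g (polar p))%:E) \_ S.
have mK : measurable_fun setT K.
  apply/(measurable_restrictT _ _).1 => //.
  apply: measurable_funTS; apply/measurable_EFinP.
  by apply: measurable_funM.
have K0 p : (0 <= K p)%E.
  apply: erestrict_ge0 => q [/=]; rewrite in_itv/= => /andP[q0 _] _.
  by rewrite lee_fin mulr_ge0// ltW.
transitivity (\int[leb]_t \int[leb]_r K (r, t))%E.
  rewrite [LHS]integral_mkcond; apply: eq_integral => t _.
  rewrite patchE; case: ifPn => tJ; last first.
    rewrite integral0_eq// => r _; rewrite /K patchE memNset//= => -[_ /= Jt].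
    by move: tJ; rewrite mem_set.
  rewrite [LHS]integral_mkcond; apply: eq_integral => r _.
  rewrite /K !patchE.
  have uE : r \in `]0%R, +oo[%classic -> (polar (r, t) \in udisk) = (r < 1).
    rewrite inE/= in_itv/= andbT => r0; apply/idP/idP.
      rewrite inE /udisk/= !exprMn -mulrDr cos2Dsin2 mulr1.
      by rewrite -[X in _ < X](expr1n _ 2) ltr_pXn2r// nnegrE ltW.
    move=> r1; rewrite inE /udisk/= !exprMn -mulrDr cos2Dsin2 mulr1.
    by rewrite -[X in _ < X](expr1n _ 2) ltr_pXn2r// nnegrE ltW.
  case: ifPn => r0; last first.
    rewrite memNset// => -[/=]; rewrite in_itv/= => /andP[h _] _.
    by move: r0; rewrite notin_setE/= in_itv/= h.
  rewrite uE//; case: ifPn => r1.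
    rewrite mem_set/=; first by rewrite -EFinM mulrC.
    split; last by rewrite inE in tJ.
    by move: r0; rewrite inE/= !in_itv/= andbT => ->.
  rewrite mul0e memNset// => -[/=]; rewrite in_itv/= => /andP[_ h] _.
  by rewrite h in r1.
rewrite -(@fubini_tonelli _ _ Rm Rm R leb leb K mK K0).
rewrite [RHS]integral_mkcond; apply: eq_integral => r _; rewrite patchE.
case: ifPn => rI; last first.
  rewrite integral0_eq// => t _; rewrite /K patchE memNset//= => -[/= Ir _].
  by move: rI; rewrite mem_set.
have igr : leb.-integrable J (EFin \o (fun t => g (polar (r, t)))).
  apply: (integrable_le (B := B) (measurable_circ _) (lebesgue_circ_lty _)).
    by apply: measurable_funTS; exact: (measurable_fun_pair2 r mgp).
  by move=> t _; rewrite ger0_norm.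
rewrite EFinM /Rintegral fineK; last first.
  exact: (integrable_fin_num (measurable_circ _) igr).
rewrite -integralZl//; last exact: measurable_circ.
rewrite [RHS]integral_mkcond; apply: eq_integral => t _.
rewrite /K !patchE; case: ifPn => [|SN].
  by rewrite inE => -[_ /= Jt]; rewrite mem_set.
rewrite memNset// => Jt; move: SN; rewrite notin_setE; apply; split => //=.
by rewrite inE in rI.
Qed.

(** The nonnegative case is applied to [g + B] and to the constant [B], and the results are
    subtracted. *)
Lemma Rintegral_polar (g : Rm * Rm -> R) (B : R) :
  measurable_fun setT g -> (forall p, `|g p| <= B) ->
  \int[(leb \x leb)%E]_(p in udisk) g p =
  \int[leb]_(r in `]0%R, 1%R[) (r * \int[leb]_(t in J) g (polar (r, t))).
Proof.
move=> mg gB.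
have B0 : 0 <= B by apply: le_trans (gB (0, 0)).
have mgp : measurable_fun setT (g \o polar) by exact: (measurableT_comp mg measurable_polar).
have mgB : measurable_fun setT (fun p => g p + B).
  by apply: measurable_funD => //; exact: measurable_cst.
have H1 := @Rintegral_polar_ge0 (fun p => g p + B) (B + B) mgB.
have H2 := @Rintegral_polar_ge0 (fun=> B) B (measurable_cst _).
have mJ := measurable_circ (- (pi / 2)) : measurable J.
have fJ := lebesgue_circ_lty (- (pi / 2)) : (leb J < +oo)%E.
have iB2 : (leb \x leb)%E.-integrable udisk (EFin \o (fun=> B)).
  apply: (integrable_le (B := `|B|) measurable_udisk udisk_lty) => //.
have ig2 : (leb \x leb)%E.-integrable udisk (EFin \o g).
  apply: (integrable_le (B := B) measurable_udisk udisk_lty) => //.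
  exact: measurable_funTS.
have iBJ : leb.-integrable J (EFin \o (fun=> B)).
  by apply: (integrable_le (B := `|B|) mJ fJ).
have igJ r : leb.-integrable J (EFin \o (fun t => g (polar (r, t)))).
  apply: (integrable_le (B := B) mJ fJ) => //.
  by apply: measurable_funTS; exact: (measurable_fun_pair2 r mgp).
have mr : measurable_fun setT (fun r : Rm => r) by [].
have bI (h : Rm * Rm -> R) : measurable_fun setT h -> (forall p, `|h p| <= B) ->
    leb.-integrable `]0%R, 1%R[%classic
      (EFin \o (fun r : Rm => r * \int[leb]_(t in J) h (polar (r, t)))).
  move=> mh hB.
  have mhp : measurable_fun setT (h \o polar) by exact: (measurableT_comp mh measurable_polar).
  apply: (integrable_le (B := B * (2 * pi)) measurable_unit_ring unit_itv_lty).
    apply: measurable_funTS; apply: measurable_funM => //.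
    exact: (measurable_Rintegral_section mJ fJ mhp (fun p => hB (polar p))).
  move=> r; rewrite /= in_itv/= => /andP[r0 r1].
  rewrite normrM -[leRHS]mul1r ler_pM// ?normr_ge0//; first by rewrite gtr0_norm// ltW.
  have ih : leb.-integrable J (EFin \o (fun t => h (polar (r, t)))).
    apply: (integrable_le (B := B) mJ fJ) => //.
    by apply: measurable_funTS; exact: (measurable_fun_pair2 r mhp).
  apply: (le_trans (le_normr_Rintegral mJ ih)).
  have -> : B * (2 * pi) = \int[leb]_(t in J) B.
    by rewrite Rintegral_cst//; congr (_ * _); exact/esym/(congr1 fine (lebesgue_circ _)).
  apply: le_Rintegral => //.
  apply: (integrable_le (B := B) mJ fJ) => //.
    apply: measurableT_comp => //.
    by apply: measurable_funTS; exact: (measurable_fun_pair2 r mhp).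
  by move=> t _; rewrite normr_id.
have := H1; rewrite RintegralD//; last exact: measurable_udisk.
have -> : \int[leb]_(r in `]0%R, 1%R[) (r * \int[leb]_(t in J) (g (polar (r, t)) + B)) =
  \int[leb]_(r in `]0%R, 1%R[) (r * \int[leb]_(t in J) g (polar (r, t))) +
  \int[leb]_(r in `]0%R, 1%R[) (r * \int[leb]_(t in J) B).
  rewrite -RintegralD//.
  - by apply: eq_Rintegral => r _; rewrite RintegralD// mulrDr.
  - exact: bI.
  - apply: (bI (fun=> B)); first exact: measurable_cst.
    by move=> p; rewrite ger0_norm.
rewrite H2; last by move=> p; rewrite B0 lexx.
move=> H; apply: (addIr (\int[leb]_(r in `]0%R, 1%R[) (r * \int[leb]_(t in J) B))).
apply: H => p; have := gB p; rewrite ler_norml => /andP[h1 h2].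
by rewrite -lerBlDr sub0r h1 lerD2r h2.
Qed.

End disk_integral.

(** * Square norms of vectors of integrals *)

Section l2_cint.
Context d (T : measurableType d) {R : realType} (m : {measure set T -> \bar R}).

(** The weight c = 1 / x balances the two terms and gives S <= S / 2 + a x^2 / 2. *)
Lemma bessel_like (S a x : R) : 0 <= a -> 0 < x ->
  (forall c, 0 < c -> S <= (c * S + a / c) / 2 * x) -> S <= a * x ^+ 2.
Proof.
move=> a0 x0 /(_ x^-1); rewrite invr_gt0 => /(_ x0).
have -> : (x^-1 * S + a / x^-1) / 2 * x = S / 2 + a * x ^+ 2 / 2.
  by field; rewrite gt_eqF.
lra.
Qed.

(* Duality: pairing the vector of integrals V with itself and bounding
   |<V, v(x)>| <= (c |V|^2 + |v(x)|^2 / c) / 2 under the integral sign. *)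
Lemma l2_cint_le (N : nat) (D : set T) (v : 'I_N -> T -> R[i]) (B x : R) :
  measurable D -> (m D <= x%:E)%E -> 0 < x ->
  (forall i, cmeasurable_on D (v i)) ->
  (forall t, D t -> \sum_i normc (v i t) ^+ 2 <= B ^+ 2) ->
  \sum_i normc (cint m D (v i)) ^+ 2 <= (B * x) ^+ 2.
Proof.
move=> mD Dx x0 mv vB.
have fD : (m D < +oo)%E by apply: le_lt_trans Dx (ltry _).
pose V i := cint m D (v i).
have vB1 i t : D t -> normc (v i t) <= `|B|.
  move=> Dt; rewrite -(@ler_pXn2r _ 2)// ?nnegrE ?normc_ge0//.
  rewrite real_normK ?num_real// (le_trans _ (vB _ Dt))//.
  by rewrite (bigD1 i)//= lerDl sumr_ge0// => j _; rewrite sqr_ge0.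
have iv i : cintegrable m D (v i).
  exact: (bounded_cintegrable mD fD (mv i) (vB1 i)).
set S := \sum_i _.
have SE : S = Re (cint m D (fun t => \sum_i conjc (V i) * v i t)).
  rewrite cint_sum//; last by move=> i _; exact: cintegrableZ.
  rewrite Re_sum; apply: eq_bigr => i _.
  by rewrite cintZ// mulrC mulc_conj.
rewrite exprMn; apply: bessel_like => // [|c c0]; first exact: sqr_ge0.
pose b := (c * S + B ^+ 2 / c) / 2.
have S0 : 0 <= S by apply: sumr_ge0 => i _; exact: sqr_ge0.
have b0 : 0 <= b.
  apply: divr_ge0 => //; apply: addr_ge0; first exact: mulr_ge0 (ltW c0) S0.
  exact: divr_ge0 (sqr_ge0 _) (ltW c0).
apply: (@le_trans _ _ (b * fine (m D))); last first.
  by rewrite ler_wpM2l// -lee_fin fineK// ge0_fin_numE.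
rewrite {1}SE (le_trans (ler_norm _))// (le_trans (ler_Re_normc _))//.
apply: normc_cint_le => //.
  apply: cmeasurable_on_sum => i _.
  by apply: cmeasurable_onM; [exact: cmeasurable_on_cst|exact: mv].
move=> t Dt; apply: (le_trans (ler_normc_sum _ _ _)).
apply: (@le_trans _ _ (\sum_i (c * normc (V i) ^+ 2 + normc (v i t) ^+ 2 / c) / 2)).
  apply: ler_sum => i _; rewrite Normc.normcM normc_conj -subr_ge0.
  set p := normc _; set q := normc _.
  have -> : (c * p ^+ 2 + q ^+ 2 / c) / 2 - p * q = (c * p - q) ^+ 2 / c / 2.
    by field; rewrite gt_eqF.
  by rewrite !divr_ge0 ?sqr_ge0// ltW.
rewrite -mulr_suml ler_wpM2r// big_split/= -mulr_sumr -mulr_suml.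
by rewrite lerD2l ler_wpM2r ?invr_ge0 ?(ltW c0) ?vB.
Qed.

End l2_cint.

(** * Moments and angular Fourier modes *)

Section modes.
Context {R : realType}.
Local Notation leb := (@lebesgue_measure R).
Local Notation Rm := (measurableTypeR R).
Local Notation J := (circ (- (pi / 2)) : set Rm).
Local Notation leb2 := (lebesgue_measure \x lebesgue_measure)%E.

Lemma toC_polar (r t : Rm) : toC (polar (r, t)) = r%:C * cis t.
Proof. by apply: complex_eqP; rewrite ?ReM ?ImM /toC /polar /cis/=; ring. Qed.

Lemma normc_rcis (r t : R) : normc (r%:C * cis t) = `|r|.
Proof. by rewrite Normc.normcM normc_cis mulr1 normc_real. Qed.

Lemma cint_polar (F : R[i] -> R[i]) (B : R) :
  cmeasurable F -> (forall z, normc (F z) <= B) ->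
  cint leb2 (@udisk R) (F \o @toC R) =
  cint leb `]0%R, 1%R[ (fun r => r%:C * cint leb J (fun t => F (r%:C * cis t))).
Proof.
move=> [F1 F2] FB; apply: complex_eqP => /=.
- rewrite (Rintegral_polar F1 (B := B)).
    apply: eq_Rintegral => r _; rewrite mul0r subr0; congr (_ * _).
    by apply: eq_Rintegral => t _; rewrite toC_polar.
  by move=> p; exact: le_trans (ler_Re_normc _) (FB _).
- rewrite (Rintegral_polar F2 (B := B)).
    apply: eq_Rintegral => r _; rewrite mul0r addr0; congr (_ * _).
    by apply: eq_Rintegral => t _; rewrite toC_polar.
  by move=> p; exact: le_trans (ler_Im_normc _) (FB _).
Qed.

(* The [k]-th angular Fourier coefficient of [f (r e^it) e^(-2it)]; the twist by
   [e^(-2it)] makes pull-back by [z^q] act by plain composition. *)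
Definition mode (f : R[i] -> R[i]) (k : int) (r : R) : R[i] :=
  ((2 * pi)^-1)%:C *
  cint leb J (fun t => f (r%:C * cis t) * cis ((k - 2)%:~R * t)).

Definition moment (f : R[i] -> R[i]) (n : nat) : R[i] :=
  cint leb2 (@udisk R) (fun p => f (toC p) * toC p ^+ n).

Lemma cmeasurable_toC : cmeasurable_on setT (@toC R : Rm * Rm -> R[i]).
Proof. by split; [exact: measurable_fst|exact: measurable_snd]. Qed.

Lemma chiD_le1 (z : R[i]) : chiD z <= 1.
Proof. by rewrite /chiD; case: ifP. Qed.

Variable f : R[i] -> R[i].
Hypotheses (mf : cmeasurable f) (fD : bounded_by_chiD f).

Let pi20 : 0 < 2 * pi :> R. Proof. by rewrite mulr_gt0 ?pi_gt0. Qed.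

Lemma bounded_by1 z : normc (f z) <= 1.
Proof. exact: le_trans (fD z) (chiD_le1 z). Qed.

Lemma cmeasurable_mode_integrand (k : R) :
  cmeasurable_on setT (fun p : Rm * Rm => f (p.1%:C * cis p.2) * cis (k * p.2)).
Proof.
apply: cmeasurable_onM.
  have := cmeasurable_on_comp (@measurable_polar R) (f := f \o @toC R) mf.
  by apply: eq_cmeasurable_on => -[r t] _ /=; rewrite toC_polar.
exact: (cmeasurable_on_comp measurable_snd (cmeasurable_cis k)).
Qed.

Lemma normc_mode_integrand (k : R) p :
  normc (f (p.1%:C * cis p.2) * cis (k * p.2)) <= 1.
Proof. by rewrite Normc.normcM normc_cis mulr1 bounded_by1. Qed.

Lemma cmeasurable_circ_integrand (k r : R) :
  cmeasurable_on J (fun t => f (r%:C * cis t) * cis (k * t)).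
Proof.
apply: (cmeasurable_onS measurableT) => //.
have [m1 m2] := cmeasurable_mode_integrand k.
by split; [exact: (measurable_fun_pair2 r m1)|exact: (measurable_fun_pair2 r m2)].
Qed.

Lemma cintegrable_circ_integrand (k r : R) :
  cintegrable leb J (fun t => f (r%:C * cis t) * cis (k * t)).
Proof.
apply: (bounded_circ_cintegrable (B := 1)).
  exact: cmeasurable_circ_integrand.
by move=> t _; exact: (normc_mode_integrand k (r, t)).
Qed.

Lemma cmeasurable_mode (k : int) : cmeasurable_on setT (fun r : Rm => mode f k r).
Proof.
apply: cmeasurable_onM; first exact: cmeasurable_on_cst.
have [m1 m2] := cmeasurable_mode_integrand ((k - 2)%:~R).
have mJ := measurable_circ (- (pi / 2)) : measurable J.
have fJ := lebesgue_circ_lty (- (pi / 2)) : (leb J < +oo)%E.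
split => /=.
- apply: (measurable_Rintegral_section mJ fJ m1) => p.
  exact: le_trans (ler_Re_normc _) (normc_mode_integrand _ _).
- apply: (measurable_Rintegral_section mJ fJ m2) => p.
  exact: le_trans (ler_Im_normc _) (normc_mode_integrand _ _).
Qed.

Lemma normc_2piV : normc (((2 * pi)^-1)%:C : R[i]) = (2 * pi)^-1.
Proof. by rewrite normc_real ger0_norm// invr_ge0 ltW. Qed.

(** Pairing [f] with the trigonometric polynomial [Q] whose coefficients are the conjugate modes
    gives back S. Since |f| <= 1 and |Q| <= 1/2 + |Q|^2 / 2, Parseval yields S <= 1/2 + S / 2. *)
Lemma bessel_mode (N : nat) (k : 'I_N -> int) (r : R) : injective k ->
  \sum_i normc (mode f (k i) r) ^+ 2 <= 1.
Proof.
move=> injk; set S := \sum_i _.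
have mJ := measurable_circ (- (pi / 2)) : measurable J.
pose h i := mode f (k i) r.
pose Q t := \sum_i conjc (h i) * cis ((k i - 2)%:~R * t).
have mQ : cmeasurable_on setT (Q : Rm -> R[i]).
  apply: cmeasurable_on_sum => i _; apply: cmeasurable_onM.
    exact: cmeasurable_on_cst.
  exact: cmeasurable_cis.
have QB t : normc (Q t) <= \sum_i normc (h i).
  apply: (le_trans (ler_normc_sum _ _ _)); apply: ler_sum => i _.
  by rewrite Normc.normcM normc_conj normc_cis mulr1.
have SE : S = Re (((2 * pi)^-1)%:C * cint leb J (fun t => f (r%:C * cis t) * Q t)).
  have -> : cint leb J (fun t => f (r%:C * cis t) * Q t) =
      \sum_i conjc (h i) * cint leb J (fun t => f (r%:C * cis t) * cis ((k i - 2)%:~R * t)).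
    rewrite (eq_bigr (fun i => cint leb J (fun t =>
      conjc (h i) * (f (r%:C * cis t) * cis ((k i - 2)%:~R * t))))); last first.
      by move=> i _; rewrite cintZ//; exact: cintegrable_circ_integrand.
    rewrite -cint_sum//.
      apply: eq_cint => t _; rewrite mulr_sumr; apply: eq_bigr => i _.
      by rewrite mulrCA.
    move=> i _; apply: cintegrableZ => //; exact: cintegrable_circ_integrand.
  rewrite mulr_sumr Re_sum; apply: eq_bigr => i _.
  by rewrite mulrCA -/(mode f (k i) r) -/(h i) mulrC mulc_conj.
have fJ := lebesgue_circ_lty (- (pi / 2)) : (leb J < +oo)%E.
have iQ : leb.-integrable J (EFin \o (fun t => normc (Q t) ^+ 2)).
  apply: (integrable_le (B := (\sum_i normc (h i)) ^+ 2) mJ fJ).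
    apply: measurable_funX; apply: measurable_funTS.
    exact: cmeasurable_on_normc.
  move=> t _; rewrite ger0_norm ?sqr_ge0// ler_pXn2r ?nnegrE ?normc_ge0//.
  exact: le_trans (normc_ge0 _) (QB t).
have i1 : leb.-integrable J (EFin \o (fun=> 1)).
  by apply: (integrable_le (B := 1) mJ fJ) => // t _; rewrite normr1.
have iu : leb.-integrable J (EFin \o (fun t => 1 / 2 + normc (Q t) ^+ 2 / 2)).
  apply: (integrable_le (B := 1 / 2 + (\sum_i normc (h i)) ^+ 2 / 2) mJ fJ).
    apply: measurable_funD => //; apply: measurable_funM => //.
    apply: measurable_funX; apply: measurable_funTS.
    exact: cmeasurable_on_normc.
  move=> t _; rewrite ger0_norm ?addr_ge0 ?divr_ge0 ?sqr_ge0// lerD2l ler_pM2r//.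
  rewrite ler_pXn2r ?nnegrE ?normc_ge0//.
  exact: le_trans (normc_ge0 _) (QB t).
have : S <= (2 * pi)^-1 * \int[leb]_(t in J) (1 / 2 + normc (Q t) ^+ 2 / 2).
  rewrite SE (le_trans (ler_norm _))// (le_trans (ler_Re_normc _))//.
  rewrite Normc.normcM normc_2piV ler_wpM2l ?invr_ge0 ?(ltW pi20)//.
  apply: le_normc_cint => //.
    apply: (bounded_circ_cintegrable (B := \sum_i normc (h i))).
      apply: cmeasurable_onM; last exact: (cmeasurable_onS measurableT).
      have := cmeasurable_circ_integrand 0 r.
      by apply: eq_cmeasurable_on => t _; rewrite mul0r cis0 mulr1.
    move=> t _; rewrite Normc.normcM -[leRHS]mul1r ler_pM ?normc_ge0//.
    exact: bounded_by1.
  move=> t _; rewrite Normc.normcM.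
  apply: (@le_trans _ _ (normc (Q t))).
    by rewrite -[leRHS]mul1r ler_wpM2r ?normc_ge0 ?bounded_by1.
  set q := normc _; rewrite -subr_ge0.
  have -> : 1 / 2 + q ^+ 2 / 2 - q = (1 - q) ^+ 2 / 2 by field.
  by rewrite divr_ge0 ?sqr_ge0.
have -> : \int[leb]_(t in J) (1 / 2 + normc (Q t) ^+ 2 / 2) =
    (2 * pi) / 2 + (2 * pi) * S / 2.
  rewrite RintegralD//; last 2 first.
  - by apply: (integrable_le (B := 1 / 2) mJ fJ) => // t _; rewrite ger0_norm.
  - apply: (integrable_le (B := (\sum_i normc (h i)) ^+ 2 / 2) mJ fJ).
      apply: measurable_funM => //; apply: measurable_funX; apply: measurable_funTS.
      exact: cmeasurable_on_normc.
    move=> t _; rewrite ger0_norm ?divr_ge0 ?sqr_ge0// ler_pM2r//.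
    rewrite ler_pXn2r ?nnegrE ?normc_ge0//.
    exact: le_trans (normc_ge0 _) (QB t).
  rewrite Rintegral_cst// RintegralZr//; congr (_ + _ / 2).
    rewrite mulrC div1r; congr (_ / 2); exact: (congr1 fine (lebesgue_circ _)).
  rewrite parseval; last by move=> i j /addIr /injk.
  by congr (_ * _); apply: eq_bigr => i _; rewrite normc_conj.
have -> : (2 * pi)^-1 * (2 * pi / 2 + 2 * pi * S / 2) = 1 / 2 + S / 2.
  by move: (lt0r_neq0 pi20); set P := 2 * pi => P0; field.
lra.
Qed.

Lemma normc_mode_le1 (k : int) (r : R) : normc (mode f k r) <= 1.
Proof.
have inj1 : injective (fun _ : 'I_1 => k) by move=> i j _; rewrite !ord1.
have := bessel_mode r inj1; rewrite big_ord1 => h; rewrite -(@ler_pXn2r _ 2)// ?nnegrE ?normc_ge0//.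
by rewrite expr1n.
Qed.

(** In polar coordinates z^n and the area element give r^(n+1) and the frequency n, which the twist
    in [mode] numbers n + 2. *)
Lemma momentE (n : nat) : moment f n = (2 * pi)%:C *
  cint leb `]0%R, 1%R[ (fun r => (r ^+ n.+1)%:C * mode f n.+2 r).
Proof.
have -> : moment f n = cint leb2 (@udisk R) ((fun z => f z * z ^+ n) \o @toC R) by [].
have mr (k : nat) : cmeasurable_on setT (fun r : Rm => (r ^+ k)%:C).
  by apply: cmeasurable_on_real; exact: measurable_funX.
rewrite (@cint_polar _ 1).
- rewrite -cintZ; last 2 first.
  + exact: measurable_unit_ring.
  + apply: (bounded_cintegrable (B := 1) measurable_unit_ring unit_itv_lty).
      apply: (cmeasurable_onS measurableT) => //; apply: cmeasurable_onM => //.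
      exact: cmeasurable_mode.
    move=> r rI; have /andP[r0 r1] : 0 < r < 1 by move: rI; rewrite /= in_itv.
    rewrite Normc.normcM normc_real -[leRHS]mul1r ler_pM ?normr_ge0 ?normc_ge0//.
      by rewrite ger0_norm ?exprn_ge0 ?(ltW r0)// exprn_ile1 ?(ltW r0) ?(ltW r1).
    exact: normc_mode_le1.
  apply: eq_cint => r _; rewrite /mode.
  have -> : cint leb J (fun t => f (r%:C * cis t) * (r%:C * cis t) ^+ n) =
      (r ^+ n)%:C * cint leb J (fun t => f (r%:C * cis t) * cis ((n.+2%:Z - 2)%:~R * t)).
    rewrite -cintZ; last 2 first.
    - exact: measurable_circ.
    - exact: cintegrable_circ_integrand.
    apply: eq_cint => t _; rewrite exprMn cisX -rmorphXn/= mulrCA; congr (_ * (_ * cis (_ * _))).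
    by rewrite -addn2 PoszD addrK -pmulrn.
  set c := cint _ _ _.
  have p1 : (2 * pi)%:C * ((2 * pi)^-1)%:C = 1 :> R[i].
    by rewrite -rmorphM/= divff// gt_eqF.
  rewrite exprS rmorphM/= -[LHS]mul1r -p1; ring.
- apply: cmeasurable_onM; first exact: mf.
  exact: cmeasurable_onX cmeasurable_toC.
- move=> z; rewrite Normc.normcM normcX; have := fD z; rewrite /chiD.
  case: ifPn => [/asboolP zD f1|_ f0].
    rewrite -[leRHS]mul1r ler_pM ?exprn_ge0 ?normc_ge0//.
    by rewrite exprn_ile1 ?normc_ge0// ltW.
  have -> : normc (f z) = 0 by apply/eqP; rewrite eq_le f0 normc_ge0.
  by rewrite mul0r.
Qed.

End modes.

(** * Expansions at infinity *)

Section kernels.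
Context {R : realType}.
Local Notation leb := (@lebesgue_measure R).
Local Notation Rm := (measurableTypeR R).
Local Notation leb2 := (lebesgue_measure \x lebesgue_measure)%E.

Lemma cmeasurable_onV d (T : measurableType d) (D : set T) (f : T -> R[i]) :
  cmeasurable_on D f -> cmeasurable_on D (fun x => (f x)^-1).
Proof.
move=> mf.
(* The inverse modulus is written as a real power in order to use the measurability of powers; at 0
   both sides vanish. *)
have fVE z : z^-1 = conjc z * ((normc z `^ (-1)) ^+ 2)%:C :> R[i].
  rewrite powR_inv1 ?normc_ge0//.
  have [->|z0] := eqVneq z 0; first by rewrite invr0 Normc.normc0 invr0 expr0n mulr0.
  have nz : normc z != 0 by rewrite normc_eq0.
  apply: (mulfI z0); rewrite divff// mulrA mulc_conj -rmorphM/= exprVn divff//.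
  by rewrite expf_eq0.
under eq_fun do rewrite fVE.
apply: cmeasurable_onM; first exact: cmeasurable_on_conj.
apply: cmeasurable_on_real; apply: measurable_funX.
apply: (measurableT_comp (measurable_powR _)).
exact: cmeasurable_on_normc.
Qed.

Lemma ler_normcB (z w : R[i]) : normc z - normc w <= normc (z - w).
Proof.
rewrite lerBlDr; apply: le_trans (ler_normcD _ _).
by rewrite subrK.
Qed.

Lemma inv_sub_expansion (z w : R[i]) N : z != 0 -> z != w ->
  (z - w)^-1 = \sum_(n < N) w ^+ n / z ^+ n.+1 + w ^+ N / (z ^+ N * (z - w)).
Proof.
move=> z0 zw; have zw0 : z - w != 0 by rewrite subr_eq0.
elim: N => [|N IH]; first by rewrite big_ord0 !expr0 add0r !mul1r.
rewrite big_ord_recr/= {1}IH -addrA; congr (_ + _).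
rewrite !exprS; field.
by rewrite z0 zw0 expf_neq0.
Qed.

(** The remainder is kept in closed form: on |z| = r it carries the decay r^-N, its denominators
    being controlled by |z - w| >= r - 1. *)
Lemma inv_sub_sqr_expansion (z w : R[i]) N : z != 0 -> z != w ->
  ((z - w) ^+ 2)^-1 = \sum_(n < N) n.+1%:R * w ^+ n / z ^+ n.+2 +
    w ^+ N / z ^+ N * (N%:R / (z * (z - w)) + ((z - w) ^+ 2)^-1).
Proof.
move=> z0 zw; have zw0 : z - w != 0 by rewrite subr_eq0.
elim: N => [|N IH]; first by rewrite big_ord0 !expr0 add0r mul0r add0r divr1 mul1r.
rewrite big_ord_recr/= {1}IH -addrA; congr (_ + _).
rewrite !exprS -natr1; field.
by rewrite z0 zw0 expf_neq0.
Qed.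

Variable mu : R[i] -> R[i].
Hypotheses (mm : cmeasurable mu) (muD : bounded_by_chiD mu).

Lemma mu_out (p : Rm * Rm) : ~ udisk p -> mu (toC p) = 0.
Proof.
move=> pD; have := muD (toC p); rewrite /chiD asboolF; last by move/udiskE.
by move=> h; apply/eqP; rewrite -normc_eq0 eq_le h normc_ge0.
Qed.

Lemma cintegral_mu (A : set R[i]) (g : R[i] -> R[i]) :
  (forall z, in_disk z -> A z) ->
  cintegral A (fun w => mu w * g w) =
  cint leb2 (@udisk R) (fun p => mu (toC p) * g (toC p)).
Proof.
move=> DA; transitivity (cint leb2 (@toC R @^-1` A) (fun p => mu (toC p) * g (toC p))).
  by [].
rewrite cint_mkcond [RHS]cint_mkcond; apply: eq_cint => p _.
have [/[!inE] pD|pD] := boolP (p \in @udisk R).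
  by rewrite mem_set//; apply: DA; apply/udiskE.
by rewrite mu_out ?mul0r ?if_same// => h; move: pD; rewrite mem_set.
Qed.

Variables (z : R[i]) (r : R).
Hypotheses (r1 : 1 < r) (zr : normc z = r).

Let rm1 : 0 < r - 1. Proof. by rewrite subr_gt0. Qed.
Let r0 : 0 < r. Proof. exact: lt_trans ltr01 r1. Qed.

Let z0 : z != 0.
Proof. by rewrite -normc_gt0 zr. Qed.

Let w1 (p : Rm * Rm) : udisk p -> normc (toC p) < 1.
Proof. by move/udiskE. Qed.

Let zwB (p : Rm * Rm) : udisk p -> r - 1 <= normc (z - toC p).
Proof. by move/w1 => h; rewrite (le_trans _ (ler_normcB _ _))// zr lerD2l lerN2 ltW. Qed.

Let zw (p : Rm * Rm) : udisk p -> z != toC p.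
Proof. by move/zwB => h; rewrite -subr_eq0 -normc_gt0 (lt_le_trans _ h). Qed.

Lemma cmeasurable_mu_mul (g : R[i] -> R[i]) :
  cmeasurable_on setT (g \o @toC R) ->
  cmeasurable_on (@udisk R) (fun p => mu (toC p) * g (toC p)).
Proof.
move=> mg; apply: (cmeasurable_onS measurableT) => //.
exact: (cmeasurable_onM mm mg).
Qed.

Lemma cint_mu_le (g : R[i] -> R[i]) (B : R) : cmeasurable_on setT (g \o @toC R) ->
  (forall p, udisk p -> normc (g (toC p)) <= B) ->
  cintegrable leb2 (@udisk R) (fun p => mu (toC p) * g (toC p)) /\
  normc (cint leb2 (@udisk R) (fun p => mu (toC p) * g (toC p))) <= 4 * B.
Proof.
move=> mg gB.
have mh := cmeasurable_mu_mul mg.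
have hB p : udisk p -> normc (mu (toC p) * g (toC p)) <= B.
  move=> pD; rewrite Normc.normcM -[leRHS]mul1r ler_pM ?normc_ge0//; last exact: gB.
  exact: bounded_by1.
split; first exact: (bounded_cintegrable (@measurable_udisk R) (@udisk_lty R) mh hB).
apply: (le_trans (normc_cint_le (@measurable_udisk R) (@udisk_lty R) mh hB)).
have B0 : 0 <= B.
  apply: le_trans (normc_ge0 _) (gB (0, 0) _).
  by rewrite /udisk/= expr0n/= addr0.
rewrite mulrC ler_wpM2r// -lee_fin fineK; first exact: udisk_le4.
by rewrite ge0_fin_numE// udisk_lty.
Qed.

(** A uniform bound on the remainder of the kernel over the disk passes to the integral against
    [mu], at the cost of the area bound 4. *)
Lemma cint_mu_expansion (K : R[i] -> R[i]) (c : nat -> R[i]) (N : nat) (B : R) :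
  cmeasurable_on setT (K \o @toC R) ->
  (forall p, udisk p -> normc (K (toC p) - \sum_(n < N) c n * toC p ^+ n) <= B) ->
  normc (cint leb2 (@udisk R) (fun p => mu (toC p) * K (toC p)) -
         \sum_(n < N) c n * moment mu n) <= 4 * B.
Proof.
move=> mK KB.
have mpow n : cmeasurable_on setT ((fun w : R[i] => c n * w ^+ n) \o @toC R).
  apply: cmeasurable_onM; first exact: cmeasurable_on_cst.
  exact: cmeasurable_onX (@cmeasurable_toC R).
have msum : cmeasurable_on setT ((fun w : R[i] => \sum_(n < N) c n * w ^+ n) \o @toC R).
  by apply: cmeasurable_on_sum => n _; exact: mpow.
have mrem : cmeasurable_on setT
    ((fun w : R[i] => K w + (- 1) * (\sum_(n < N) c n * w ^+ n)) \o @toC R).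
  by apply: (cmeasurable_onD mK (cmeasurable_onM (cmeasurable_on_cst _ _) msum)).
have KB' p : udisk p -> normc (K (toC p) + (- 1) * (\sum_(n < N) c n * toC p ^+ n)) <= B.
  by move=> pD; rewrite mulN1r; exact: KB.
have [irem Brem] := cint_mu_le mrem KB'.
have ipow n : cintegrable leb2 (@udisk R) (fun p => mu (toC p) * toC p ^+ n).
  apply: (@cint_mu_le (fun w => w ^+ n) 1 _ _).1.
    exact: cmeasurable_onX (@cmeasurable_toC R).
  by move=> p pD; rewrite normcX exprn_ile1 ?normc_ge0// ltW// w1.
rewrite (_ : cint _ _ _ - _ = cint leb2 (@udisk R)
   (fun p => mu (toC p) * (K (toC p) + (- 1) * \sum_(n < N) c n * toC p ^+ n)))//.
apply/eqP; rewrite subr_eq; apply/eqP.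
have -> : \sum_(n < N) c n * moment mu n =
   cint leb2 (@udisk R) (fun p => \sum_(n < N) c n * (mu (toC p) * toC p ^+ n)).
  rewrite cint_sum; last 2 first.
  - exact: measurable_udisk.
  - by move=> n _; apply: cintegrableZ => //; exact: measurable_udisk.
  by apply: eq_bigr => n _; rewrite cintZ//; exact: measurable_udisk.
rewrite -cintD; last 3 first.
- exact: measurable_udisk.
- exact: irem.
- apply: cintegrable_sum; first exact: measurable_udisk.
  by move=> n _; apply: cintegrableZ => //; exact: measurable_udisk.
apply: eq_cint => p _; rewrite (_ : \sum_(n < N) c n * (mu (toC p) * _) =
    mu (toC p) * \sum_(n < N) c n * toC p ^+ n).
  by rewrite mulN1r mulrBr subrK.
by rewrite mulr_sumr; apply: eq_bigr => n _; rewrite mulrCA.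
Qed.

Let normc_piV_le : normc ((pi^-1)%:C : R[i]) <= 2^-1.
Proof.
by rewrite normc_real ger0_norm ?invr_ge0 ?pi_ge0// lef_pV2 ?posrE ?pi_gt0// pi_ge2.
Qed.

(** The factor 2 is the area bound 4 times the bound 1/2 for 1 / pi. *)
Lemma cauchy_tr_expansion N :
  normc (cauchy_tr mu z - (pi^-1)%:C * \sum_(n < N) moment mu n / z ^+ n.+1)
  <= 2 * (r ^- N / (r - 1)).
Proof.
rewrite /cauchy_tr (@cintegral_mu _ (fun w => (z - w)^-1))// -mulrBr.
have -> : \sum_(n < N) moment mu n / z ^+ n.+1 =
    \sum_(n < N) (z ^+ n.+1)^-1 * moment mu n.
  by apply: eq_bigr => n _; rewrite mulrC.
rewrite Normc.normcM.
rewrite (_ : 2 * _ = 2^-1 * (4 * (r ^- N / (r - 1)))); last by field; rewrite ?expf_neq0 ?gt_eqF.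
apply: ler_pM; rewrite ?normc_ge0 ?normc_piV_le//.
apply: (@cint_mu_expansion (fun w => (z - w)^-1) (fun n => (z ^+ n.+1)^-1)).
  apply: cmeasurable_onV; apply: cmeasurable_onD; first exact: cmeasurable_on_cst.
  have := cmeasurable_onM (cmeasurable_on_cst setT (-1)) (@cmeasurable_toC R).
  by apply: eq_cmeasurable_on => p _; rewrite mulN1r.
move=> p pD; rewrite (inv_sub_expansion N z0 (zw pD)).
rewrite (_ : _ - _ = toC p ^+ N / (z ^+ N * (z - toC p))).
  rewrite !Normc.normcM !Normc.normcV Normc.normcM !normcX zr invfM.
  rewrite -[leRHS]mul1r ler_pM ?exprn_ge0 ?normc_ge0//.
  - by rewrite mulr_ge0 ?invr_ge0 ?exprn_ge0 ?(ltW r0) ?normc_ge0.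
  - by rewrite exprn_ile1 ?normc_ge0// ltW// w1.
  - rewrite ler_wpM2l ?invr_ge0 ?exprn_ge0 ?(ltW r0)//.
    by rewrite lef_pV2 ?posrE ?(lt_le_trans rm1) ?zwB.
rewrite addrAC -[RHS]add0r; congr (_ + _); apply/eqP; rewrite subr_eq0; apply/eqP.
by apply: eq_bigr => n _; rewrite mulrC.
Qed.

(** Outside the closed disk the principal value is trivial: for eps < r - 1 the truncation removes
    no point of the disk. *)
Lemma beurlingE : beurling mu z =
  - (pi^-1)%:C * cint leb2 (@udisk R) (fun p => mu (toC p) * ((z - toC p) ^+ 2)^-1).
Proof.
set V := RHS.
have near0 : \forall eps \near (0 : R)^'+, beurling_trunc mu z eps = V.
  near=> eps; rewrite /beurling_trunc/=.
  rewrite (@cintegral_mu _ (fun w => ((z - w) ^+ 2)^-1))// => w /= wD.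
  have h : eps < r - 1 by near: eps; exact: nbhs_right_lt.
  rewrite (lt_le_trans h)// (le_trans _ (ler_normcB _ _))// zr lerD2l lerN2.
  exact: ltW.
rewrite /beurling; apply: complex_eqP.
- apply: lim_near_cst => //.
  by apply: filterS near0 => eps E; exact: (congr1 (@complex.Re R) E).
- apply: lim_near_cst => //.
  by apply: filterS near0 => eps E; exact: (congr1 (@complex.Im R) E).
Unshelve. all: by end_near. Qed.

Lemma beurling_expansion N :
  normc (beurling mu z + (pi^-1)%:C * \sum_(n < N) n.+1%:R * moment mu n / z ^+ n.+2)
  <= 2 * (r ^- N * (N%:R / (r - 1) + ((r - 1) ^+ 2)^-1)).
Proof.
rewrite beurlingE mulNr addrC -opprB normc_oppr -mulrBr.
have -> : \sum_(n < N) n.+1%:R * moment mu n / z ^+ n.+2 =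
    \sum_(n < N) (n.+1%:R / z ^+ n.+2) * moment mu n.
  by apply: eq_bigr => n _; rewrite mulrAC.
rewrite Normc.normcM.
set B := r ^- N * _; rewrite (_ : 2 * B = 2^-1 * (4 * B)); last by field.
apply: ler_pM; rewrite ?normc_ge0 ?normc_piV_le//.
apply: (@cint_mu_expansion (fun w => ((z - w) ^+ 2)^-1) (fun n => n.+1%:R / z ^+ n.+2)).
  apply: cmeasurable_onV; apply: cmeasurable_onX.
  apply: cmeasurable_onD; first exact: cmeasurable_on_cst.
  have := cmeasurable_onM (cmeasurable_on_cst setT (-1)) (@cmeasurable_toC R).
  by apply: eq_cmeasurable_on => p _; rewrite mulN1r.
move=> p pD; rewrite (inv_sub_sqr_expansion N z0 (zw pD)).
set E := toC p ^+ N / _ * _; rewrite (_ : _ - _ = E).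
  have dw := lt_le_trans rm1 (zwB pD).
  rewrite /E Normc.normcM; apply: ler_pM; rewrite ?normc_ge0//.
    rewrite Normc.normcM Normc.normcV !normcX zr -[leRHS]mul1r ler_pM ?exprn_ge0 ?normc_ge0//.
    - by rewrite invr_ge0 exprn_ge0 ?(ltW r0).
    - by rewrite exprn_ile1 ?normc_ge0// ltW// w1.
  apply: (le_trans (ler_normcD _ _)); apply: lerD.
    rewrite Normc.normcM normc_nat Normc.normcV Normc.normcM zr ler_wpM2l//.
    rewrite lef_pV2 ?posrE ?mulr_gt0//.
    rewrite -[leLHS]mul1r ler_pM ?(ltW rm1) ?(ltW r1) ?zwB//.
  rewrite Normc.normcV normcX lef_pV2 ?posrE ?exprn_gt0//.
  by rewrite ler_pXn2r ?nnegrE ?(ltW rm1) ?(ltW dw)// zwB.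
rewrite addrAC -[RHS]add0r; congr (_ + _); apply/eqP; rewrite subr_eq0; apply/eqP.
by apply: eq_bigr => n _; rewrite mulrAC.
Qed.

End kernels.

(** * The invariant coefficient *)

Section fejer.
Context {R : realType}.
Local Notation leb := (@lebesgue_measure R).
Local Notation Rm := (measurableTypeR R).
Local Notation J := (circ (- (pi / 2)) : set Rm).

Lemma exists_cis (u : R[i]) : normc u = 1 -> exists t, u = cis t.
Proof.
case: u => a b nu.
have ab : a ^+ 2 + b ^+ 2 = 1.
  by rewrite -[LHS](sqr_normcE (a +i* b)) nu expr1n.
have a1 : -1 <= a <= 1.
  rewrite -ler_norml -(@ler_pXn2r _ 2)// ?nnegrE// expr1n real_normK ?num_real//.
  by rewrite -ab lerDl sqr_ge0.
have bE : Num.sqrt (1 - a ^+ 2) = `|b| by rewrite -ab addrC addKr sqrtr_sqr.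
have [b0|b0] := leP 0 b.
  by exists (acos a); rewrite /cis acosK// sin_acos// bE ger0_norm.
by exists (- acos a); rewrite /cis cosN sinN acosK// sin_acos// bE ltr0_norm// opprK.
Qed.

Definition csgn (z : R[i]) : R[i] := z * ((normc z)%:C)^-1.

Lemma normc_csgn z : z != 0 -> normc (csgn z) = 1.
Proof.
move=> z0; rewrite Normc.normcM Normc.normcV normc_real.
by rewrite ger0_norm ?normc_ge0// divff// normc_eq0.
Qed.

Lemma csgn_rcis (s t : R) : 0 < s -> csgn (s%:C * cis t) = cis t.
Proof.
move=> s0; rewrite /csgn normc_rcis gtr0_norm// mulrAC divff ?mul1r//.
by rewrite -normc_gt0 normc_real normr_gt0 gt_eqF.
Qed.

Lemma csgnX z n : csgn (z ^+ n) = csgn z ^+ n.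
Proof. by rewrite /csgn normcX exprMn exprVn rmorphXn. Qed.

Lemma csgn_decomp z : z != 0 -> exists2 t, csgn z = cis t & z = (normc z)%:C * cis t.
Proof.
move=> z0; have [t e] := exists_cis (normc_csgn z0).
exists t => //; rewrite -e /csgn mulrCA divff ?mulr1//.
by rewrite -normc_gt0 normc_real normr_gt0 normc_eq0.
Qed.

Variables (mu : R[i] -> R[i]) (L : nat).
Hypotheses (mm : cmeasurable mu) (muD : bounded_by_chiD mu) (L0 : (0 < L)%N).

(* Fejer mean of order [L] in the angle, applied to [mu (s e^it) e^(-2it)]. *)
Definition fejer (s t : R) : R[i] := (L%:R^-1)%:C *
  \sum_(j < L) \sum_(k < L) mode mu (k%:Z - j%:Z) s * cis ((j%:Z - k%:Z)%:~R * t).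

(* [fejer] as a function of [w = s e^it] that does not mention the angle. *)
Definition fejerC (w : R[i]) : R[i] := (L%:R^-1)%:C *
  \sum_(j < L) \sum_(k < L) mode mu (k%:Z - j%:Z) (normc w) *
    (csgn w ^+ j * conjc (csgn w) ^+ k).

Lemma cisB_nat (j k : nat) (t : R) : cis ((j%:Z - k%:Z)%:~R * t) =
  cis t ^+ j * conjc (cis t) ^+ k.
Proof.
by rewrite rmorphB/= -!pmulrn mulrBl cisD -mulrN -!cisX cisN.
Qed.

Lemma fejerC_rcis (s t : R) : 0 < s -> fejerC (s%:C * cis t) = fejer s t.
Proof.
move=> s0; congr (_ * _); apply: eq_bigr => j _; apply: eq_bigr => k _.
by rewrite cisB_nat csgn_rcis// normc_rcis gtr0_norm.
Qed.

Let pi20 : 0 < 2 * pi :> R. Proof. by rewrite mulr_gt0 ?pi_gt0. Qed.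

(** [fejer] integrates the twisted coefficient against |Q|^2 / (2 pi L), whose mass is 1 by
    Parseval, the L coefficients of [Q] being unimodular. *)
Lemma normc_fejer_le1 (s t : R) : normc (fejer s t) <= 1.
Proof.
have mJ := measurable_circ (- (pi / 2)) : measurable J.
have fJ := lebesgue_circ_lty (- (pi / 2)) : (leb J < +oo)%E.
pose Q x := \sum_(j < L) cis (j%:R * t) * cis ((- j%:Z)%:~R * x).
have L1 : 0 < L%:R :> R by rewrite ltr0n.
have QB x : normc (Q x) <= L%:R.
  apply: (le_trans (ler_normc_sum _ _ _)).
  under eq_bigr do rewrite Normc.normcM !normc_cis mulr1.
  by rewrite sumr_const card_ord.
have mQ : cmeasurable_on setT (Q : Rm -> R[i]).
  apply: cmeasurable_on_sum => j _; apply: cmeasurable_onM.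
    exact: cmeasurable_on_cst.
  exact: cmeasurable_cis.
pose g x := mu (s%:C * cis x) * cis ((- 2) * x).
have FE : fejer s t = ((2 * pi)^-1 / L%:R)%:C *
    cint leb J (fun x => g x * (normc (Q x) ^+ 2)%:C).
  have -> : cint leb J (fun x => g x * (normc (Q x) ^+ 2)%:C) =
     \sum_(j < L) \sum_(k < L) cis ((j%:Z - k%:Z)%:~R * t) *
       cint leb J (fun x => mu (s%:C * cis x) * cis ((k%:Z - j%:Z - 2)%:~R * x)).
    have E x : g x * (normc (Q x) ^+ 2)%:C = \sum_(j < L) \sum_(k < L)
        cis ((j%:Z - k%:Z)%:~R * t) *
        (mu (s%:C * cis x) * cis ((k%:Z - j%:Z - 2)%:~R * x)).
      rewrite -mulc_conj /Q conjc_sum mulr_suml mulr_sumr; apply: eq_bigr => j _.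
      rewrite mulr_sumr mulr_sumr; apply: eq_bigr => k _.
      rewrite conjcM -!cisN /g.
      rewrite (_ : (k%:Z - j%:Z - 2)%:~R * x = - (((- k%:Z)%:~R) * x) +
        (((- j%:Z)%:~R) * x + (- 2) * x)); last by rewrite !(rmorphB, rmorphN)/=; ring.
      rewrite (_ : (j%:Z - k%:Z)%:~R * t = j%:R * t + - (k%:R * t)); last first.
        by rewrite !(rmorphB, rmorphN)/= -!pmulrn; ring.
      rewrite !cisD; ring.
    apply: (etrans (@eq_cint _ _ _ leb J _ _ (fun x _ => E x))).
    rewrite cint_sum//; last first.
      move=> j _; apply: cintegrable_sum => // k _; apply: cintegrableZ => //.
      exact: cintegrable_circ_integrand.
    apply: eq_bigr => j _; rewrite cint_sum//; last first.
      move=> k _; apply: cintegrableZ => //; exact: cintegrable_circ_integrand.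
    apply: eq_bigr => k _; rewrite cintZ//; exact: cintegrable_circ_integrand.
  rewrite /fejer mulr_sumr mulr_sumr; apply: eq_bigr => j _.
  rewrite mulr_sumr mulr_sumr; apply: eq_bigr => k _.
  rewrite /mode rmorphM/=; ring.
rewrite FE Normc.normcM normc_real ger0_norm; last first.
  by rewrite divr_ge0 ?invr_ge0 ?(ltW pi20) ?(ltW L1).
have iQ : leb.-integrable J (EFin \o (fun x => normc (Q x) ^+ 2)).
  apply: (integrable_le (B := L%:R ^+ 2) mJ fJ).
    apply: measurable_funX; apply: measurable_funTS.
    exact: cmeasurable_on_normc.
  by move=> x _; rewrite ger0_norm ?sqr_ge0// ler_pXn2r ?nnegrE ?normc_ge0// ltW.
have gB x : normc (g x) <= 1.
  by rewrite Normc.normcM normc_cis mulr1 bounded_by1.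
have le2 : normc (cint leb J (fun x => g x * (normc (Q x) ^+ 2)%:C)) <=
    \int[leb]_(x in J) normc (Q x) ^+ 2.
  have gQ x : normc (g x * (normc (Q x) ^+ 2)%:C) <= normc (Q x) ^+ 2.
    rewrite Normc.normcM normc_real ger0_norm ?sqr_ge0// -[leRHS]mul1r.
    by rewrite ler_wpM2r ?sqr_ge0.
  apply: le_normc_cint => //.
  apply: (bounded_circ_cintegrable (B := L%:R ^+ 2)).
    apply: cmeasurable_onM.
      exact: cmeasurable_circ_integrand.
    apply: cmeasurable_on_real; apply: measurable_funX; apply: measurable_funTS.
    exact: cmeasurable_on_normc.
  move=> x _; apply: (le_trans (gQ x)).
  by rewrite ler_pXn2r ?nnegrE ?normc_ge0// ltW.
have E2 : \int[leb]_(x in J) normc (Q x) ^+ 2 = 2 * pi * L%:R.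
  rewrite (@parseval _ _ _ (fun j : 'I_L => - j%:Z)); last first.
    by move=> i j /oppr_inj/eqP; rewrite eqz_nat => /eqP/val_inj.
  congr (_ * _); under eq_bigr do rewrite normc_cis expr1n.
  by rewrite sumr_const card_ord.
rewrite E2 in le2; apply: (le_trans (ler_wpM2l _ le2)).
  by rewrite divr_ge0 ?invr_ge0 ?(ltW pi20) ?(ltW L1).
have mulVVK (a b : R) : a != 0 -> b != 0 -> a^-1 / b * (a * b) = 1.
  by move=> a0 b0; rewrite mulrACA !mulVf// mulr1.
by rewrite mulVVK ?lt0r_neq0.
Qed.

Lemma normc_fejerC_le1 w : w != 0 -> normc (fejerC w) <= 1.
Proof.
move=> w0; have [t _ ->] := csgn_decomp w0.
by rewrite fejerC_rcis ?normc_gt0// normc_fejer_le1.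
Qed.

Lemma cmeasurable_csgn : cmeasurable csgn.
Proof.
apply: cmeasurable_onM; first exact: cmeasurable_toC.
apply: cmeasurable_onV; apply: cmeasurable_on_real.
exact: cmeasurable_on_normc (@cmeasurable_toC R).
Qed.

Lemma cmeasurable_fejerC : cmeasurable fejerC.
Proof.
apply: cmeasurable_onM; first exact: cmeasurable_on_cst.
apply: cmeasurable_on_sum => j _; apply: cmeasurable_on_sum => k _.
apply: cmeasurable_onM; last first.
  apply: cmeasurable_onM; apply: cmeasurable_onX; first exact: cmeasurable_csgn.
  exact: cmeasurable_on_conj cmeasurable_csgn.
have mn : measurable_fun setT (fun p : Rm * Rm => normc (toC p)).
  exact: cmeasurable_on_normc (@cmeasurable_toC R).
exact: (cmeasurable_on_comp mn (cmeasurable_mode mm muD _)).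
Qed.

End fejer.

Arguments Normc.normc : simpl never.

(** * Spreading the Fejer mean over the generations *)

Section nu.
Context {R : realType}.
Local Notation leb := (@lebesgue_measure R).
Local Notation Rm := (measurableTypeR R).
Local Notation J := (circ (- (pi / 2)) : set Rm).

Variables (mu : R[i] -> R[i]) (L : nat).
Hypotheses (mm : cmeasurable mu) (muD : bounded_by_chiD mu) (L0 : (0 < L)%N).

(** The factor 2 makes all orders q M - 2 nonnegative, including M = 1 in generation 0, and keeps
    the exponents D - 2M of [ppoly] within the degree D - 2. *)
Definition qpow (k : nat) : nat := (2 * (2 * L) ^ k)%N.

(* The radii of a fundamental annulus of [z |-> z ^ (2 L)] near the unit circle. *)
Definition fund (s : R) : bool := (2^-1 <= s) && (s ^+ (2 * L)%N < 2^-1).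

Lemma two_le : (2 <= 2 * L)%N. Proof. by rewrite leq_pmulr. Qed.

Lemma qpow_gt0 k : (0 < qpow k)%N.
Proof. by rewrite muln_gt0 expn_gt0 muln_gt0 L0. Qed.

Lemma qpowS k : qpow k.+1 = (qpow k * (2 * L))%N.
Proof. by rewrite /qpow expnS mulnA mulnAC (mulnC (_ * _)%N) mulnA. Qed.

Lemma fund_gt0 s : fund s -> 0 < s.
Proof. by case/andP => s2 _; apply: lt_le_trans s2; rewrite invr_gt0. Qed.

Lemma fund_lt1 s : fund s -> s < 1.
Proof.
move=> fs; rewrite ltNge; apply/negP => s1.
case/andP: fs => _; apply/negP; rewrite -leNgt (@le_trans _ _ 1)//.
  by rewrite invf_le1// ler1n.
exact: exprn_ege1.
Qed.

(** If s = r^q satisfies s^D < 1/2, the power of r attached to any later generation is a power of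
    s^D, hence below 1/2. *)
Lemma fund_lt (r : R) (k k' : nat) : 0 <= r -> (k < k')%N ->
  fund (r ^+ qpow k) -> ~~ fund (r ^+ qpow k').
Proof.
move=> r0 kk' /andP[_ h]; rewrite negb_and -ltNge; apply/orP; left.
have -> : qpow k' = (qpow k.+1 * (2 * L) ^ (k' - k.+1))%N.
  by rewrite /qpow -mulnA -expnD subnKC.
rewrite exprM qpowS (exprM r); set s := (_ ^+ (2 * L)%N) in h *.
have s0 : 0 <= s by rewrite !exprn_ge0.
apply: (le_lt_trans _ h); rewrite -[leRHS]expr1 ler_wiXn2l//.
  by apply: (le_trans (ltW h)); rewrite invf_le1 ?ler1n.
by rewrite expn_gt0 muln_gt0 L0.
Qed.

Lemma fund_uniq (r : R) (k k' : nat) : 0 <= r ->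
  fund (r ^+ qpow k) -> fund (r ^+ qpow k') -> k = k'.
Proof.
move=> r0 h h'; case: (ltngtP k k') => // lt.
  by have := fund_lt r0 lt h; rewrite h'.
by have := fund_lt r0 lt h'; rewrite h.
Qed.

(** The least k whose next power b^(D^(k+1)) is below 1/2 works; minimality bounds b^(D^k) from
    below. *)
Lemma fund_exists (b : R) : 2^-1 <= b -> b < 1 -> exists k, fund (b ^+ ((2 * L) ^ k)%N).
Proof.
move=> b2 b1; have b0 : 0 < b by apply: lt_le_trans b2; rewrite invr_gt0.
have ex : exists k, b ^+ ((2 * L) ^ k.+1)%N < 2^-1.
  have : b ^+ n @[n --> \oo] --> 0 by apply: cvg_expr; rewrite gtr0_norm.
  move/cvgr0Pnorm_lt => /(_ 2^-1); rewrite invr_gt0 => /(_ (ltr0Sn _ _))[N _ HN].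
  exists N; rewrite -[ltLHS]ger0_norm; last by rewrite exprn_ge0// ltW.
  by apply: HN => /=; exact: ltnW (ltnW (ltn_expl N.+1 two_le)).
case: (ex_minnP ex) => k hk kmin; exists k; apply/andP; split; last first.
  by rewrite -exprM -expnSr.
case: k hk kmin => [|k] hk kmin; first by rewrite expn0 expr1.
rewrite leNgt; apply/negP => h.
by have := kmin k h; rewrite ltnn.
Qed.

(** On generation k this is the pull-back by z^q: [fejerC] being a twisted coefficient, pulling back
    is composition, and [csgn z ^+ 2] removes the twist. The generation is obtained by choice, and
    [fund_uniq] makes it unambiguous. *)
Definition nu (z : R[i]) : R[i] :=
  if pselect (exists k, fund (normc z ^+ qpow k)) is left h
  then fejerC mu L (z ^+ qpow (projT1 (cid h))) * csgn z ^+ 2 else 0.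

Lemma nuE z k : fund (normc z ^+ qpow k) -> nu z = fejerC mu L (z ^+ qpow k) * csgn z ^+ 2.
Proof.
move=> h; rewrite /nu; case: pselect => [h'|]; last by case; exists k.
by rewrite (fund_uniq (normc_ge0 z) (projT2 (cid h')) h).
Qed.

Lemma nu0 z : (forall k, ~~ fund (normc z ^+ qpow k)) -> nu z = 0.
Proof.
by move=> h; rewrite /nu; case: pselect => // -[k hk]; case/negP: (h k).
Qed.

Lemma nu_bounded : bounded_by_chiD nu.
Proof.
move=> z; have [[k hk]|h] := pselect (exists k, fund (normc z ^+ qpow k)); last first.
  rewrite nu0 ?Normc.normc0; first by rewrite /chiD; case: ifP.
  by move=> k; apply/negP => hk; apply: h; exists k.
have z0 : z != 0.
  apply/eqP => z0; have := fund_gt0 hk; rewrite z0 Normc.normc0 expr0n.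
  by rewrite (gtn_eqF (qpow_gt0 k)) ltxx.
have z1 : normc z < 1.
  rewrite ltNge; apply/negP => z1; have := fund_lt1 hk.
  by apply/negP; rewrite -leNgt exprn_ege1.
rewrite /chiD asboolT// (nuE hk) Normc.normcM normcX normc_csgn// expr1n mulr1.
by apply: normc_fejerC_le1 => //; rewrite expf_neq0.
Qed.

Lemma measurable_fund : measurable [set s : Rm | fund s].
Proof.
have -> : [set s : Rm | fund s] = `[2^-1, +oo[%classic `&` [set s | s ^+ (2 * L)%N < 2^-1].
  by apply/seteqP; split => s /=; rewrite /fund in_itv/= andbT => /andP.
apply: measurableI; first exact: measurable_itv.
rewrite -[X in measurable X]setTI.
apply: (measurable_fun_ltr (f := fun s : Rm => s ^+ (2 * L)%N) (g := fun=> 2^-1)) => //.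
Qed.

Lemma measurable_ann k : measurable [set r : Rm | fund (r ^+ qpow k)].
Proof.
rewrite -[X in measurable X]setTI.
have mX : measurable_fun setT (fun r : Rm => r ^+ qpow k) by exact: measurable_funX.
exact: (mX measurableT _ measurable_fund).
Qed.

Lemma cmeasurable_nu : cmeasurable nu.
Proof.
pose A k : set (Rm * Rm) := [set p | fund (normc (toC p) ^+ qpow k)].
have mA k : measurable (A k).
  have mn : measurable_fun setT (fun p : Rm * Rm => normc (toC p)).
    exact: cmeasurable_on_normc (@cmeasurable_toC R).
  rewrite -[X in measurable X]setTI; exact: (mn measurableT _ (measurable_ann k)).
(* A countable measurable cover by the annuli and the complement of their union, [nu] being given by
   one formula on each piece. *)
pose E k := if k is k'.+1 then A k' else ~` \bigcup_k A k.
have mE k : measurable (E k).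
  case: k => [|k] //=; apply: measurableC; exact: bigcup_measurable.
have ET : \bigcup_k E k = setT.
  apply/seteqP; split => // p _.
  have [[k _ Ak]|nA] := pselect ((\bigcup_k A k) p); first by exists k.+1.
  by exists 0%N.
have mEk k : cmeasurable_on (E k) (nu \o @toC R).
  case: k => [|k].
    apply: (eq_cmeasurable_on (f := fun=> 0)); last exact: cmeasurable_on_cst.
    move=> p /= nA; rewrite nu0// => k; apply/negP => h; apply: nA.
    by exists k.
  apply: (eq_cmeasurable_on (f := fun p : Rm * Rm =>
      fejerC mu L (toC p ^+ qpow k) * csgn (toC p) ^+ 2)).
    by move=> p /= h; rewrite -nuE.
  apply: (cmeasurable_onS measurableT) => //; apply: cmeasurable_onM; last first.
    exact: cmeasurable_onX (@cmeasurable_csgn R).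
  have [m1 m2] := cmeasurable_onX (qpow k) (@cmeasurable_toC R).
  have mq : measurable_fun setT (fun p : Rm * Rm =>
      (Re (toC p ^+ qpow k), Im (toC p ^+ qpow k)) : Rm * Rm).
    exact: measurable_fun_pair.
  have := cmeasurable_on_comp mq (cmeasurable_fejerC L mm muD).
  apply: eq_cmeasurable_on => p _ /=; congr fejerC.
  by apply: complex_eqP.
split; rewrite -ET; apply/measurable_fun_bigcup => // k.
- exact: (mEk k).1.
- exact: (mEk k).2.
Qed.

Lemma nu_admissible : admissible nu.
Proof. by split; [exact: cmeasurable_nu|exact: nu_bounded]. Qed.

(** The neighbourhood |z|^(2D) > 1/2 leaves out generation 0: a point of generation k + 1 is sent by
    z^D to generation k, with the same value of [fejerC]. Equality holds at every point, not only
    almost everywhere. *)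
Lemma nu_eventually_invariant : eventually_invariant (2 * L) nu.
Proof.
exists [set p : R * R | 2^-1 < normc (toC p) ^+ (2 * (2 * L))%N]; split; [|split].
- have cn : continuous (fun p : R * R => normc (toC p) ^+ (2 * (2 * L))%N).
    move=> p; apply: (@continuous_comp _ _ _ (fun p : R * R => normc (toC p))
      (fun x => x ^+ (2 * (2 * L))%N)); last exact: exprn_continuous.
    apply: (@continuous_comp _ _ _ (fun p : R * R => p.1 ^+ 2 + p.2 ^+ 2) Num.sqrt);
      last exact: sqrt_continuous.
    apply: cvgD.
      by apply: (@continuous_comp _ _ _ (@fst R R) (fun x => x ^+ 2));
        [exact: cvg_fst|exact: exprn_continuous].
    by apply: (@continuous_comp _ _ _ (@snd R R) (fun x => x ^+ 2));
      [exact: cvg_snd|exact: exprn_continuous].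
  by apply: (@open_comp _ _ (fun p : R * R => normc (toC p) ^+ (2 * (2 * L))%N)
      [set x | 2^-1 < x]) => [p _|]; [exact: cn|exact: open_gt].
- by move=> p /= ->; rewrite expr1n invf_lt1// ltr1n.
apply: aeW => -[x y] /=; set z := toC (x, y) => zU zD.
have a0 := normc_ge0 z.
have z0 : z != 0.
  rewrite -normc_gt0 lt_neqAle a0 andbT eq_sym; apply/eqP => az.
  have e0 : (0 < 2 * (2 * L))%N by rewrite !muln_gt0.
  by move: zU; rewrite az expr0n (gtn_eqF e0) ltNge invr_ge0 ler0n.
have [k hk] := @fund_exists (normc z ^+ (2 * (2 * L))) (ltW zU)
  ltac:(by rewrite exprn_ilt1// -lt0n muln_gt0/= muln_gt0).
have hk1 : fund (normc z ^+ qpow k.+1).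
  rewrite (_ : qpow k.+1 = (2 * (2 * L)) * (2 * L) ^ k)%N.
    by rewrite exprM.
  by rewrite /qpow expnS; exact: mulnA.
have hk2 : fund (normc (z ^+ (2 * L)) ^+ qpow k).
  by rewrite normcX -exprM mulnC -qpowS.
rewrite /pullback_pow (nuE hk1) (nuE hk2) -exprM (mulnC _ (qpow k)) -qpowS.
(* What remains, with u = [csgn z], is u^(2D) conj(u)^(D-1) / u^(D-1) = u^2; the moduli cancel. *)
move: (fejerC mu L _) => Fz; rewrite csgnX -[LHS]mulrA -[LHS]mulrA; congr (Fz * _).
set D := (2 * L)%N; have D0 : (0 < D)%N by rewrite muln_gt0.
have Dn : (D%:R : R[i]) != 0 by rewrite pnatr_eq0 -lt0n.
have zE : z = (normc z)%:C * csgn z.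
  by have [t e {1}->] := csgn_decomp z0; rewrite e.
have u1 : csgn z * conjc (csgn z) = 1.
  by rewrite mulc_conj normc_csgn// expr1n.
have u0 : csgn z != 0 by rewrite -normc_gt0 normc_csgn.
have c0 : D%:R * (normc z)%:C ^+ D.-1 != 0 :> R[i].
  by rewrite mulf_neq0// expf_neq0// -normc_gt0 normc_real normr_gt0 normc_eq0.
have uV : conjc (csgn z) = (csgn z)^-1.
  by apply: (mulfI u0); rewrite u1 divff.
have XE : D%:R * z ^+ D.-1 = D%:R * (normc z)%:C ^+ D.-1 * csgn z ^+ D.-1.
  by rewrite {1}zE exprMn mulrA.
have conjE : Num.conj (D%:R * z ^+ D.-1) = D%:R * (normc z)%:C ^+ D.-1 * (csgn z)^-1 ^+ D.-1.
  rewrite XE -[LHS]/(conjc _) !conjcM; congr (_ * _); last first.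
    by rewrite -uV (rmorphXn (@conjc R)).
  congr (_ * _); first exact: conjc_nat.
  by rewrite -rmorphXn; exact: conjc_real.
rewrite conjE XE exprVn; case: D D0 c0 {Dn XE conjE hk hk1 hk2} => // e _ c0.
rewrite (exprS (csgn z) e) [e.+1.-1]/=; set v := csgn z ^+ e; have v0 : v != 0 by rewrite expf_neq0.
move: c0 u0 v0; rewrite [e.+1.-1]/=; move: (e.+1%:R * _) (csgn z) v => c u v c0 u0 v0.
by field; rewrite ?c0 ?u0 ?v0.
Qed.

End nu.

(** * Moments of [nu] *)

Section nu_moments.
Context {R : realType}.
Local Notation leb := (@lebesgue_measure R).
Local Notation Rm := (measurableTypeR R).
Local Notation J := (circ (- (pi / 2)) : set Rm).
Local Notation I01 := (`]0%R, 1%R[%classic : set Rm).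

Lemma Rintegral_pow_ge0 (h : Rm -> R) (q : nat) : (0 < q)%N ->
  measurable_fun setT h -> (forall s, 0 <= h s) ->
  \int[leb]_(s in `]0%R, 1%R]) h s =
  \int[leb]_(s in `]0%R, 1%R]) (h (s ^+ q) * (q%:R * s ^+ q.-1)).
Proof.
move=> q0 mh h0; rewrite /Rintegral; congr fine.
have cX n : continuous (fun x : R => x ^+ n) by move=> x; exact: exprn_continuous.
have cf : continuous (fun x : R => q%:R * x ^+ q.-1).
  by move=> x; apply: cvgM; [exact: cvg_cst|exact: cX].
have dF (x : R) : x \in `]0%R, 1%R[ -> is_derive x 1 (fun x : R => x ^+ q) (q%:R * x ^+ q.-1).
  move=> _; have -> : (fun x : R => x ^+ q) = (@id R) ^+ q.
    by apply/funext => y; rewrite fctE.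
  by apply: (is_derive_eq (is_deriveX q (is_derive_id x 1))); rewrite /GRing.scale/= mulr1.
have mhE : measurable_fun setT (fun s : Rm => (h s)%:E) by exact/measurable_EFinP.
have := @ge0_integral_substitution_oc R _ _ 0 1 (EFin \o h) ltr01 (cX q) cf dF.
rewrite expr0n (gtn_eqF q0) expr1n => ->//=.
- by move=> x; rewrite in_itv/= => /andP[x0 _]; rewrite mulr_ge0 ?exprn_ge0.
- move=> x y; rewrite !in_itv/= => /andP[x0 _] /andP[y0 _] xy.
  by rewrite ltr_pXn2r.
Qed.

(** Substitution applies to nonnegative functions on []0, 1]]; a bounded [g] is reduced to them by
    adding [B]. *)
Lemma Rintegral_pow (g : Rm -> R) (q : nat) (B : R) : (0 < q)%N ->
  measurable_fun setT g -> (forall s, `|g s| <= B) ->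
  \int[leb]_(s in I01) (s ^+ q.-1 * g (s ^+ q)) = q%:R^-1 * \int[leb]_(s in I01) g s.
Proof.
move=> q0 mg gB.
have B0 : 0 <= B by apply: le_trans (gB 0).
have mX n : measurable_fun setT (fun s : Rm => s ^+ n) by exact: measurable_funX.
have mI : measurable (`]0%R, 1%R]%classic : set Rm) by exact: measurable_itv.
have fI : (leb `]0%R, 1%R]%classic < +oo)%E.
  by rewrite lebesgue_measure_itv/= lte_fin ltr01 -EFinD ltry.
have iG (h : Rm -> R) (C : R) : measurable_fun setT h -> (forall s, `|h s| <= C) ->
    leb.-integrable `]0%R, 1%R]%classic (EFin \o (fun s => s ^+ q.-1 * h (s ^+ q))).
  move=> mh hC; apply: (integrable_le (B := C) mI fI).
    apply: measurable_funTS; apply: measurable_funM; first exact: mX.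
    exact: (measurableT_comp mh (mX q)).
  move=> x; rewrite /= in_itv/= => /andP[x0 x1].
  rewrite normrM -[leRHS]mul1r ler_pM ?normr_ge0// ger0_norm ?exprn_ge0 ?(ltW x0)//.
  by rewrite exprn_ile1// ltW.
have ih (h : Rm -> R) (C : R) : measurable_fun setT h -> (forall s, `|h s| <= C) ->
    leb.-integrable `]0%R, 1%R]%classic (EFin \o h).
  by move=> mh hC; apply: (integrable_le (B := C) mI fI) => //; exact: measurable_funTS.
have mB : measurable_fun setT (fun _ : Rm => B) by exact: measurable_cst.
have BB (s : Rm) : `|B| <= B by rewrite ger0_norm.
have q1 : q%:R != 0 :> R by rewrite pnatr_eq0 -lt0n.
have key (h : Rm -> R) (C : R) : measurable_fun setT h -> (forall s, `|h s| <= C) -> (forall s, 0 <= h s) ->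
    \int[leb]_(s in `]0%R, 1%R]) (s ^+ q.-1 * h (s ^+ q)) =
    q%:R^-1 * \int[leb]_(s in `]0%R, 1%R]) h s.
  move=> mh hC h0; rewrite (Rintegral_pow_ge0 q0 mh h0).
  rewrite -RintegralZl//; last first.
    have := integrableZl mI q%:R (iG _ _ mh hC).
    by apply: eq_integrable => // x _ /=; rewrite -EFinM; congr (_%:E); ring.
  by apply: eq_Rintegral => s _; rewrite mulrCA mulKf// mulrC.
have E : \int[leb]_(s in `]0%R, 1%R]) (s ^+ q.-1 * g (s ^+ q)) =
    q%:R^-1 * \int[leb]_(s in `]0%R, 1%R]) g s.
  have mgB : measurable_fun setT (fun s => g s + B) by exact: measurable_funD.
  have gBB s : `|g s + B| <= B + B.
    by apply: (le_trans (ler_normD _ _)); apply: lerD; [exact: gB|exact: (BB 0)].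
  have gB0 s : 0 <= g s + B.
    by rewrite -lerBlDr sub0r; have := gB s; rewrite ler_norml => /andP[].
  have := key _ _ mgB gBB gB0.
  rewrite RintegralD ?(ih _ _ mg gB) ?(ih _ _ mB BB)// mulrDr.
  rewrite -(key _ _ mB BB (fun=> B0)).
  have -> : \int[leb]_(s in `]0%R, 1%R]) (s ^+ q.-1 * (g (s ^+ q) + B)) =
      \int[leb]_(s in `]0%R, 1%R]) (s ^+ q.-1 * g (s ^+ q)) +
      \int[leb]_(s in `]0%R, 1%R]) (s ^+ q.-1 * B).
    rewrite -RintegralD ?(iG _ _ mg gB) ?(iG _ _ mB BB)//.
    by apply: eq_Rintegral => s _; rewrite mulrDr.
  exact: addIr.
rewrite Rintegral_itv_bndo_bndc; last first.
  by apply: integrableS (iG _ _ mg gB) => //; apply: subset_itvl; rewrite bnd_simp.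
rewrite Rintegral_itv_bndo_bndc//.
by apply: integrableS (ih _ _ mg gB) => //; apply: subset_itvl; rewrite bnd_simp.
Qed.

Lemma cint_pow (G : Rm -> R[i]) (q : nat) (B : R) : (0 < q)%N ->
  cmeasurable_on setT G -> (forall s, normc (G s) <= B) ->
  cint leb I01 (fun s => (s ^+ q.-1)%:C * G (s ^+ q)) = (q%:R^-1)%:C * cint leb I01 G.
Proof.
move=> q0 [m1 m2] GB; apply: complex_eqP; rewrite ?ReM ?ImM /= mul0r ?subr0 ?addr0.
- rewrite -(Rintegral_pow q0 m1 (B := B)).
    by apply: eq_Rintegral => s _; rewrite ReM /= mul0r subr0.
  by move=> s; exact: le_trans (ler_Re_normc _) (GB s).
- rewrite -(Rintegral_pow q0 m2 (B := B)).
    by apply: eq_Rintegral => s _; rewrite ImM /= mul0r addr0.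
  by move=> s; exact: le_trans (ler_Im_normc _) (GB s).
Qed.

Variables (mu : R[i] -> R[i]) (L : nat).
Hypotheses (mm : cmeasurable mu) (muD : bounded_by_chiD mu) (L0 : (0 < L)%N).
Local Notation nu := (nu mu L).
Local Notation qpow := (qpow L).
Local Notation fund := (fund L).

Lemma nu_rcis (r t : R) k : 0 < r -> fund (r ^+ qpow k) ->
  nu (r%:C * cis t) = fejer mu L (r ^+ qpow k) ((qpow k)%:R * t) * cis (2 * t).
Proof.
move=> r0 h; rewrite (@nuE R mu L L0 _ k); last by rewrite normc_rcis gtr0_norm.
rewrite csgn_rcis// cisX; congr (_ * _).
by rewrite exprMn cisX -rmorphXn/= fejerC_rcis ?exprn_gt0.
Qed.

(** Exactly L - M pairs of indices below L differ by M: this is the Fejer weight before division by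
    L, truncated subtraction accounting for M >= L. *)
Lemma sum_shift_diag (M : nat) (c : R[i]) :
  \sum_(j < L) \sum_(k < L) (if (k : nat) == (j + M)%N then c else 0) = (L - M)%:R * c.
Proof.
transitivity (\sum_(j < L | (j < L - M)%N) c).
  rewrite [RHS]big_mkcond; apply: eq_bigr => j _.
  rewrite -big_mkcond/=; rewrite ltn_subRL addnC; case: ifPn => jM.
    by rewrite (big_pred1 (Ordinal jM)) => // k; rewrite -val_eqE.
  rewrite big1// => k /eqP kE; move: jM; rewrite -kE ltn_ord.
  by [].
rewrite -(big_ord_widen _ (fun=> c) (leq_subr M L)) sumr_const card_ord.
by rewrite mulr_natl.
Qed.

(** On generation k, apart from the factor e^(2it), [nu] depends on t through q t, so only multiples
    of q are frequencies. The frequency M = N / q picks a mode of [mu] with its Fejer weight, which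
    vanishes for M >= L. *)
Lemma mode_nu (r : R) (k N : nat) : 0 < r -> fund (r ^+ qpow k) ->
  mode nu N r = if (qpow k %| N)%N then
    ((L - N %/ qpow k)%:R / L%:R)%:C * mode mu (N %/ qpow k)%N (r ^+ qpow k) else 0.
Proof.
move=> r0 h; set q := qpow k; set s := r ^+ q.
have q0 : (0 < q)%N by exact: qpow_gt0.
have mJ := measurable_circ (- (pi / 2)) : measurable J.
have pi20 : 0 < 2 * pi :> R by rewrite mulr_gt0 ?pi_gt0.
have Lr : (L%:R : R) != 0 by rewrite pnatr_eq0 -lt0n.
(* The total frequency of the term (j, l); it vanishes exactly when N = (l - j) q. *)
pose ex (j l : nat) : int := (j%:Z - l%:Z) * q%:Z + N%:Z.
have E t : nu (r%:C * cis t) * cis ((N%:Z - 2)%:~R * t) =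
    \sum_(j < L) \sum_(l < L) ((L%:R^-1)%:C * mode mu (l%:Z - j%:Z) s) *
      cis ((ex j l)%:~R * t).
  rewrite (nu_rcis _ r0 h) /fejer -/q -/s mulr_sumr !mulr_suml; apply: eq_bigr => j _.
  rewrite mulr_sumr !mulr_suml; apply: eq_bigr => l _.
  rewrite (_ : (ex j l)%:~R * t = (j%:Z - l%:Z)%:~R * (q%:R * t) + (2 * t + (N%:Z - 2)%:~R * t)).
    by rewrite !cisD; ring.
  by rewrite /ex !(rmorphD, rmorphB, rmorphM, rmorphN)/= -!pmulrn; ring.
have ic j l : cintegrable leb J (fun t => (L%:R^-1)%:C * mode mu (l%:Z - j%:Z) s *
      cis ((ex j l)%:~R * t)) by exact: cintegrable_cis.
rewrite {1}/mode (@eq_cint _ _ _ leb J _ _ (fun t _ => E t)) cint_sum//; last first.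
  by move=> j _; apply: cintegrable_sum.
have icis n : cintegrable leb J (fun t : Rm => cis (n%:~R * t)).
  have := @cintegrable_cis R (- (pi / 2)) (n%:~R) 1.
  by under eq_fun do rewrite mul1r.
have -> : ((2 * pi)^-1)%:C * (\sum_(j < L) cint leb J (fun t => \sum_(l < L)
      (L%:R^-1)%:C * mode mu (l%:Z - j%:Z) s * cis ((ex j l)%:~R * t))) =
    \sum_(j < L) \sum_(l < L)
      (if ex j l == 0 then (L%:R^-1)%:C * mode mu (l%:Z - j%:Z) s else 0).
  rewrite mulr_sumr; apply: eq_bigr => j _; rewrite cint_sum// mulr_sumr.
  apply: eq_bigr => l _; rewrite cintZ// cint_cis; case: ifP => _; last by rewrite !mulr0.
  by rewrite mulrCA -rmorphM/= mulVf ?mulr1 ?gt_eqF.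
case: ifPn => [/dvdnP[M NE]|qN]; last first.
  rewrite big1// => j _; rewrite big1// => l _; case: eqP => // e.
  case/negP: qN; have : (q%:Z %| N%:Z)%Z.
    by apply/dvdzP; exists (l%:Z - j%:Z); apply/eqP; rewrite -subr_eq0 -e /ex; apply/eqP; ring.
  by [].
rewrite NE mulnK//.
transitivity (\sum_(j < L) \sum_(l < L)
    (if (l : nat) == (j + M)%N then (L%:R^-1)%:C * mode mu M s else 0)).
  apply: eq_bigr => j _; apply: eq_bigr => l _.
  have -> : (ex j l == 0) = ((l : nat) == (j + M)%N).
    rewrite /ex NE PoszM -mulrDl mulf_eq0 [_ == 0 in X in _ || X](_ : _ = false) ?orbF; last first.
      by rewrite eqz_nat gtn_eqF.
    rewrite (_ : j%:Z - l%:Z + M%:Z = (j%:Z + M%:Z) - l%:Z); last by ring.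
    by rewrite subr_eq0 -PoszD eqz_nat eq_sym.
  case: eqP => // ->; rewrite (_ : (j + M)%N%:Z - j%:Z = M%:Z)//.
  by rewrite PoszD addrC addrA addNr add0r.
rewrite sum_shift_diag rmorphM/= rmorph_nat; ring.
Qed.

Lemma mode_nu_out (r : R) (N : int) : 0 < r -> (forall k, ~~ fund (r ^+ qpow k)) ->
  mode nu N r = 0.
Proof.
move=> r0 h; rewrite /mode (_ : cint _ _ _ = 0) ?mulr0//.
rewrite -[RHS](cint0 leb J); apply: eq_cint => t _.
by rewrite nu0 ?mul0r// => k; rewrite normc_rcis gtr0_norm.
Qed.

(** The ratio D = 2L of consecutive generations exceeds every M < L, so their frequencies never
    coincide. *)
Lemma qpow_mul_inj (k k' M M' : nat) : (0 < M < L)%N -> (0 < M' < L)%N ->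
  (qpow k * M = qpow k' * M')%N -> k = k'.
Proof.
wlog lt : k k' M M' / (k < k')%N => [H hM hM' e|].
  case: (ltngtP k k') => // lt; first exact: (H k k' M M').
  by apply/esym/(H k' k M' M).
move=> /andP[_ ML] /andP[M'0 _] e; exfalso.
have qE : qpow k' = (qpow k * (2 * L) ^ (k' - k))%N.
  by rewrite /qpow -mulnA -expnD subnKC// ltnW.
move/eqP: e; rewrite qE -mulnA eqn_pmul2l ?qpow_gt0// => /eqP e.
move: ML; rewrite e ltnNge => /negP; apply.
apply: (@leq_trans (2 * L)); first by rewrite leq_pmull.
rewrite -[leqLHS]muln1 leq_mul//.
by rewrite -{1}[(2 * L)%N]expn1 leq_pexp2l ?muln_gt0 ?L0// subn_gt0.
Qed.

Definition fundset : set Rm := [set s | fund s].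

(** The part of a moment of [nu] that all generations share. *)
Definition qmoment (M : nat) : R[i] := ((2 * pi) * ((L - M)%:R / L%:R))%:C *
  cint leb fundset (fun s => (s ^+ M.-1)%:C * mode mu M s).

(** The frequency n + 2 = q M lives in generation k only. There r^(n+1) = r^(q-1) (r^q)^(M-1), so s
    = r^q maps the annulus onto [fundset] and yields the factor 1 / q. *)
Lemma moment_nu (n k M : nat) : (0 < M < L)%N -> n.+2 = (qpow k * M)%N ->
  moment nu n = ((qpow k)%:R^-1)%:C * qmoment M.
Proof.
move=> /andP[M0 ML] nE; set q := qpow k.
have q0 : (0 < q)%N by exact: qpow_gt0.
have nuA := nu_admissible mm muD L0.
rewrite (momentE nuA.1 nuA.2).
pose phi : R := (L - M)%:R / L%:R.
(* The extension by 0 off [fundset] lets the substitution take place on all of []0, 1[]. *)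
pose G s : R[i] := if fund s then phi%:C * ((s ^+ M.-1)%:C * mode mu M s) else 0.
have mfund : measurable fundset by exact: measurable_fund.
have mG0 : cmeasurable_on setT (fun s : Rm => phi%:C * ((s ^+ M.-1)%:C * mode mu M s)).
  apply: cmeasurable_onM; first exact: cmeasurable_on_cst.
  apply: cmeasurable_onM; last exact: cmeasurable_mode.
  by apply: cmeasurable_on_real; exact: measurable_funX.
have mG : cmeasurable_on setT (G : Rm -> R[i]).
  have := cmeasurable_onM (cmeasurable_on_real (measurable_indic mfund (D := setT))) mG0.
  apply: eq_cmeasurable_on => s _; rewrite /G indicE.
  have -> : (s \in fundset) = fund s by apply/idP/idP => [/set_mem|/mem_set].
  by case: ifP => _; [exact: mul1r|exact: mul0r].
have Lr : 0 < L%:R :> R by rewrite ltr0n.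
have phi01 : 0 <= phi <= 1.
  by rewrite divr_ge0 ?ler0n//= ler_pdivrMr// mul1r ler_nat leq_subr.
have GB s : normc (G s) <= 1.
  rewrite /G; case: ifPn => h; last by rewrite Normc.normc0.
  have s0 := ltW (fund_gt0 h); have s1 := ltW (fund_lt1 h).
  case/andP: phi01 => p0 p1.
  rewrite Normc.normcM (Normc.normcM (s ^+ M.-1)%:C) !normc_real ger0_norm// [`|s ^+ _|]ger0_norm ?exprn_ge0//.
  have m1 := normc_mode_le1 mm muD M s.
  apply: mulr_ile1; rewrite ?mulr_ge0 ?exprn_ge0 ?normc_ge0//.
  by apply: mulr_ile1; rewrite ?exprn_ge0 ?normc_ge0 ?exprn_ile1.
have -> : cint leb I01 (fun r => (r ^+ n.+1)%:C * mode nu n.+2 r) =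
    cint leb I01 (fun r => (r ^+ q.-1)%:C * G (r ^+ q)).
  apply: eq_cint => r; rewrite /= in_itv/= => /andP[r0 r1].
  rewrite /G; case: ifPn => h.
    rewrite (mode_nu _ r0 h) nE dvdn_mulr// mulKn//.
    rewrite (_ : n.+1 = (q.-1 + q * M.-1)%N); last first.
      apply: succn_inj; rewrite nE -addSn prednK//.
      by rewrite -mulnS prednK.
    by rewrite exprD exprM rmorphM/= /phi; ring.
  (* Radii outside generation k contribute nothing: a nonzero mode there would make n + 2 a
     frequency of another generation. *)
  rewrite mulr0; have [[k' h']|nh] := pselect (exists k', fund (r ^+ qpow k')); last first.
    rewrite mode_nu_out ?mulr0// => k'; apply/negP => h'; apply: nh.
    by exists k'.
  rewrite (mode_nu _ r0 h'); case: ifPn => [/dvdnP[M' NE]|_]; last by rewrite mulr0.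
  rewrite NE mulnK ?qpow_gt0//.
  have [LM|ML'] := leqP L M'.
    by move: LM; rewrite -subn_eq0 => /eqP ->; rewrite mul0r mul0r mulr0.
  have kk : k = k'.
    apply: (@qpow_mul_inj k k' M M'); first by rewrite M0.
      by rewrite ML' andbT lt0n; apply/eqP => M'0; move: NE; rewrite M'0.
    by rewrite -nE NE mulnC.
  by move: h; rewrite /q kk h'.
rewrite (cint_pow q0 mG GB) mulrCA; congr (_ * _).
have phiE : ((2 * pi) * phi)%:C = (2 * pi)%:C * phi%:C by exact: rmorphM.
rewrite /qmoment phiE -mulrA; congr (_ * _).
rewrite -cintZ//; last first.
  have fI : (leb fundset < +oo)%E.
    apply: (le_lt_trans _ (@unit_itv_lty R)); apply: le_measure; rewrite ?inE//.
    by move=> s h; rewrite /= in_itv/= (fund_gt0 h) (fund_lt1 h).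
  apply: (bounded_cintegrable (B := 1) mfund fI).
    apply: (cmeasurable_onS measurableT) => //; apply: cmeasurable_onM; last exact: cmeasurable_mode.
    by apply: cmeasurable_on_real; exact: measurable_funX.
  move=> s h; rewrite Normc.normcM normc_real ger0_norm ?exprn_ge0 ?(ltW (fund_gt0 h))//.
  have s0 := ltW (fund_gt0 h); have s1 := ltW (fund_lt1 h).
  have m1 := normc_mode_le1 mm muD M s.
  by apply: mulr_ile1; rewrite ?exprn_ge0 ?normc_ge0 ?exprn_ile1.
rewrite cint_mkcond [RHS]cint_mkcond; apply: eq_cint => s _.
rewrite /G /fundset !mem_setE /= in_itv/=; case: ifPn => [_|].
  by [].
case: ifPn => // h; rewrite (fund_gt0 h) (fund_lt1 h).
by [].
Qed.

Lemma moment_nu0 (n : nat) : (forall k M, (0 < M < L)%N -> n.+2 <> (qpow k * M)%N) ->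
  moment nu n = 0.
Proof.
move=> nE; have nuA := nu_admissible mm muD L0.
rewrite (momentE nuA.1 nuA.2) (_ : cint _ _ _ = 0) ?mulr0//.
rewrite -[RHS](cint0 leb I01); apply: eq_cint => r; rewrite /= in_itv/= => /andP[r0 r1].
have [[k' h']|nh] := pselect (exists k', fund (r ^+ qpow k')); last first.
  rewrite mode_nu_out ?mulr0// => k'; apply/negP => h'; apply: nh.
  by exists k'.
rewrite (mode_nu _ r0 h'); case: ifPn => [/dvdnP[M' NE]|_]; last by rewrite mulr0.
rewrite NE mulnK ?qpow_gt0//.
have [LM|ML'] := leqP L M'.
  by move: LM; rewrite -subn_eq0 => /eqP ->; rewrite mul0r mul0r mulr0.
exfalso; apply: (nE k' M'); last by rewrite NE mulnC.
by rewrite ML' andbT lt0n; apply/eqP => M0; move: NE; rewrite M0.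
Qed.

End nu_moments.

(** * The Cauchy transform of [nu] as a lacunary series *)

Section nu_pp.
Context {R : realType}.

(** The orders q M with M < L stay below the next q, so cutting at the K-th q closes exactly K
    generations. The regrouping serves for the Cauchy transform and for square norms; the sum starts
    at 2, the first q. *)
Lemma sum_qpow_blocks (V : nmodType) (L : nat) (g : nat -> V) (K : nat) : (0 < L)%N ->
  (forall N, (2 <= N)%N ->
    (forall k M, (0 < M < L)%N -> N <> (qpow L k * M)%N) -> g N = 0) ->
  \sum_(2 <= N < qpow L K) g N =
  \sum_(k < K) \sum_(m < L.-1) g (qpow L k * m.+1)%N.
Proof.
move=> L0 g0.
have qle a b : (a <= b)%N -> (qpow L a <= qpow L b)%N.
  by move=> ab; rewrite /qpow leq_pmul2l// leq_pexp2l// muln_gt0.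
elim: K => [|K IH]; first by rewrite /qpow expn0 muln1 big_geq// big_ord0.
have q2 k : (2 <= qpow L k)%N by rewrite /qpow leq_pmulr// expn_gt0 muln_gt0 L0.
have qLL k : (qpow L k * L <= qpow L k.+1)%N.
  by rewrite qpowS leq_mul2l leq_pmull// orbT.
rewrite (@big_cat_nat _ _ _ (qpow L K))//=; last exact: qle.
rewrite IH big_ord_recr/=; congr (_ + _).
(* Each N of this range equals q (m + 1) for at most one m, so [g N] can be spread over m and the
   sums exchanged. *)
transitivity (\sum_(qpow L K <= N < qpow L K.+1)
    \sum_(m < L.-1) (if N == (qpow L K * m.+1)%N then g N else 0)).
  apply: eq_big_nat => N /andP[N1 N2].
  have [[m NE]|nm] := pselect (exists m : 'I_L.-1, N = (qpow L K * m.+1)%N).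
    rewrite (bigD1 m)//= -NE eqxx big1 ?addr0// => m' mm'.
    case: eqP => // e; case/eqP: mm'; apply: val_inj.
    by move/eqP: e; rewrite NE eqn_pmul2l ?(leq_trans _ (q2 K))// eqSS => /eqP.
  rewrite big1; last by move=> m _; case: eqP => // e; case: nm; exists m.
  apply: g0 => [|k M /andP[M0 ML] NE]; first exact: leq_trans (q2 K) N1.
  have ML1 : (M.-1 < L.-1)%N by rewrite ltn_predRL prednK.
  have [kK|Kk|kK] := ltngtP k K.
  - have : (N < qpow L k.+1)%N.
      by rewrite NE (leq_trans _ (qLL k))// ltn_pmul2l// (leq_trans _ (q2 k)).
    by move/leq_trans => /(_ _ (qle _ _ kK)); rewrite ltnNge N1.
  - have : (qpow L K.+1 <= N)%N by rewrite NE (leq_trans (qle _ _ Kk))// leq_pmulr.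
    by rewrite leqNgt N2.
  - by apply: nm; exists (Ordinal ML1); rewrite /= prednK// NE kK.
rewrite exchange_big; apply: eq_bigr => m _ /=.
have mL : (m.+1 < L)%N by rewrite -ltn_predRL.
rewrite (bigD1_seq (qpow L K * m.+1)%N)/= ?iota_uniq//; last first.
  rewrite mem_index_iota leq_pmulr//= (leq_trans _ (qLL K))// ltn_pmul2l//.
  exact: (leq_trans _ (q2 K)).
by rewrite eqxx big1 ?addr0// => N /negbTE ->.
Qed.

Variables (mu : R[i] -> R[i]) (L : nat).
Hypotheses (mm : cmeasurable mu) (muD : bounded_by_chiD mu) (L0 : (0 < L)%N).
Local Notation nu := (nu mu L).
Local Notation qpow := (qpow L).
Local Notation D := (2 * L)%N.

(** The coefficients come from matching z / D times the k-th term with (1 / pi) moment / z^(n+1),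
    where n + 2 = 2 D^k M: the exponent D - 2M makes the powers of z agree, and 1 / (2 D^k) is the
    factor of the generation. *)
Definition ppoly : {poly R[i]} :=
  \sum_(m < L.-1) ((D%:R / (2 * pi))%:C * qmoment mu L m.+1) *: 'X^(D - 2 * m.+1).

Lemma size_ppoly : (size ppoly <= D.-1)%N.
Proof.
apply: (leq_trans (size_sum _ _ _)); apply/bigmax_leqP => m _.
apply: (leq_trans (size_scale_leq _ _)); rewrite size_polyXn.
have mL : (m.+1 < L)%N by rewrite -ltn_predRL.
by move: (nat_of_ord m) mL => m' mL; lia.
Qed.

Lemma moment_nu_block k m : (m < L.-1)%N ->
  moment nu (qpow k * m.+1 - 2) = ((qpow k)%:R^-1)%:C * qmoment mu L m.+1.
Proof.
move=> mL; apply: moment_nu => //; first by rewrite /= -ltn_predRL.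
rewrite -addn2 subnK// /qpow -mulnA leq_pmulr// muln_gt0 expn_gt0 muln_gt0 L0.
by [].
Qed.

(** The identity is exact for each K, so convergence of the series follows from the error bound of
    the expansion at infinity. *)
Lemma partial_sum_ppE (z : R[i]) K : z != 0 ->
  z / D%:R * \sum_(k < K) pp_term D ppoly z k =
  (pi^-1)%:C * \sum_(n < qpow K - 2) moment nu n / z ^+ n.+1.
Proof.
move=> z0.
have -> : \sum_(n < qpow K - 2) moment nu n / z ^+ n.+1 =
    \sum_(2 <= N < qpow K) (moment nu (N - 2) / z ^+ N.-1).
  rewrite (big_addn 0 (qpow K) 2) big_mkord; apply: eq_bigr => n _.
  by rewrite addnK addn2.
rewrite sum_qpow_blocks//; last first.
  move=> N N2 hN.
  by rewrite moment_nu0 ?mul0r// => k M /hN; rewrite -addn2 subnK.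
rewrite !mulr_sumr; apply: eq_bigr => k _.
rewrite /pp_term /ppoly horner_sum mulr_suml !mulr_sumr; apply: eq_bigr => m _.
rewrite hornerZ hornerXn moment_nu_block//.
have mL : (m.+1 < L)%N by rewrite -ltn_predRL.
have N0 : (0 < qpow k * m.+1)%N by rewrite muln_gt0 qpow_gt0.
set N := (qpow k * m.+1)%N in N0 *.
have ZE : z ^+ (D ^ k.+1)%N = z ^+ (D ^ k)%N ^+ (D - 2 * m.+1) * (z * z ^+ N.-1).
  rewrite -exprS prednK// -exprM -exprD; congr (z ^+ _).
  rewrite expnSr /N /qpow (mulnC 2%N (D ^ k)%N) -mulnA -mulnDr subnK//.
  by rewrite leq_mul2l (ltnW mL).
rewrite {}ZE; set w := _ ^+ (D - _); set a := z ^+ N.-1.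
have w0 : w != 0 by rewrite /w !expf_neq0.
have a0 : a != 0 by rewrite /a expf_neq0.
have Dn n : (0 < n)%N -> (n%:R : R[i]) != 0 by rewrite pnatr_eq0 -lt0n.
have p0 : (pi%:C : R[i]) != 0 by rewrite -normc_gt0 normc_real normr_gt0 lt0r_neq0 ?pi_gt0.
have E1 : (D%:R / (2 * pi))%:C = D%:R / (2 * pi%:C) :> R[i].
  by rewrite fmorph_div rmorphM !rmorph_nat.
have E2 : ((qpow k)%:R^-1)%:C = (2 * (D ^ k)%N%:R)^-1 :> R[i].
  by rewrite fmorphV rmorph_nat natrM.
have E3 : (pi^-1)%:C = (pi%:C)^-1 :> R[i] by rewrite fmorphV.
rewrite {}E1 {}E2 {}E3.
have Dk0 : (0 < D ^ k)%N by rewrite expn_gt0 muln_gt0 L0.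
have D0 : (0 < D)%N by rewrite muln_gt0 L0.
move: (Dn _ Dk0) (Dn _ D0); move: (qmoment mu L m.+1) (pi%:C) p0 ((D ^ k)%N%:R) (D%:R : R[i]).
move=> x p p0 e d e0 d0.
by field; rewrite ?z0 ?w0 ?a0 ?p0 ?e0 ?d0.
Qed.

Lemma nu_pp : M_pp nu.
Proof.
exists D; split; first by rewrite leq_pmulr.
split; first exact: nu_eventually_invariant.
exists ppoly; split; first exact: size_ppoly.
move=> z z1; have nuA := nu_admissible mm muD L0.
have z0 : z != 0 by rewrite -normc_gt0 (lt_trans _ z1).
pose r := normc z.
have key K : normc (cauchy_tr nu z - z / D%:R * \sum_(k < K) pp_term D ppoly z k) <=
    2 * (r ^- (qpow K - 2) / (r - 1)).
  by rewrite partial_sum_ppE//; exact: (@cauchy_tr_expansion R nu nuA.1 nuA.2 z r z1 erefl _).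
have r1 : 1 < r by exact: z1.
have rV : `|r^-1| < 1 by rewrite ger0_norm ?invf_lt1 ?invr_ge0 ?(lt_trans ltr01)// ltW ?(lt_trans ltr01).
have rm : 0 < r - 1 by rewrite subr_gt0.
have small e : 0 < e -> \forall K \near \oo, 2 * (r ^- (qpow K - 2) / (r - 1)) <= e.
  move=> e0; have := cvg_expr rV; move/cvgr0Pnorm_lt => /(_ (e * (r - 1) / 2)).
  rewrite divr_gt0 ?mulr_gt0// => /(_ isT); apply: filterS => K HK.
  rewrite mulrA ler_pdivrMr// mulrC -ler_pdivlMr//; apply: le_trans (ltW HK).
  rewrite -exprVn ger0_norm ?exprn_ge0 ?invr_ge0 ?(le_trans ler01 (ltW r1))//.
  apply: ler_wiXn2l; rewrite ?invr_ge0 ?invf_le1 ?(le_trans ler01 (ltW r1)) ?(lt_trans ltr01 r1) ?(ltW r1)//.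
  (* Hence the order 2 D^K - 2 is at least K. *)
  have : (K < D ^ K)%N by apply: ltn_expl; rewrite leq_pmulr.
  by rewrite /qpow; lia.
split; apply/cvgrPdist_le => e e0; apply: filterS (small e e0) => K hK.
- by rewrite -ReN -ReD (le_trans (ler_Re_normc _))// (le_trans (key K)).
- by rewrite -ImN -ImD (le_trans (ler_Im_normc _))// (le_trans (key K)).
Qed.

End nu_pp.

(** * Asymptotic variance *)

Section circle_norm.
Context {R : realType}.
Local Notation leb := (@lebesgue_measure R).
Local Notation Rm := (measurableTypeR R).
Local Notation J0 := (circ 0 : set Rm).

(* [tau r N] bounds on [|z| = r] the remainder of order [N] in the expansion of
   the Beurling transform. *)
Definition tau (r : R) (N : nat) : R :=
  2 * (r ^- N * (N%:R / (r - 1) + ((r - 1) ^+ 2)^-1)).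

Lemma bernoulli_le (x : R) n : 0 <= x -> 1 + n%:R * x <= (1 + x) ^+ n.
Proof.
move=> x0; elim: n => [|n IH]; first by rewrite mul0r addr0 expr0.
rewrite exprS; apply: (@le_trans _ _ ((1 + x) * (1 + n%:R * x))); last first.
  by rewrite ler_wpM2l// addr_ge0.
have h : 0 <= n%:R * x * x by rewrite !mulr_ge0.
rewrite -natr1; nra.
Qed.

Lemma tau_ge0 (r : R) N : 1 < r -> 0 <= tau r N.
Proof.
move=> r1; have r0 : 0 <= r by apply: ltW (lt_trans ltr01 r1).
have rm : 0 <= r - 1 by rewrite subr_ge0 ltW.
by rewrite /tau mulr_ge0// mulr_ge0 ?invr_ge0 ?exprn_ge0// addr_ge0 ?divr_ge0 ?invr_ge0 ?sqr_ge0.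
Qed.

(** Writing r = s^2 splits r^-N into two halves: one absorbs the factor N, by Bernoulli's inequality
    N (s - 1) <= s^N, and the other tends to 0. *)
Lemma tau_cvg (r : R) : 1 < r -> tau r N @[N --> \oo] --> 0.
Proof.
move=> r1; pose s := Num.sqrt r.
have r0 : 0 <= r by apply: ltW (lt_trans ltr01 r1).
have s1 : 1 < s by rewrite -[ltLHS]sqrtr1 ltr_sqrt ?(lt_trans ltr01 r1).
have s0 : 0 < s by apply: lt_trans s1.
have sm : 0 < s - 1 by rewrite subr_gt0.
have rm : 0 < r - 1 by rewrite subr_gt0.
have sE : s ^+ 2 = r by rewrite sqr_sqrtr.
pose C := 2 * ((s - 1)^-1 / (r - 1) + ((r - 1) ^+ 2)^-1).
have C0 : 0 <= C.
  by rewrite mulr_ge0// addr_ge0 ?divr_ge0 ?invr_ge0 ?sqr_ge0 ?(ltW sm) ?(ltW rm).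
have sN N : 1 <= s ^+ N by rewrite exprn_ege1// ltW.
have le1 N : tau r N <= C * s^-1 ^+ N.
  rewrite /tau /C -mulrA ler_pM2l// -sE -exprM mulnC exprM -exprVn expr2 mulrC mulrA.
  rewrite exprVn ler_wpM2r ?invr_ge0 ?exprn_ge0 ?(ltW s0)//.
  rewrite mulrDl lerD//.
    rewrite mulrAC ler_wpM2r ?invr_ge0 ?sE ?(ltW rm)//.
    rewrite ler_pdivrMr ?exprn_gt0// mulrC ler_pdivlMr//.
    have := @bernoulli_le (s - 1) N (ltW sm).
    have -> : 1 + (s - 1) = s by ring.
    by apply: le_trans; rewrite lerDr ler01.
  by rewrite -[leRHS]mulr1 ler_wpM2l ?invr_ge0 ?sqr_ge0// invf_le1 ?(lt_le_trans ltr01).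
apply: (@squeeze_cvgr _ _ _ _ (fun=> 0) (fun N => C * s^-1 ^+ N)).
- by apply: nearW => N; rewrite tau_ge0// le1.
- exact: cvg_cst.
- rewrite -[X in _ --> X](mulr0 C); apply: cvgM; first exact: cvg_cst.
  by apply: cvg_expr; rewrite ger0_norm ?invr_ge0 ?(ltW s0)// invf_lt1.
Qed.

(** Applied in both directions to the Beurling transform and its partial sums. *)
Lemma Rint_sqr_le (f g : Rm -> R[i]) (B e x : R) : 0 < x -> 0 <= e ->
  cmeasurable_on J0 f -> cmeasurable_on J0 g ->
  (forall t, normc (f t) <= B) -> (forall t, normc (g t) <= B) ->
  (forall t, normc (f t - g t) <= e) ->
  \int[leb]_(t in J0) normc (f t) ^+ 2 <=
  (1 + x) * (\int[leb]_(t in J0) normc (g t) ^+ 2) + (1 + x^-1) * (2 * pi) * e ^+ 2.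
Proof.
move=> x0 e0 mf mg fB gB fg.
have mJ := measurable_circ 0 : measurable J0.
have fJ := lebesgue_circ_lty 0 : (leb J0 < +oo)%E.
have i2 (h : Rm -> R[i]) : cmeasurable_on J0 h -> (forall t, normc (h t) <= B) ->
    leb.-integrable J0 (EFin \o (fun t => normc (h t) ^+ 2)).
  move=> mh hB; apply: (integrable_le (B := B ^+ 2) mJ fJ).
    by apply: measurable_funX; exact: cmeasurable_on_normc.
  move=> t _; rewrite ger0_norm ?sqr_ge0// ler_pXn2r ?nnegrE ?normc_ge0//.
  exact: le_trans (normc_ge0 _) (hB t).
have ig := i2 _ mg gB.
have igZ : leb.-integrable J0 (EFin \o (fun t => (1 + x) * normc (g t) ^+ 2)).
  have := integrableZl mJ (1 + x) ig.
  by apply: eq_integrable => // t _ /=; rewrite EFinM.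
have ic : leb.-integrable J0 (EFin \o (fun=> (1 + x^-1) * e ^+ 2)).
  by apply: (integrable_le (B := `|(1 + x^-1) * e ^+ 2|) mJ fJ).
have -> : (1 + x^-1) * (2 * pi) * e ^+ 2 = \int[leb]_(t in J0) ((1 + x^-1) * e ^+ 2).
  rewrite Rintegral_cst// (_ : fine _ = 2 * pi); last exact: (congr1 fine (lebesgue_circ 0)).
  by rewrite mulrAC.
rewrite -RintegralZl// -RintegralD//; apply: le_Rintegral => //.
- exact: i2.
- have := integrableD mJ igZ ic.
  by apply: eq_integrable => // t _ /=; rewrite EFinD.
move=> t _; rewrite -{1}(subrK (g t) (f t)) addrC.
apply: (le_trans (sqr_normcD _ _ x0)); rewrite lerD2l ler_wpM2l//.
  by rewrite addr_ge0 ?invr_ge0 ?(ltW x0).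
by rewrite ler_pXn2r ?nnegrE ?normc_ge0.
Qed.

Variable f : R[i] -> R[i].
Hypotheses (mf : cmeasurable f) (fD : bounded_by_chiD f).
Variable r : R.
Hypothesis r1 : 1 < r.

Let r0 : 0 < r. Proof. exact: lt_trans ltr01 r1. Qed.

(* Up to sign, [acoef n] is the modulus of the coefficient of [z^-(n+2)] in the
   expansion of the Beurling transform at infinity. *)
Definition acoef (h : R[i] -> R[i]) (n : nat) : R := n.+1%:R / pi * normc (moment h n).

Lemma acoef_ge0 h n : 0 <= acoef h n.
Proof. by apply: mulr_ge0 (normc_ge0 _); apply: divr_ge0 => //; exact: pi_ge0. Qed.

Definition cnorm2 (h : R[i] -> R[i]) (s : R) : R :=
  \int[leb]_(t in J0) normc (beurling h (s%:C * cis t)) ^+ 2.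

Let gN N (t : Rm) : R[i] := \sum_(n < N)
  (- ((pi^-1)%:C * (n.+1%:R * moment f n / (r ^+ n.+2)%:C))) * cis ((- n.+2%:Z)%:~R * t).

Let zr t : normc (r%:C * cis t) = r.
Proof. by rewrite normc_rcis gtr0_norm. Qed.

Let gNE N t : normc (beurling f (r%:C * cis t) - gN N t) <= tau r N.
Proof.
have := beurling_expansion mf fD r1 (zr t) N.
rewrite (_ : (pi^-1)%:C * _ = - gN N t)//.
rewrite /gN -sumrN mulr_sumr; apply: eq_bigr => n _; rewrite mulNr opprK.
rewrite -[RHS]mulrA; congr (_ * _).
rewrite exprMn invfM -rmorphXn/= -!mulrA; congr (_ * (_ * (_ * _))).
rewrite cisX rmorphN/= mulNr cisN; apply: (mulfI (cis_neq0 (n.+2%:R * t))).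
by rewrite mulfV ?cis_neq0// -pmulrn mulc_conj normc_cis expr1n.
Qed.

Let mgN N : cmeasurable_on J0 (gN N).
Proof.
apply: cmeasurable_on_sum => n _; apply: cmeasurable_onM.
  exact: cmeasurable_on_cst.
exact: (cmeasurable_onS measurableT (@subsetT _ _) (cmeasurable_cis _)).
Qed.

Let cvg_part (P : R[i] -> R) (t : Rm) : (forall z w, P (z - w) = P z - P w) ->
  (forall z, `|P z| <= normc z) ->
  P (gN N t) @[N --> \oo] --> P (beurling f (r%:C * cis t)).
Proof.
move=> PB Pn; apply/cvgrPdist_le => e e0.
have /cvgr0Pnorm_le /(_ _ e0) := tau_cvg r1; apply: filterS => N tN.
rewrite -PB; apply: (le_trans (Pn _)); apply: (le_trans (gNE N t)).
exact: le_trans (ler_norm _) tN.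
Qed.

(** [beurling] being defined by a limit, its measurability on the circle comes from the convergence
    of the trigonometric polynomials [gN]. *)
Let mbeurling : cmeasurable_on J0 (fun t => beurling f (r%:C * cis t)).
Proof.
split.
- apply: (@measurable_fun_cvg _ _ _ _ (fun N t => Re (gN N t))) => [N|t _].
    exact: (mgN N).1.
  by apply: cvg_part => [z w|]; [rewrite ReD ReN|exact: ler_Re_normc].
- apply: (@measurable_fun_cvg _ _ _ _ (fun N t => Im (gN N t))) => [N|t _].
    exact: (mgN N).2.
  by apply: cvg_part => [z w|]; [rewrite ImD ImN|exact: ler_Im_normc].
Qed.

Let beurling_le t : normc (beurling f (r%:C * cis t)) <= tau r 0.
Proof. by have := gNE 0 t; rewrite /gN big_ord0 subr0. Qed.

Let gN_le N t : normc (gN N t) <= tau r 0 + tau r N.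
Proof.
rewrite -[gN N t](subrK (beurling f (r%:C * cis t))) addrC.
apply: (le_trans (ler_normcD _ _)); apply: lerD; first exact: beurling_le.
by rewrite -opprB normc_oppr gNE.
Qed.

Let gN_norm N : \int[leb]_(t in J0) normc (gN N t) ^+ 2 =
  2 * pi * \sum_(n < N) (acoef f n / r ^+ n.+2) ^+ 2.
Proof.
rewrite /gN (@parseval _ _ _ (fun n : 'I_N => - n.+2%:Z)); last first.
  by move=> i j /oppr_inj/eqP; rewrite eqz_nat => /eqP[]/val_inj.
congr (_ * _); apply: eq_bigr => n _; congr (_ ^+ 2).
rewrite normc_oppr Normc.normcM Normc.normcM Normc.normcM normc_nat Normc.normcV !normc_real.
rewrite ger0_norm ?invr_ge0 ?pi_ge0// ger0_norm ?exprn_ge0 ?(ltW r0)//.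
by rewrite /acoef !mulrA; congr (_ * _ / _); rewrite mulrC.
Qed.

Lemma circle_intE : circle_int (beurling f) r = (r * cnorm2 f r)%:E.
Proof.
have mJ := measurable_circ 0 : measurable J0.
have fJ := lebesgue_circ_lty 0 : (leb J0 < +oo)%E.
have zE t : (r * cos t) +i* (r * sin t) = r%:C * cis t.
  by apply: complex_eqP; rewrite ?ReM ?ImM /cis/=; ring.
have mn : measurable_fun J0 (fun t => normc (beurling f (r%:C * cis t)) ^+ 2).
  by apply: measurable_funX; exact: cmeasurable_on_normc.
have i2 : leb.-integrable J0 (EFin \o (fun t => normc (beurling f (r%:C * cis t)) ^+ 2)).
  apply: (integrable_le (B := tau r 0 ^+ 2) mJ fJ) => // t _.
  by rewrite ger0_norm ?sqr_ge0// ler_pXn2r ?nnegrE ?normc_ge0// tau_ge0.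
have JE : J0 = `]0%R, (2 * pi)%R]%classic by rewrite /circ add0r.
rewrite /circle_int; under eq_integral do rewrite zE.
rewrite -integral_itv_obnd_cbnd; last first.
  apply/measurable_EFinP; rewrite -JE; apply: measurable_funM => //.
rewrite -JE EFinM /cnorm2 /Rintegral fineK; last exact: integrable_fin_num.
rewrite -integralZl//; apply: eq_integral => t _.
by rewrite EFinM muleC.
Qed.

Lemma cnorm2_ge0 : 0 <= cnorm2 f r.
Proof. by apply: Rintegral_ge0 => t _; exact: sqr_ge0. Qed.

(** The remainder costs [tau r N], and the damping factors r^-(n+2) <= 1 are dropped. *)
Lemma cnorm2_le N (x : R) : 0 < x ->
  cnorm2 f r <= (1 + x) * (2 * pi * \sum_(n < N) acoef f n ^+ 2) +
    (1 + x^-1) * (2 * pi) * tau r N ^+ 2.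
Proof.
move=> x0; have tN := tau_ge0 N r1.
have := @Rint_sqr_le _ (gN N) (tau r 0 + tau r N) (tau r N) x x0 tN mbeurling (mgN N).
move=> /(_ _ (gN_le N) (gNE N)); rewrite gN_norm => h.
apply: (le_trans (h _)).
  by move=> t; apply: (le_trans (beurling_le t)); rewrite lerDl.
rewrite lerD2r ler_wpM2l ?addr_ge0 ?(ltW x0)// ler_wpM2l ?mulr_ge0 ?pi_ge0//.
apply: ler_sum => n _; have a0 := acoef_ge0 f n.
have rn : 0 < r ^+ n.+2 by rewrite exprn_gt0.
have q0 : 0 <= acoef f n / r ^+ n.+2 by apply: divr_ge0 a0 (ltW rn).
have qa : acoef f n / r ^+ n.+2 <= acoef f n.
  by rewrite ler_pdivrMr// ler_peMr// exprn_ege1// ltW.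
by rewrite !expr2 ler_pM.
Qed.

(** The sum is compared with one of order N' >= N; N' tends to infinity, which kills the remainder,
    and then x tends to 0. *)
Lemma cnorm2_ge N :
  2 * pi * \sum_(n < N) (acoef f n / r ^+ n.+2) ^+ 2 <= cnorm2 f r.
Proof.
set S := leLHS.
have mono N' : (N <= N')%N -> S <= 2 * pi * \sum_(n < N') (acoef f n / r ^+ n.+2) ^+ 2.
  move=> NN'; rewrite ler_wpM2l ?mulr_ge0 ?pi_ge0//.
  rewrite (big_ord_widen _ (fun n : nat => (acoef f n / r ^+ n.+2) ^+ 2) NN').
  by rewrite big_mkcond/=; apply: ler_sum => n _; case: ifP => // _; exact: sqr_ge0.
have step x N' : 0 < x -> (N <= N')%N ->
    S <= (1 + x) * cnorm2 f r + (1 + x^-1) * (2 * pi) * tau r N' ^+ 2.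
  move=> x0 NN'; apply: (le_trans (mono _ NN')); rewrite -gN_norm.
  have tN := tau_ge0 N' r1.
  apply: (@Rint_sqr_le _ _ (tau r 0 + tau r N') (tau r N') x x0 tN (mgN N') mbeurling).
  - exact: gN_le.
  - by move=> t; apply: (le_trans (beurling_le t)); rewrite lerDl.
  - by move=> t; rewrite -opprB normc_oppr gNE.
have lim1 x : 0 < x -> S <= (1 + x) * cnorm2 f r.
  move=> x0; pose c := (1 + x^-1) * (2 * pi).
  have c0 : c * tau r N' ^+ 2 @[N' --> \oo] --> 0.
    rewrite -[X in _ --> X](mulr0 c); apply: cvgM; first exact: cvg_cst.
    rewrite -[X in _ --> X](mulr0 0); under eq_fun do rewrite expr2.
    by apply: cvgM; exact: tau_cvg.
  apply/ler_addgt0Pr => e e0; near \oo => N'.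
  apply: (le_trans (step x N' x0 _)); first by near: N'; exact: nbhs_infty_ge.
  rewrite lerD2l; apply: (le_trans (ler_norm _)); rewrite -/c; near: N'.
  by move/cvgr0Pnorm_le : c0 => /(_ _ e0).
have c0 := cnorm2_ge0; apply/ler_addgt0Pr => e e0.
have c1 : 0 < cnorm2 f r + 1 by apply: (le_lt_trans c0); rewrite ltrDl.
(* This x makes x times [cnorm2 f r] at most e. *)
have := lim1 (e / (cnorm2 f r + 1)); rewrite divr_gt0// => /(_ isT).
move/le_trans; apply; rewrite mulrDl mul1r lerD2l mulrAC ler_pdivrMr//.
by rewrite ler_wpM2l ?(ltW e0)// lerDl.
Unshelve. all: by end_near. Qed.

End circle_norm.

(** * From circles to the asymptotic variance *)

Section sigma2_bounds.
Context {R : realType}.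
Implicit Types f : R[i] -> R[i].

Let pi20 : 0 < 2 * pi :> R. Proof. by rewrite mulr_gt0 ?pi_gt0. Qed.

Lemma norm_ln_gt0 (r : R) : 1 < r < 2 -> 0 < `|ln (r - 1)|.
Proof.
move=> /andP[r1 r2]; rewrite normr_gt0 lt_eqF// ln_lt0// subr_gt0 r1/=.
by rewrite ltrBlDr.
Qed.

(** If the limsup exceeds x, so does the supremum over every right neighbourhood of 1, hence some
    value there; e < 1 keeps the logarithm from vanishing. *)
Lemma sigma2_gt f (x e : R) : admissible f -> (x%:E < sigma2 (beurling f))%E ->
  0 < e -> e < 1 -> exists r, [/\ 1 < r, r < 1 + e &
    x * (2 * pi) * `|ln (r - 1)| < r * cnorm2 f r].
Proof.
move=> [mf fD] xs e0 e1.
move: xs; rewrite /sigma2; set F := (fun r : R => _).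
rewrite -lte_pdivrMl ?invr_gt0// invrK -EFinM => xs.
have : ((2 * pi * x)%:E < ereal_sup (F @` `]1%R, (1 + e)%R[))%E.
  apply: (lt_le_trans xs); apply: ereal_inf_lbound; exists `]1%R, (1 + e)%R[%classic => //.
  near=> r; rewrite /= in_itv/=; apply/andP; split; near: r; first exact: nbhs_right_gt.
  by apply: nbhs_right_lt; rewrite ltrDl.
move=> /ereal_sup_gt[_ [r + <-]]; rewrite /= in_itv/= => /andP[r1 re].
rewrite /F circle_intE// -EFinM lte_fin => h; exists r; split => //.
have l0 : 0 < `|ln (r - 1)| by apply: norm_ln_gt0; rewrite r1 (lt_trans re)//; lra.
by move: h; rewrite [_^-1 * _]mulrC ltr_pdivlMr// (mulrC (2 * pi)).
Unshelve. all: by end_near. Qed.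

Lemma sigma2_ge f (y : R) : admissible f ->
  (forall e, 0 < e -> exists r, [/\ 1 < r, r < 1 + e, r < 2 &
    y * (2 * pi) * `|ln (r - 1)| <= r * cnorm2 f r]) ->
  (y%:E <= sigma2 (beurling f))%E.
Proof.
move=> [mf fD] H; rewrite /sigma2; set F := (fun r : R => _).
rewrite -lee_pdivrMl ?invr_gt0// invrK -EFinM.
apply: le_ereal_inf_tmp => _ [V V1 <-].
have [e e0 eV] := V1.
have [r [r1 re r2 h]] := H e e0.
apply: (@le_trans _ _ (F r)); last first.
  apply: ereal_sup_ubound; exists r => //; apply: eV => //=.
  by rewrite ltr0_norm ?subr_lt0// opprB ltrBlDl.
have l0 : 0 < `|ln (r - 1)| by apply: norm_ln_gt0; rewrite r1.
rewrite /F circle_intE// -EFinM lee_fin [_^-1 * _]mulrC ler_pdivlMr//.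
by rewrite (mulrC (2 * pi)).
Qed.

End sigma2_bounds.

(** * Lower bound for the asymptotic variance of [nu] *)

Section nu_lower_bound.
Context {R : realType}.
Local Notation leb := (@lebesgue_measure R).

Lemma bernoulli_ge (x : R) n : 0 <= x -> x <= 1 -> 1 - n%:R * x <= (1 - x) ^+ n.
Proof.
move=> x0 x1; elim: n => [|n IH]; first by rewrite mul0r subr0 expr0.
rewrite exprS; apply: (@le_trans _ _ ((1 - x) * (1 - n%:R * x))); last first.
  by rewrite ler_wpM2l// subr_ge0.
have h : 0 <= n%:R * x * x by rewrite !mulr_ge0.
rewrite -natr1; nra.
Qed.

Variables (mu : R[i] -> R[i]) (L : nat).
Hypotheses (mm : cmeasurable mu) (muD : bounded_by_chiD mu) (L0 : (0 < L)%N).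
Local Notation nu := (nu mu L).
Local Notation qpow := (qpow L).
Local Notation D := (2 * L)%N.

(** The limit over k of the coefficients [acoef nu] at the orders q M - 2, as [acoef_nu] shows. *)
Definition bcoef (M : nat) : R := M%:R / pi * normc (qmoment mu L M).

Lemma bcoef_ge0 M : 0 <= bcoef M.
Proof. by apply: mulr_ge0 (normc_ge0 _); apply: divr_ge0 => //; exact: pi_ge0. Qed.

(** This is the B of the overview. *)
Definition bsum : R := \sum_(m < L.-1) bcoef m.+1 ^+ 2.

Lemma bsum_ge0 : 0 <= bsum.
Proof. by apply: sumr_ge0 => m _; exact: sqr_ge0. Qed.

Lemma acoef_nu i m : (m < L.-1)%N ->
  acoef nu (qpow i * m.+1 - 2) = (1 - (qpow i * m.+1)%:R^-1) * bcoef m.+1.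
Proof.
move=> mL; rewrite /acoef moment_nu_block// Normc.normcM normc_real /bcoef.
have q0 : (0 < qpow i)%N by exact: qpow_gt0.
have q1 : (1 < qpow i * m.+1)%N.
  by rewrite /qpow -mulnA leq_pmulr// muln_gt0 expn_gt0 muln_gt0 L0.
rewrite ger0_norm ?invr_ge0//.
have -> : (qpow i * m.+1 - 2).+1 = (qpow i * m.+1 - 1)%N by rewrite -subSn// subSS.
rewrite natrB ?(ltnW q1)// natrM.
have a0 : (qpow i)%:R != 0 :> R by rewrite pnatr_eq0 -lt0n.
have b0 : m.+1%:R != 0 :> R by rewrite pnatr_eq0.
have p0 : pi != 0 :> R by rewrite gt_eqF ?pi_gt0.
move: (normc _) ((qpow i)%:R) (m.+1%:R) (pi : R) a0 b0 p0 => x q M p a0 b0 p0.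
by field; rewrite ?a0 ?b0 ?p0.
Qed.

(* On the circle of radius [1 + D^-k] the coefficients of generations [j] to
   [k - j - 1] are damped at most by the factor [1 - 2 D^-j]. *)
Lemma cnorm2_nu_ge (j k : nat) : (0 < j)%N -> (2 * j <= k)%N ->
  2 * pi * ((k - 2 * j)%:R * ((1 - 2 * D%:R^-1 ^+ j) ^+ 4 * bsum)) <=
  cnorm2 nu (1 + D%:R^-1 ^+ k).
Proof.
move=> j0 jk; have nuA := nu_admissible mm muD L0.
have D2 : 2 <= D%:R :> R by rewrite ler_nat leq_pmulr.
have D0 : 0 < D%:R :> R by apply: lt_le_trans D2.
have Dn : D%:R != 0 :> R by rewrite gt_eqF.
have d0 : 0 < D%:R^-1 :> R by rewrite invr_gt0.
have d2 : D%:R^-1 <= 2^-1 :> R by rewrite lef_pV2 ?posrE.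
have d1 : D%:R^-1 <= 1 :> R by apply: (le_trans d2); lra.
set d := D%:R^-1 in d0 d2 d1 *; set x := d ^+ k.
have x0 : 0 < x by rewrite exprn_gt0.
have x1 : x <= 1 by rewrite exprn_ile1// ltW.
have dj : d ^+ j <= 2^-1.
  by rewrite (le_trans _ d2)// -[leRHS]expr1 ler_wiXn2l// ltW.
set c := 1 - 2 * d ^+ j; have c0 : 0 <= c by rewrite /c; lra.
have c1 : c <= 1 by rewrite lerBlDr lerDl mulr_ge0 ?exprn_ge0 ?(ltW d0).
(* Orders N of the generations before K satisfy N <= 2 D^(k-j), so N x <= 2 D^-j. *)
pose K := (k - j)%N.
have [jK kjK jk'] : [/\ (j <= K)%N, (k - 2 * j = K - j)%N & (j <= k)%N].
  by rewrite /K; clear -jk; split; lia.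
have r1 : 1 < 1 + x by rewrite ltrDl.
apply: le_trans (cnorm2_ge nuA.1 nuA.2 r1 (qpow K - 2)).
rewrite ler_wpM2l ?mulr_ge0 ?pi_ge0//.
have -> : \sum_(n < qpow K - 2) (acoef nu n / (1 + x) ^+ n.+2) ^+ 2 =
    \sum_(2 <= N < qpow K) (acoef nu (N - 2) / (1 + x) ^+ N) ^+ 2.
  rewrite (big_addn 0 (qpow K) 2) big_mkord; apply: eq_bigr => n _.
  by rewrite addnK addn2.
rewrite sum_qpow_blocks//; last first.
  move=> N N2 hN; rewrite /acoef moment_nu0 ?Normc.normc0 ?mulr0 ?mul0r ?expr0n//.
  by move=> i M /hN; rewrite -addn2 subnK.
(* The first j generations are dropped, which leaves K - j = k - 2j of them. *)
rewrite -(subnKC jK).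
rewrite big_split_ord/= -[leLHS]add0r; apply: lerD.
  by apply: sumr_ge0 => i _; apply: sumr_ge0 => m _; exact: sqr_ge0.
rewrite kjK mulr_natl -[X in _ *+ X]card_ord -sumr_const; apply: ler_sum => i _.
rewrite /bsum mulr_sumr; apply: ler_sum => m _.
rewrite acoef_nu//; set N := (qpow (j + i) * m.+1)%N.
rewrite (exprM c 2 2 : c ^+ 4 = _) -exprMn.
have b0 := bcoef_ge0 m.+1.
have N0 : (0 < N)%N by rewrite muln_gt0 qpow_gt0.
have r0 : 0 < (1 + x) ^+ N by rewrite exprn_gt0// (lt_trans ltr01).
have DE n : D%:R * d ^+ n.+1 = d ^+ n by rewrite exprS mulVKf.
have DXE n : (D ^ n)%:R * d ^+ n = 1 :> R.
  by rewrite natrX -exprMn divff// expr1n.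
(* The coefficient carries N - 1 in place of N; as N >= D^j, the relative loss is at most D^-j. *)
have h1 : c <= 1 - N%:R^-1.
  rewrite lerD2l lerN2 (@le_trans _ _ (d ^+ j))//; last by rewrite ler_peMl ?exprn_ge0 ?(ltW d0)// ler1n.
  rewrite -[leRHS]invrK lef_pV2 ?posrE ?ltr0n ?invr_gt0 ?exprn_gt0//.
  rewrite /d exprVn invrK -natrX ler_nat /N /qpow expnD.
  by rewrite -!mulnA mulnCA leq_pmulr// !muln_gt0 expn_gt0 muln_gt0 L0.
(* Damping: (1 + x)^-N >= (1 - x)^N >= 1 - N x >= c. *)
have h2 : c <= ((1 + x) ^+ N)^-1.
  have e1 : 1 - x <= (1 + x)^-1.
    by rewrite -[leRHS]mul1r ler_pdivlMr ?(lt_trans ltr01)//; nra.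
  apply: (@le_trans _ _ ((1 - x) ^+ N)); last first.
    by rewrite -exprVn lerXn2r// ?nnegrE ?subr_ge0// invr_ge0 (le_trans ler01 (ltW r1)).
  apply: le_trans (bernoulli_ge N (ltW x0) x1); rewrite lerD2l lerN2.
  have NK : (N <= 2 * D ^ (k - j))%N.
    have iK : (j + i < K)%N by rewrite -ltn_subRL.
    apply: (@leq_trans (qpow (j + i).+1)).
      rewrite qpowS /N leq_mul2l; apply/orP; right.
      by apply: (@leq_trans L); [by apply: ltnW; rewrite -ltn_predRL|rewrite leq_pmull].
    by rewrite /qpow leq_mul2l leq_pexp2l// muln_gt0.
  apply: (@le_trans _ _ ((2 * D ^ (k - j))%:R * x)).
    by rewrite ler_pM2r// ler_nat.
  rewrite natrM -mulrA ler_pM2l// /x -{2}(subnK jk').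
  by rewrite exprD mulrA DXE mul1r.
have le : c ^+ 2 * bcoef m.+1 <= (1 - N%:R^-1) * bcoef m.+1 / (1 + x) ^+ N.
  by rewrite [leRHS]mulrAC ler_wpM2r// expr2; apply: ler_pM.
have p0 : 0 <= c ^+ 2 * bcoef m.+1 by rewrite mulr_ge0 ?sqr_ge0.
by rewrite lerXn2r ?nnegrE// (le_trans p0).
Qed.

(** At r = 1 + D^-k one has |ln (r - 1)| = k ln D, while k - 2j generations contribute c^4 B each,
    with c = 1 - 2 D^-j. First j is fixed so that c^4 B still exceeds y ln D, then k grows until 2j
    is negligible. *)
Lemma sigma2_nu_ge (y : R) : y * ln D%:R < bsum ->
  (y%:E <= sigma2 (beurling nu))%E.
Proof.
move=> yB; apply: sigma2_ge; first exact: nu_admissible.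
move=> e e0.
have D2 : 2 <= D%:R :> R by rewrite ler_nat leq_pmulr.
have D0 : 0 < D%:R :> R by apply: lt_le_trans D2.
have d0 : 0 < D%:R^-1 :> R by rewrite invr_gt0.
have d2 : D%:R^-1 <= 2^-1 :> R by rewrite lef_pV2 ?posrE.
have l0 : 0 < ln D%:R :> R by rewrite ln_gt0// (lt_le_trans _ D2)// ltr1n.
have dc : D%:R^-1 ^+ n @[n --> \oo] --> (0 : R).
  by apply: cvg_expr; rewrite ger0_norm ?(ltW d0)// (le_lt_trans d2)//; lra.
set d := D%:R^-1 in d0 d2 dc *.
have [j [j0 hj]] : exists j, (0 < j)%N /\ y * ln D%:R < (1 - 2 * d ^+ j) ^+ 4 * bsum.
  have : (1 - 2 * d ^+ n) ^+ 4 * bsum @[n --> \oo] --> (1 - 2 * 0) ^+ 4 * bsum.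
    apply: cvgM; last exact: cvg_cst.
    apply: (cvg_comp (fun n => 1 - 2 * d ^+ n) (fun z : R => z ^+ 4) _ (@exprn_continuous R 4 _)).
    apply: cvgB; first exact: cvg_cst.
    by apply: cvgM => //; exact: cvg_cst.
  rewrite mulr0 subr0 expr1n mul1r => /cvgr_gt /(_ _ yB) H.
  near \oo => j; exists j; split; near: j; first exact: nbhs_infty_gt.
  exact: H.
set a := _ * bsum in hj; set b := y * _ in hj.
have ab : 0 < a - b by rewrite subr_gt0.
near \oo => k.
have k0 : (2 * j <= k)%N by near: k; exact: nbhs_infty_ge.
have ke : d ^+ k < e.
  apply: (le_lt_trans (ler_norm _)); near: k.
  by move/cvgr0Pnorm_lt : dc => /(_ _ e0).
(* The threshold is equivalent to k b <= (k - 2j) a. *)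
have kk : 2 * j%:R * a / (a - b) <= k%:R by near: k; exact: nbhs_infty_ger.
have x0 : 0 < d ^+ k by rewrite exprn_gt0.
exists (1 + d ^+ k); split.
- by rewrite ltrDl.
- by rewrite ltrD2l.
- rewrite -natr1 addrC ltrD2r (@le_lt_trans _ _ (2^-1))//; last by lra.
  apply: (le_trans _ d2); rewrite -[leRHS]expr1 ler_wiXn2l ?(ltW d0)//; first by lra.
  by rewrite (leq_trans _ k0)// muln_gt0.
have -> : 1 + d ^+ k - 1 = d ^+ k by ring.
have -> : `|ln (d ^+ k)| = k%:R * ln D%:R.
  rewrite /d exprVn lnV ?posrE ?exprn_gt0// normrN lnXn// -[ln _ *+ k]mulr_natl ger0_norm//.
  by rewrite mulr_ge0// ltW.
apply: (@le_trans _ _ (cnorm2 nu (1 + d ^+ k))); last first.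
  rewrite ler_peMl//; last by rewrite lerDl ltW.
  by apply: cnorm2_ge0.
apply: le_trans (cnorm2_nu_ge j0 k0); rewrite -/d -/a natrB// [(2 * j)%:R]natrM.
have -> : y * (2 * pi) * (k%:R * ln D%:R) = 2 * pi * (k%:R * b) by rewrite /b; ring.
rewrite ler_wpM2l ?mulr_ge0 ?pi_ge0//.
by move: kk; rewrite ler_pdivrMr//; lra.
Unshelve. all: by end_near. Qed.

End nu_lower_bound.

(** * Upper bound for the coefficients of [mu] *)

Section fundamental_annulus.
Context {R : realType}.
Local Notation leb := (@lebesgue_measure R).
Local Notation Rm := (measurableTypeR R).
Local Notation I01 := (`]0%R, 1%R[%classic : set Rm).

Variables (mu : R[i] -> R[i]) (L : nat).
Hypotheses (mm : cmeasurable mu) (muD : bounded_by_chiD mu) (L0 : (0 < L)%N).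
Local Notation D := (2 * L)%N.
Local Notation fundset := (fundset L : set Rm).

(** One integrand for both coefficients: over []0, 1[] its integral bounds [acoef mu (M - 2)], with
    M in place of M - 1, and over [fundset] it gives [bcoef] up to the Fejer weight. *)
Definition wmode (M : nat) (s : Rm) : R[i] := (2 * M%:R * s ^+ M.-1)%:C * mode mu M s.

Lemma cmeasurable_wmode M : cmeasurable_on setT (wmode M).
Proof.
apply: cmeasurable_onM; last exact: cmeasurable_mode.
by apply: cmeasurable_on_real; apply: measurable_funM => //; exact: measurable_funX.
Qed.

Lemma normc_wmode M (s : R) : 0 <= s -> normc (wmode M s) = 2 * M%:R * s ^+ M.-1 * normc (mode mu M s).
Proof. by move=> s0; rewrite Normc.normcM normc_real ger0_norm// !mulr_ge0 ?exprn_ge0. Qed.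

Lemma cintegrable_wmode (E : set Rm) M : measurable E -> E `<=` I01 ->
  cintegrable leb E (wmode M).
Proof.
move=> mE EI; apply: (@cintegrableS _ _ _ leb E I01 _ mE (measurable_unit_ring) EI).
apply: (bounded_cintegrable (B := 2 * M%:R) (measurable_unit_ring) (@unit_itv_lty R)).
  by apply: (cmeasurable_onS measurableT) => //; exact: cmeasurable_wmode.
move=> s; rewrite /= in_itv/= => /andP[s0 s1]; rewrite normc_wmode ?(ltW s0)//.
rewrite -[leRHS]mulr1 -mulrA ler_wpM2l//.
by apply: mulr_ile1; rewrite ?exprn_ge0 ?normc_ge0 ?(ltW s0) ?exprn_ile1 ?(ltW s0) ?(ltW s1) ?normc_mode_le1.
Qed.

Lemma cint_wmode (E : set Rm) M : measurable E -> E `<=` I01 ->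
  cint leb E (wmode M) =
  (2 * M%:R)%:C * cint leb E (fun s => (s ^+ M.-1)%:C * mode mu M s).
Proof.
move=> mE EI; rewrite -cintZ//; last first.
  apply: (@cintegrableS _ _ _ leb E I01 _ mE (measurable_unit_ring) EI).
  apply: (bounded_cintegrable (B := 1) (measurable_unit_ring) (@unit_itv_lty R)).
    apply: (cmeasurable_onS measurableT) => //; apply: cmeasurable_onM; last exact: cmeasurable_mode.
    by apply: cmeasurable_on_real; exact: measurable_funX.
  move=> s; rewrite /= in_itv/= => /andP[s0 s1].
  rewrite Normc.normcM normc_real ger0_norm ?exprn_ge0 ?(ltW s0)//.
  by apply: mulr_ile1; rewrite ?exprn_ge0 ?normc_ge0 ?(ltW s0) ?exprn_ile1 ?(ltW s0) ?(ltW s1) ?normc_mode_le1.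
by apply: eq_cint => s _; rewrite /wmode [RHS]mulrA -[X in _ = X * _]rmorphM.
Qed.

Lemma acoef_le n : acoef mu n <= normc (cint leb I01 (wmode n.+2)).
Proof.
rewrite cint_wmode//.
rewrite /acoef (momentE mm muD) !Normc.normcM !normc_real.
rewrite !ger0_norm ?mulr_ge0 ?pi_ge0// mulrA ler_wpM2r ?normc_ge0//.
have p0 : pi != 0 :> R by rewrite gt_eqF ?pi_gt0.
have -> : n.+1%:R / pi * (2 * pi) = 2 * n.+1%:R :> R by rewrite (mulrC 2) mulrA divfK// mulrC.
by rewrite ler_pM2l// ler_nat.
Qed.

Lemma fundset_sub : fundset `<=` I01.
Proof. by move=> s h; rewrite /= in_itv/= (fund_gt0 h) (fund_lt1 h). Qed.

Lemma bcoefE M : (M <= L)%N ->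
  bcoef mu L M = (1 - M%:R / L%:R) * normc (cint leb fundset (wmode M)).
Proof.
move=> ML; rewrite cint_wmode; [|exact: measurable_fund|exact: fundset_sub].
rewrite /bcoef /qmoment !Normc.normcM !normc_real.
rewrite !ger0_norm ?mulr_ge0 ?pi_ge0 ?invr_ge0// natrB//.
have p0 : pi != 0 :> R by rewrite gt_eqF ?pi_gt0.
have l0 : L%:R != 0 :> R by rewrite pnatr_eq0 -lt0n.
move: (normc _) (L%:R : R) (M%:R : R) (pi : R) l0 p0 => x l m p l0 p0.
by field; rewrite ?l0 ?p0.
Qed.

(* Bessel's inequality in the angle, integrated over the radii. *)
Lemma sum_wmode_le (E : set Rm) (N : nat) (B x : R) :
  measurable E -> E `<=` I01 -> (leb E <= x%:E)%E -> 0 < x -> 0 <= B ->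
  (forall n s, (n < N)%N -> E s -> 2 * n.+2%:R * s ^+ n.+1 <= B) ->
  \sum_(n < N) normc (cint leb E (wmode n.+2)) ^+ 2 <= (B * x) ^+ 2.
Proof.
move=> mE EI Ex x0 B0 wB.
apply: (@l2_cint_le _ _ _ leb N E (fun n => wmode n.+2)) => //.
  by move=> n; apply: (cmeasurable_onS measurableT) => //; exact: cmeasurable_wmode.
move=> s Es; have s0 : 0 <= s by have := EI _ Es; rewrite /= in_itv/= => /andP[/ltW].
have injk : injective (fun n : 'I_N => n.+2%:Z).
  by move=> i j /eqP; rewrite eqz_nat => /eqP[]/val_inj.
have bm := bessel_mode mm muD s injk.
apply: (@le_trans _ _ (\sum_(n < N) B ^+ 2 * normc (mode mu n.+2 s) ^+ 2)).
  apply: ler_sum => n _; rewrite normc_wmode// exprMn ler_wpM2r ?sqr_ge0//.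
  by rewrite lerXn2r ?nnegrE ?mulr_ge0 ?exprn_ge0// wB.
by rewrite -mulr_sumr -[leRHS]mulr1 ler_wpM2l ?sqr_ge0.
Qed.

Definition inner : set Rm := `]0%R, (2^-1)%R[%classic.
Definition outer : set Rm := I01 `&` [set s | 2^-1 <= s ^+ D].

Lemma measurable_outer : measurable outer.
Proof.
apply: measurableI; first exact: measurable_unit_ring.
rewrite -[X in measurable X]setTI.
apply: (measurable_fun_ler (f := fun _ : Rm => 2^-1) (g := fun s : Rm => s ^+ D)) => //.
Qed.

(** Bernoulli's inequality for 1 / s gives 1 + D (1 / s - 1) <= s^-D <= 2, whence 1 - s <= 1 / s - 1
    <= 1 / D. *)
Lemma lebesgue_outer : (leb outer <= (D%:R^-1)%:E)%E.
Proof.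
have D0 : (0 < D)%N by rewrite muln_gt0.
have Dr : 0 < D%:R :> R by rewrite ltr0n.
apply: (@le_trans _ _ (leb `[(1 - D%:R^-1)%R, 1%R[%classic)).
  apply: le_measure; rewrite ?inE; [exact: measurable_outer|exact: measurable_itv|].
  move=> s [] /=; rewrite !in_itv/= => /andP[s0 s1] sD; rewrite s1 andbT.
  have V1 : 1 <= s^-1 by rewrite invf_ge1// ltW.
  have := @bernoulli_le R (s^-1 - 1) D; rewrite subr_ge0 => /(_ V1).
  have -> : 1 + (s^-1 - 1) = s^-1 by ring.
  rewrite exprVn => h.
  have : (s ^+ D)^-1 <= 2 by rewrite -[leRHS]invrK lef_pV2 ?posrE ?exprn_gt0// invr_gt0.
  move/(le_trans h); rewrite -lerBrDl.
  have -> : 2 - 1 = 1 :> R by ring.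
  rewrite mulrC -ler_pdivlMr// mul1r => h2.
  have : 1 - s <= s^-1 - 1.
    have -> : s^-1 - 1 = (1 - s) / s by field; rewrite gt_eqF.
    by rewrite ler_peMr// subr_ge0 ltW.
  move: h2; move: (s^-1) (D%:R^-1) => a b; lra.
rewrite lebesgue_measure_itv/= lte_fin; case: ifP => _; last by rewrite lee_fin invr_ge0.
by rewrite -EFinD lee_fin opprB addrCA subrr addr0.
Qed.

Lemma lebesgue_inner : (leb inner <= (2^-1)%:E)%E.
Proof.
rewrite /inner lebesgue_measure_itv/= lte_fin invr_gt0 ltr0n/=.
by rewrite -EFinD subr0.
Qed.

Lemma cint_unit_split M :
  cint leb I01 (wmode M) = cint leb fundset (wmode M) +
    (cint leb inner (wmode M) + cint leb outer (wmode M)).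
Proof.
have mf : measurable fundset by exact: measurable_fund.
have mi : measurable inner by exact: measurable_itv.
have mo := measurable_outer.
have h2 : 2^-1 < 1 :> R by rewrite invf_lt1// ltr1n.
have D0 : (0 < D)%N by rewrite muln_gt0.
have IE : I01 = fundset `|` (inner `|` outer).
  apply/seteqP; split=> s; last first.
    case=> [/fundset_sub//|[|[]//]]; rewrite /inner /= !in_itv/= => /andP[-> s2]; exact: lt_trans s2 h2.
  move=> Is; have := Is; rewrite /= in_itv/= => /andP[s0 s1].
  have [s2|s2] := ltP s 2^-1; first by right; left; rewrite /inner /= in_itv/= s0.
  have [sD|sD] := ltP (s ^+ D) 2^-1; first by left; rewrite /fundset /= /fund s2.
  by right; right; split.
have d2 : [disjoint inner & outer].
  apply/disj_setPS => s []; rewrite /inner /= in_itv/= => /andP[s0 s2] [_ sD].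
  have s1 := ltW (lt_trans s2 h2).
  move: sD; rewrite /= leNgt => /negP; apply; apply: le_lt_trans s2.
  by rewrite -[leRHS]expr1 ler_wiXn2l// ltW.
have d1 : [disjoint fundset & inner `|` outer].
  apply/disj_setPS => t -[/andP[f1 f2] [|[_]]] /=.
    by rewrite /inner /= in_itv/= (ltNge t) f1 andbF.
  by rewrite leNgt f2.
have mio : measurable (inner `|` outer) by exact: measurableU.
have iI := @cintegrable_wmode _ M (measurable_unit_ring) (@subset_refl _ I01).
rewrite IE in iI *; rewrite cint_setU//; congr (_ + _); apply: cint_setU => //.
by apply: cintegrableS iI => //; exact: measurableU.
Qed.

(** Each of the two remaining pieces contributes at most 1; separating them doubles both, whence the
    4. *)
Lemma sum_acoef_le (N : nat) (x : R) : (N < L)%N -> 0 < x ->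
  \sum_(n < N) acoef mu n ^+ 2 <=
  (1 + x) * (\sum_(n < N) normc (cint leb fundset (wmode n.+2)) ^+ 2) + (1 + x^-1) * 4.
Proof.
move=> NL x0.
have Dr : 0 < D%:R :> R by rewrite ltr0n muln_gt0.
have hin : \sum_(n < N) normc (cint leb inner (wmode n.+2)) ^+ 2 <= 1.
  (* The weight is at most 2, because M <= 2^(M-1) bounds M s^(M-1) by 1 for s < 1/2; the length is
     1/2. *)
  have -> : 1 = (2 * 2^-1) ^+ 2 :> R by rewrite divff// expr1n.
  apply: sum_wmode_le => //.
  - exact: measurable_itv.
  - move=> s; rewrite /inner /= !in_itv/= => /andP[-> s2] /=.
    by rewrite (lt_trans s2)// invf_lt1// ltr1n.
  - exact: lebesgue_inner.
  - move=> n s _; rewrite /inner /= in_itv/= => /andP[s0 s2].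
    rewrite -mulrA ler_piMr//.
    apply: (@le_trans _ _ (n.+2%:R * 2^-1 ^+ n.+1)).
      by rewrite ler_wpM2l// lerXn2r ?nnegrE ?(ltW s0) ?(ltW s2)// invr_ge0.
    rewrite exprVn ler_pdivrMr ?exprn_gt0// mul1r -natrX ler_nat.
    exact: ltn_expl.
have hout : \sum_(n < N) normc (cint leb outer (wmode n.+2)) ^+ 2 <= 1.
  (* Here N < L matters: 2M <= 2L = D, so the width 1 / D compensates the weight. *)
  apply: (@le_trans _ _ ((D%:R * D%:R^-1) ^+ 2)); last by rewrite divff ?expr1n// gt_eqF.
  apply: sum_wmode_le => //.
  - exact: measurable_outer.
  - by move=> s [].
  - exact: lebesgue_outer.
  - by rewrite invr_gt0.
  - move=> n s nN [] /=; rewrite in_itv/= => /andP[s0 s1] _.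
    rewrite -[leRHS]mulr1 ler_pM ?mulr_ge0 ?exprn_ge0 ?(ltW s0)//.
      by rewrite -natrM ler_nat leq_mul2l/=; apply: leq_trans NL.
    by rewrite exprn_ile1 ?(ltW s0) ?(ltW s1).
have xV : 0 <= 1 + x^-1 by rewrite addr_ge0// invr_ge0 ltW.
have -> : 4 = 2 * 1 + 2 * 1 :> R by ring.
apply: (@le_trans _ _ (\sum_(n < N) ((1 + x) * normc (cint leb fundset (wmode n.+2)) ^+ 2 +
    (1 + x^-1) * (2 * normc (cint leb inner (wmode n.+2)) ^+ 2 +
                  2 * normc (cint leb outer (wmode n.+2)) ^+ 2)))).
  apply: ler_sum => n _.
  apply: (@le_trans _ _ (normc (cint leb I01 (wmode n.+2)) ^+ 2)).
    by rewrite lerXn2r ?nnegrE ?acoef_ge0 ?normc_ge0 ?acoef_le.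
  rewrite cint_unit_split; apply: (le_trans (sqr_normcD _ _ x0)).
  rewrite lerD2l ler_wpM2l//; have := sqr_normcD (cint leb inner (wmode n.+2)) (cint leb outer (wmode n.+2)) ltr01.
  by rewrite invr1.
rewrite big_split/= -!mulr_sumr big_split/= -!mulr_sumr lerD2l ler_wpM2l// lerD//.
  by rewrite ler_wpM2l.
by rewrite ler_wpM2l.
Qed.

(** For M <= N + 1 the Fejer weight is at least 1 - (N + 1) / L, so passing from the integrals over
    [fundset] to [bcoef] costs this factor squared. *)
Lemma sum_acoef_bsum (N : nat) (x : R) : (N.+1 < L)%N -> 0 < x ->
  (1 - N.+1%:R / L%:R) ^+ 2 * \sum_(n < N) acoef mu n ^+ 2 <=
  (1 + x) * bsum mu L + (1 + x^-1) * 4.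
Proof.
move=> NL x0; set c := 1 - _.
have Lr : 0 < L%:R :> R by rewrite ltr0n.
have c0 : 0 <= c by rewrite subr_ge0 ler_pdivrMr// mul1r ler_nat ltnW.
have c1 : c <= 1 by rewrite lerBlDr lerDl divr_ge0.
have xV : 0 <= 1 + x^-1 by rewrite addr_ge0// invr_ge0 ltW.
have h := sum_acoef_le (ltnW NL) x0.
apply: (le_trans (ler_wpM2l (sqr_ge0 c) h)); rewrite mulrDr; apply: lerD; last first.
  by rewrite ler_piMl ?mulr_ge0// exprn_ile1.
rewrite mulrCA ler_wpM2l ?addr_ge0 ?(ltW x0)// mulr_sumr.
have NL' : (N.+1 <= L.-1)%N by rewrite -ltnS prednK.
apply: (@le_trans _ _ (\sum_(m < N.+1) bcoef mu L m.+1 ^+ 2)); last first.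
  rewrite /bsum (big_ord_widen _ (fun m : nat => bcoef mu L m.+1 ^+ 2) NL').
  by rewrite big_mkcond/=; apply: ler_sum => n _; case: ifP => // _; exact: sqr_ge0.
(* The term M = 1 would correspond to the order -1; it is dropped. *)
rewrite big_ord_recl -[leLHS]add0r lerD ?sqr_ge0//; apply: ler_sum => n _.
have nL : (n.+2 <= L)%N by rewrite (leq_trans _ NL)// !ltnS ltnW.
rewrite bcoefE// -exprMn /= /bump /=.
rewrite lerXn2r ?nnegrE ?mulr_ge0 ?normc_ge0//.
  by rewrite subr_ge0 ler_pdivrMr// mul1r ler_nat.
rewrite ler_wpM2r ?normc_ge0// lerD2l lerN2 ler_wpM2r ?invr_ge0//.
by rewrite ler_nat ltnS.
Qed.

End fundamental_annulus.

(** * Choice of L *)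

Section comparison.
Context {R : realType}.

Lemma lte_between (a b : \bar R) : (a < b)%E ->
  exists x : R, (a < x%:E)%E /\ (x%:E < b)%E.
Proof.
case: a => [a||]; case: b => [b||] //.
- rewrite lte_fin => ab; exists ((a + b) / 2); rewrite !lte_fin; lra.
- by move=> _; exists (a + 1); rewrite lte_fin ltrDl ltr01 ltry.
- by move=> _; exists (b - 1); rewrite ltNyr lte_fin ltrBlDr ltrDl ltr01.
- by move=> _; exists 0; rewrite ltNyr ltry.
Qed.

Lemma expR_half_le (y : R) : 0 <= y -> y <= 1 -> expR (y / 2) <= 1 + y.
Proof.
move=> y0 y1; have h := expR_ge1Dx (- (y / 2)).
have c0 : 0 < 1 - y / 2 by lra.
have : (expR (- (y / 2)))^-1 <= (1 - y / 2)^-1 by rewrite lef_pV2 ?posrE ?expR_gt0.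
rewrite expRN invrK => /le_trans; apply.
by rewrite -[leLHS]mul1r ler_pdivrMr//; nra.
Qed.

(** With u = N y >= 8 l, the bound 1 + y >= e^(y/2) gives (1 + y)^N >= e^(u/4) e^(u/4) >= (u/4)
    y^-2, to be compared with (u + 1) y^-2. Hence the 8: half of the decay absorbs y^-2, the other
    half absorbs u. *)
Lemma tau_le16 (y l : R) (N : nat) : 0 < y -> y <= 1 -> 1 <= l -> l = - ln y ->
  8 * l <= N%:R * y -> tau (1 + y) N <= 16.
Proof.
move=> y0 y1 l1 lE Ny; rewrite /tau; have -> : 1 + y - 1 = y by ring.
set u := N%:R * y in Ny; have u8 : 8 <= u by apply: le_trans Ny; lra.
have rN : u / 4 * (y ^+ 2)^-1 <= (1 + y) ^+ N.
  apply: (@le_trans _ _ (expR (y / 2) ^+ N)); last first.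
    by rewrite lerXn2r ?nnegrE ?expR_ge0 ?addr_ge0 ?(ltW y0)// expR_half_le// ltW.
  rewrite -expRM_natl.
  have -> : (y ^+ 2)^-1 = expR (2 * l).
    by rewrite lE mulrN expRN expRM_natl lnK.
  have -> : N%:R * (y / 2) = u / 4 + u / 4 by rewrite /u; field.
  rewrite expRD ler_pM ?expR_ge0//; first by lra.
    by apply: le_trans (expR_ge1Dx _); lra.
  by rewrite ler_expR; lra.
have yn : y != 0 by rewrite gt_eqF.
have -> : N%:R / y + (y ^+ 2)^-1 = (u + 1) * (y ^+ 2)^-1.
  by rewrite /u; field; rewrite yn.
have v0 : 0 < (y ^+ 2)^-1 by rewrite invr_gt0 exprn_gt0.
move: (y ^+ 2)^-1 v0 rN => v v0 rN.
have r0 : 0 < (1 + y) ^+ N by rewrite exprn_gt0// addr_gt0.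
rewrite mulrCA [leLHS]mulrC ler_pdivrMr//.
move: r0 rN; move: ((1 + y) ^+ N) => r r0 rN.
have h : (u + 1) * v <= u * v * 2 by nra.
have := rN; have -> : u / 4 * v = u * v / 4 by ring.
lra.
Qed.

Variable mu : R[i] -> R[i].
Hypothesis muA : admissible mu.
Let mm := muA.1.
Let muD := muA.2.

(** Five factors 1 + eta are lost: in r <= 1 + eta, in [cnorm2_le], in the Fejer weights through K,
    in [sum_acoef_bsum], and in replacing ln D by l. The additive constants are beaten by taking l
    large. *)
Lemma exists_bsum_gt (x : R) : (x%:E < sigma2 (beurling mu))%E ->
  exists L, (0 < L)%N /\ x * ln (2 * L)%:R < bsum mu L.
Proof.
(* For x < 0 any L works, [bsum] being nonnegative. *)
have [x0 _|x0 xs] := ltP x 0.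
  exists 1%N; split=> //; apply: lt_le_trans (bsum_ge0 _ _).
  by rewrite nmulr_rlt0// ln_gt0// ltr1n.
have [x' [xx' x's]] := lte_between xs; rewrite lte_fin in xx'.
have [eta [eta0 eta1 xeta]] : exists eta : R,
    [/\ 0 < eta, eta < 1 & (1 + eta) ^+ 5 * x < x'].
  have : (1 + e) ^+ 5 * x @[e --> 0^'+] --> (1 + 0) ^+ 5 * x.
    apply: cvg_at_right_filter; apply: cvgM; last exact: cvg_cst.
    apply: (cvg_comp (fun e : R => 1 + e) (fun z : R => z ^+ 5) _ (@exprn_continuous R 5 _)).
    by apply: cvgD; [exact: cvg_cst|exact: cvg_id].
  rewrite addr0 expr1n mul1r => /cvgr_lt /(_ _ xx') H.
  near (0 : R)^'+ => e; exists e; split; near: e => //; first exact: nbhs_right_gt.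
  exact: nbhs_right_lt.
(* K depends on eta only, so ln K stays bounded as r tends to 1. *)
have [K [K1 hK]] : exists K, (1 < K)%N /\ 1 <= (1 + eta) * (1 - K%:R^-1) ^+ 2 :> R.
  near \oo => K; exists K; split; first by near: K; exact: nbhs_infty_gt.
  have K0 : 0 < K%:R :> R by rewrite ltr0n; near: K; exact: nbhs_infty_gt.
  have : 2 * (1 + eta) / eta <= K%:R by near: K; exact: nbhs_infty_ger.
  rewrite ler_pdivrMr// => h.
  have V0 : 0 < K%:R^-1 :> R by rewrite invr_gt0.
  have : 2 * (1 + eta) * K%:R^-1 <= eta by rewrite ler_pdivrMr// [leRHS]mulrC.
  move: (K%:R^-1) V0 => v v0 hv; nra.
have K0 : 0 < K%:R :> R by rewrite ltr0n ltnW.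
(* [C1] collects the additive errors in the bound for x' l, and [C2] the one in the bound for ln D;
   beyond [l0] the gap (x' - (1 + eta)^5 x) l exceeds their combined effect. Taking r - 1 < e^-l0
   ensures l > l0. *)
pose C2 := ln (20 * K%:R / eta).
pose C1 := (1 + eta) ^+ 3 * ((1 + eta^-1) * 4) + (1 + eta) * (1 + eta^-1) * 16 ^+ 2.
pose l0 := Num.max 1 ((C1 + (1 + eta) ^+ 4 * (x * C2)) / (x' - (1 + eta) ^+ 5 * x)).
have em0 : 0 < Num.min eta (expR (- l0)) by rewrite lt_min eta0 expR_gt0.
have em1 : Num.min eta (expR (- l0)) < 1 by rewrite gt_min eta1.
have [r [r1 re hr]] := sigma2_gt muA x's em0 em1.
pose y := r - 1; have y0 : 0 < y by rewrite subr_gt0.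
have rE : r = 1 + y by rewrite /y; ring.
have [ye yl] : y < eta /\ y < expR (- l0).
  by apply/andP; rewrite -lt_min /y ltrBlDl.
have y1 : y <= 1 by apply: ltW (lt_trans ye eta1).
pose l := - ln y; have ll : l0 < l.
  by rewrite /l ltrNr -[ltRHS]expRK ltr_ln ?posrE ?expR_gt0.
have l1 : 1 < l by apply: le_lt_trans ll; rewrite le_max lexx.
have lE : `|ln (r - 1)| = l.
  by rewrite -/y ltr0_norm ?ln_lt0 ?y0 ?(lt_trans ye eta1).
pose N := (Num.trunc (8 * l / y)).+1.
have lp0 : 0 <= 8 * l / y by rewrite divr_ge0 ?(ltW y0)// mulr_ge0//; lra.
have N1 : 8 * l <= N%:R * y by rewrite -ler_pdivrMr// ltW// truncnS_gt.
(* N + 1 is at most 8 l / y + 2, and l / y >= 1. *)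
have N2 : N.+1%:R <= 10 * l / y.
  have /andP[t1 _] := truncn_itv lp0.
  rewrite /N -[X in X%:R]addn2 natrD; have : 1 <= l / y by rewrite ler_pdivlMr// mul1r (le_trans y1)// ltW.
  move: t1; rewrite -!mulrA; move: (l / y) (Num.trunc _)%:R => a b t1 a1; lra.
pose L := (K * N.+1)%N.
have L0 : (0 < L)%N by rewrite muln_gt0 (ltnW K1).
have NL : (N.+1 < L)%N by rewrite -{1}[N.+1]mul1n ltn_pmul2r.
exists L; split => //.
have tN := tau_le16 y0 y1 (ltW l1) erefl N1.
have t0 := tau_ge0 N r1.
have eV : 0 < eta^-1 by rewrite invr_gt0.
have hA := sum_acoef_bsum mm muD L0 NL eta0.
have hc := cnorm2_le mm muD r1 N eta0.
set A := \sum_(n < N) _ in hA hc; set B := bsum mu L in hA *.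
have cE : 1 - N.+1%:R / L%:R = 1 - K%:R^-1 :> R.
  rewrite /L natrM invfM mulrCA divff ?mulr1// pnatr_eq0//.
have A0 : 0 <= A by apply: sumr_ge0 => n _; exact: sqr_ge0.
have hA' : A <= (1 + eta) * ((1 + eta) * B + (1 + eta^-1) * 4).
  rewrite -cE in hK; apply: (@le_trans _ _ ((1 + eta) * ((1 - N.+1%:R / L%:R) ^+ 2 * A))).
    by rewrite mulrA ler_peMl.
  by rewrite ler_wpM2l// addr_ge0// ltW.
have key : x' * l <= (1 + eta) ^+ 4 * B + C1.
  have pp : 0 < 2 * pi :> R by rewrite mulr_gt0 ?pi_gt0.
  have s1 : x' * l * (2 * pi) <= (1 + eta) * cnorm2 mu r.
    rewrite -lE mulrAC; apply: (le_trans (ltW hr)); rewrite ler_wpM2r//.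
      exact: cnorm2_ge0.
    by rewrite rE lerD2l ltW.
  rewrite -(ler_pM2r pp); apply: (le_trans s1).
  rewrite -rE in tN.
  have tt : tau r N ^+ 2 <= 16 ^+ 2 by rewrite lerXn2r ?nnegrE.
  have e1 : 0 <= 1 + eta by rewrite addr_ge0// ltW.
  have e2 : 0 <= 1 + eta^-1 by rewrite addr_ge0// ltW.
  apply: (@le_trans _ _ ((1 + eta) * ((1 + eta) * (2 * pi * ((1 + eta) * ((1 + eta) * B + (1 + eta^-1) * 4))) +
      (1 + eta^-1) * (2 * pi) * 16 ^+ 2))).
    rewrite ler_wpM2l//; apply: (le_trans hc); apply: lerD.
      by rewrite ler_wpM2l// ler_wpM2l// ltW.
    by rewrite ler_wpM2l// mulr_ge0// ltW.
  rewrite /C1 le_eqVlt; apply/orP; left; apply/eqP; ring.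
(* 2L <= 20 K l / y. Inserting eta / eta lets ln (eta l) <= eta l absorb the iterated logarithm. *)
have lnL : ln (2 * L)%:R <= (1 + eta) * l + C2.
  have le1 : (2 * L)%:R <= (20 * K%:R / eta) * (eta * l * y^-1) :> R.
    rewrite /L !natrM.
    have -> : 20 * K%:R / eta * (eta * l * y^-1) = 2 * (K%:R * (10 * l / y)) :> R.
      by field; rewrite ?gt_eqF.
    by rewrite ler_pM2l// ler_pM2l.
  have el0 : 0 < eta * l by rewrite mulr_gt0// (lt_trans ltr01 l1).
  have yV : 0 < y^-1 by rewrite invr_gt0.
  have kk : 0 < 20 * K%:R / eta by rewrite divr_gt0// mulr_gt0.
  apply: (@le_trans _ _ (ln ((20 * K%:R / eta) * (eta * l * y^-1)))).
    rewrite ler_ln ?posrE//; first by rewrite ltr0n muln_gt0.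
    by rewrite mulr_gt0// mulr_gt0.
  have -> : ln (20 * K%:R / eta * (eta * l * y^-1)) = C2 + (ln (eta * l) - ln y).
    by rewrite -lnV ?posrE// -lnM ?posrE// -lnM ?posrE// mulr_gt0.
  have := ltW (ln_sublinear el0); rewrite -/l mulrDl mul1r; lra.
have l2 : C1 + (1 + eta) ^+ 4 * (x * C2) < (x' - (1 + eta) ^+ 5 * x) * l.
  by rewrite [ltRHS]mulrC -ltr_pdivrMr ?subr_gt0//; apply: le_lt_trans ll; rewrite le_max lexx orbT.
have e4 : 0 < (1 + eta) ^+ 4 by rewrite exprn_gt0// addr_gt0.
have h1 : x * ln (2 * L)%:R <= x * ((1 + eta) * l + C2) by rewrite ler_wpM2l.
apply: (le_lt_trans h1); rewrite -(ltr_pM2l e4).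
have -> : (1 + eta) ^+ 4 * (x * ((1 + eta) * l + C2)) =
  (1 + eta) ^+ 5 * x * l + (1 + eta) ^+ 4 * (x * C2) by ring.
move: l2 key; rewrite mulrBl; lra.
Unshelve. all: by end_near. Qed.

End comparison.

Theorem theorem6p2 (R : realType) :
  Sigma2 R =
    ereal_sup [set sigma2 (beurling mu) | mu in
                 [set mu | admissible mu /\ M_ei mu]] /\
  Sigma2 R =
    ereal_sup [set sigma2 (beurling mu) | mu in
                 [set mu | admissible mu /\ M_pp mu]].
Proof.
set Sei := ereal_sup _; set Spp := ereal_sup _.
have le1 : (Sei <= Sigma2 R)%E.
  by apply: ereal_sup_le => _ [mu [muA _] <-]; exists mu.
have le2 : (Spp <= Sei)%E.
  apply: ereal_sup_le => _ [mu [muA [d [d2 [inv _]]]] <-]; exists mu => //.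
  by split => //; exists d.
have le3 : (Sigma2 R <= Spp)%E.
  apply: ge_ereal_sup => _ [mu muA <-].
  (* The values are extended reals, so a real x is inserted strictly between the two sides. *)
  rewrite leNgt; apply/negP => /lte_between[x [Sx xs]].
  have [L [L0 xL]] := exists_bsum_gt muA xs.
  move: Sx; rewrite ltNge => /negP; apply.
  apply: le_trans (sigma2_nu_ge muA.1 muA.2 L0 xL) _.
  apply: ereal_sup_ubound; exists (nu mu L) => //; split.
    exact: nu_admissible muA.1 muA.2 L0.
  exact: nu_pp muA.1 muA.2 L0.
by split; apply/eqP; rewrite eq_le ?le1 ?(le_trans le3 le2) ?le3 ?(le_trans le2 le1).
Qed.
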